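(* Let $(R,\mathfrak m)$ be a Cohen-Macaulay local ring of dimension two with infinite residue field, let $s\geq2$ and let $I_1,\ldots,I_s$ be $\mathfrak m$-primary ideals of $R$. Let $\mathcal F=\{\mathcal F(\underline n)\}_{\underline n\in\mathbb Z^s}$ be an $\underline I$-admissible filtration of ideals in $R$ such that $H^1_{\mathcal R_{++}}(\mathcal R(\mathcal F))_{\underline n}=0$ for all $\underline n\geq\underline 0$. Then the following statements are equivalent. (1) $\mathcal P(\mathcal F)=\mathbb N^s$, i.e. $P_{\mathcal F}(\underline n)=H_{\mathcal F}(\underline n)$ for all $\underline n\geq\underline 0$. (2) $r_{\mathcal A}(\mathcal F)\leq1$ for any good complete reduction $\mathcal A$ of $\mathcal F$. (2') There exists a good complete reduction $\mathcal A$ of $\mathcal F$ such that $r_{\mathcal A}(\mathcal F)\leq1$.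
   Context: Notation: $\mathbb N=\{0,1,2,\ldots\}$, $\lambda$ denotes length over $R$, $e=(1,\ldots,1)\in\mathbb Z^s$, $\underline 0=(0,\dots,0)$; $\underline n\ge\underline m$ means componentwise inequality; $\underline n^+=(\max(n_1,0),\ldots,\max(n_s,0))$; $\underline I=(I_1,\ldots,I_s)$ and $\underline I^{\underline n}=I_1^{n_1}\cdots I_s^{n_s}$, where a nonpositive power of an ideal is $R$. ''For all large $\underline n$'' means for all $\underline n\in\mathbb N^s$ with every $n_i\gg0$. Filtrations: a $\mathbb Z^s$-graded $\underline I$-filtration is a family of ideals $\mathcal F=\{\mathcal F(\underline n)\}_{\underline n\in\mathbb Z^s}$ of $R$ with $\underline I^{\underline n}\subseteq\mathcal F(\underline n)$, $\mathcal F(\underline n)\mathcal F(\underline m)\subseteq\mathcal F(\underline n+\underline m)$, and $\mathcal F(\underline m)\subseteq\mathcal F(\underline n)$ whenever $\underline m\geq\underline n$. It is $\underline I$-admissible if moreover $\mathcal F(\underline n)=\mathcal F(\underline n^+)$ for all $\underline n$ and $\bigoplus_{\underline n\in\mathbb Z^s}\mathcal F(\underline n)\underline t^{\underline n}$ is a finite module over $\bigoplus_{\underline n\in\mathbb Z^s}\underline I^{\underline n}\underline t^{\underline n}$, where $t_1,\dots,t_s$ are indeterminates and $\underline t^{\underline n}=t_1^{n_1}\cdots t_s^{n_s}$. Rees rings: $\mathcal R(\mathcal F)=\bigoplus_{\underline n\in\mathbb N^s}\mathcal F(\underline n)\underline t^{\underline n}$, $\mathcal R(\underline I)=\bigoplus_{\underline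 n\in\mathbb N^s}\underline I^{\underline n}\underline t^{\underline n}$, and $\mathcal R_{++}=\bigoplus_{\underline n\ge e}\underline I^{\underline n}\underline t^{\underline n}$, an ideal of $\mathcal R(\underline I)$. $H^1_{\mathcal R_{++}}(\mathcal R(\mathcal F))$ is the first local cohomology of the $\mathcal R(\underline I)$-module $\mathcal R(\mathcal F)$ with support in $\mathcal R_{++}$; the subscript $\underline n$ denotes the degree $\underline n$ component. $H_{\mathcal F}(\underline n)=\lambda(R/\mathcal F(\underline n))$, and $P_{\mathcal F}$ is the unique polynomial with $P_{\mathcal F}(\underline n)=H_{\mathcal F}(\underline n)$ for all large $\underline n$. A vector $\underline n\in\mathbb Z^s$ is a postulation vector of $\mathcal F$ if $H_{\mathcal F}(\underline m)=P_{\mathcal F}(\underline m)$ for all $\underline m\ge\underline n$ (in $\mathbb Z^s$); $\mathcal P(\mathcal F)\subseteq\mathbb Z^s$ is the set of postulation vectors. With $\dim R=2$, a set $\mathcal A=\{x_{ij}\in I_i:j=1,2;\ i=1,\dots,s\}$ is a complete reduction of $\mathcal F$ if, with $y_j=x_{1j}\cdots x_{sj}$ and $J=(y_1,y_2)$, $J\mathcal F(\underline n)=\mathcal F(\underline n+e)$ for all large $\underline n\in\mathbb N^s$. It is a good complete reduction if in addition $\mathcal F(\underline m)\cap(y_1)=y_1\mathcal F(\underline m-e)$ for all large $\underline m\in\mathbb N^s$. The complete reduction number $r_{\mathcal A}(\mathcal F)$ is the least $k\in\mathbb N$ such that $J\mathcal F(\underline n)=\mathcal F(\underline n+e)$ for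 all $\underline n\ge ke$. *)

(* Defs.v *)
From HB Require Import structures.
From mathcomp Require Import all_boot all_order all_algebra finmap.
From mathcomp.multinomials Require Import mpoly.
From mathcomp Require Import boolp classical_sets cardinality.

Set Implicit Arguments.
Unset Strict Implicit.
Unset Printing Implicit Defensive.

Import Order.TTheory GRing.Theory Num.Theory.

Local Open Scope classical_set_scope.
Local Open Scope ring_scope.

Definition is_maximum (S : set nat) (d : nat) : Prop :=
  S d /\ forall k, S k -> (k <= d)%N.

Definition is_minimum (S : set nat) (d : nat) : Prop :=
  S d /\ forall k, S k -> (d <= k)%N.

(** * Ideals and local algebra

   Ideals are sets [I : set R] satisfying [is_ideal]; the unit ideal is
   allowed (unlike with MathComp's [idealr_closed]), since nonpositive powers
   of ideals are [setT]. *)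

Section Ideals.
Variable R : comNzRingType.
Implicit Types (I J P : set R) (x y : R) (d k : nat).

Definition is_ideal I : Prop :=
  [/\ I 0, forall x y, I x -> I y -> I (x + y) & forall a x, I x -> I (a * x)].

Definition ideal_span (S : set R) : set R := smallest is_ideal S.

Definition idmul I J : set R := ideal_span [set x * y | x in I & y in J].

(* nonpositive powers are the unit ideal *)
Definition idexp I (z : int) : set R :=
  if z is Posz k then iter k (idmul I) setT else setT.

Definition noetherian : Prop :=
  forall I, is_ideal I -> exists s : seq R, I = ideal_span [set` s].

Definition maximal_ideal I : Prop :=
  [/\ is_ideal I, I != setT
    & forall J, is_ideal J -> J != setT -> I `<=` J -> J = I].

Definition prime_ideal P : Prop :=
  [/\ is_ideal P, P != setT & forall x y, P (x * y) -> P x \/ P y].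

Definition radical I : set R := [set x | exists k, I (x ^+ k)].

Definition primary_ideal I : Prop :=
  [/\ is_ideal I, I != setT & forall x y, I (x * y) -> I x \/ radical I y].

Definition m_primary (m I : set R) : Prop := primary_ideal I /\ radical I = m.

Definition local_ring (m : set R) : Prop :=
  maximal_ideal m /\ forall J, maximal_ideal J -> J = m.

Definition infinite_residue_field (m : set R) : Prop :=
  infinite_set (range (fun x => [set y | m (y - x)])).

Definition krull_dim d : Prop :=
  is_maximum [set l | exists P : nat -> set R,
      (forall i, (i <= l)%N -> prime_ideal (P i)) /\
      (forall i, (i < l)%N -> P i `<` P i.+1)] d.

Definition regular_seq (xs : seq R) : Prop :=
  ideal_span [set` xs] != setT /\
  forall i, (i < size xs)%N -> forall z,
    ideal_span [set` take i xs] (xs`_i * z) -> ideal_span [set` take i xs] z.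

Definition depth (m : set R) d : Prop :=
  is_maximum [set l | exists xs : seq R,
      [/\ size xs = l, [set` xs] `<=` m & regular_seq xs]] d.

Definition cohen_macaulay_local (m : set R) : Prop :=
  [/\ noetherian, local_ring m & exists d, krull_dim d /\ depth m d].

(* The length of the R-module R/I: its submodules are the ideals containing I.
   The value is 0 if R/I has infinite length. *)
Definition length_quot I : nat :=
  xget 0%N (is_maximum [set l | exists J : nat -> set R,
    [/\ forall i, (i <= l)%N -> is_ideal (J i), I `<=` J 0%N
      & forall i, (i < l)%N -> J i `<` J i.+1]]).

End Ideals.
Arguments krull_dim : clear implicits.
Arguments noetherian : clear implicits.

(** * Multidegrees *)

Section Degrees.
Variable s : nat.
Implicit Types n p : 'rV[int]_s.

Definition dle n p : bool := [forall i, n 0 i <= p 0 i].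

Definition dpos n : 'rV[int]_s := map_mx (Num.max 0) n.

Definition de : 'rV[int]_s := const_mx 1.

Definition for_large (Q : 'rV[int]_s -> Prop) : Prop :=
  exists N : nat, forall n, (forall i, N%:Z <= n 0 i) -> Q n.

End Degrees.
Arguments de {s}.

(** * Multigraded modules

   Let A be a family of additive subgroups of R, indexed by Z^s, with
   1 in A_0 and A_n A_p included in A_(n+p); it encodes the Z^s-graded subring
   (+)_n A_n t^n of R[t_1^+-1,...,t_s^+-1].
   In a graded module M over this ring, [gact n p a : M_n -> M_p] is the
   multiplication by the homogeneous element a t^(p-n); it is relevant only
   for a in A_(p-n). Indexing the action by source and target degrees avoids
   casts between M_((n+p)+q) and M_(n+(p+q)). *)

Section GradedModules.
Variables (R : comNzRingType) (s : nat) (A : 'rV[int]_s -> set R).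

Record gmod := GMod {
  gcomp :> 'rV[int]_s -> zmodType;
  gact : forall n p, R -> gcomp n -> gcomp p;
  gactDr : forall n p a (x y : gcomp n), A (p - n) a ->
    gact p a (x + y) = gact p a x + gact p a y;
  gactDl : forall n p a b (x : gcomp n), A (p - n) a -> A (p - n) b ->
    gact p (a + b) x = gact p a x + gact p b x;
  gact1 : forall n (x : gcomp n), gact n 1 x = x;
  gactA : forall n p q a b (x : gcomp n), A (p - n) a -> A (q - p) b ->
    gact q b (gact p a x) = gact q (b * a) x
}.

(* homomorphisms of graded modules, of degree 0 *)
Definition is_ghom (M N : gmod) (f : forall n, M n -> N n) : Prop :=
  (forall n (x y : M n), f n (x + y) = f n x + f n y) /\
  (forall n p a (x : M n), A (p - n) a -> f p (gact p a x) = gact p a (f n x)).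

Definition ginjective (E : gmod) : Prop :=
  forall (M N : gmod) (i : forall n, M n -> N n) (f : forall n, M n -> E n),
    is_ghom i -> (forall n, injective (i n)) -> is_ghom f ->
    exists2 g : (forall n, N n -> E n), is_ghom g & forall n x, g n (i n x) = f n x.

(* injective resolutions 0 -> M -> E^0 -> E^1 -> ... among graded modules *)
Record gres (M : gmod) := GRes {
  gres_obj : nat -> gmod;
  gres_aug : forall n, M n -> gres_obj 0 n;
  gres_d : forall i n, gres_obj i n -> gres_obj i.+1 n;
  gres_inj : forall i, ginjective (gres_obj i);
  gres_aug_hom : is_ghom gres_aug;
  gres_d_hom : forall i, is_ghom (@gres_d i);
  gres_aug_inj : forall n, injective (@gres_aug n);
  gres_exact0 : forall n (x : gres_obj 0 n),
    gres_d x = 0 <-> exists y : M n, gres_aug y = x;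
  gres_exact : forall i n (x : gres_obj i.+1 n),
    gres_d x = 0 <-> exists y : gres_obj i n, gres_d y = x
}.

Variable J : 'rV[int]_s -> set R. (* a graded ideal (+)_n J_n t^n *)

(* J^k x = 0 *)
Fixpoint killed (M : gmod) (k : nat) (n : 'rV[int]_s) (x : M n) : Prop :=
  if k is k'.+1 then forall p a, J (p - n) a -> killed k' (gact p a x)
  else x = 0.

Definition gtorsion (M : gmod) (n : 'rV[int]_s) : set (M n) :=
  [set x | exists k, killed k x].

(* The degree n part of H^i(Gamma_J(E)) is zero, for a resolution E of M. *)
Definition tors_cohomology_zero (M : gmod) (E : gres M) (i : nat)
    (n : 'rV[int]_s) : Prop :=
  match i with
  | 0 => forall x : gres_obj E 0 n, gtorsion x -> gres_d x = 0 -> x = 0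
  | i'.+1 => forall x : gres_obj E i'.+1 n, gtorsion x -> gres_d x = 0 ->
      exists2 y : gres_obj E i' n, gtorsion y & gres_d y = x
  end.

(* H^i_J(M)_n = 0, where H^i_J is the i-th right derived functor of the
   torsion functor Gamma_J on graded modules; any two injective resolutions
   give isomorphic cohomology. *)
Definition local_cohomology_zero (i : nat) (M : gmod) (n : 'rV[int]_s) : Prop :=
  exists E : gres M, tors_cohomology_zero E i n.

End GradedModules.

(** * Filtrations *)

Section Filtrations.
Variables (R : comNzRingType) (s : nat).
Variable I : 'I_s -> set R.
Implicit Types (F : 'rV[int]_s -> set R) (n p : 'rV[int]_s).

Definition multipow n : set R :=
  \big[@idmul R/setT]_(i < s) idexp (I i) (n 0 i).

Record filtration F : Prop := Filtration {
  filtration_ideal : forall n, is_ideal (F n);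
  filtration_multipow : forall n, multipow n `<=` F n;
  filtration_mul : forall n p, idmul (F n) (F p) `<=` F (n + p);
  filtration_le : forall n p, dle n p -> F p `<=` F n
}.

(* Laurent polynomials, as finitely supported functions n |-> coeff of t^n *)
Definition laurent := {fsfun 'rV[int]_s -> R with 0}.

Definition laurent_in F : set laurent := [set f | forall n, F n (f n)].

Definition laurent_mul_coef (f g : laurent) n : R :=
  \sum_(p <- finsupp f) f p * g (n - p).

(* (+)_n F(n) t^n is a finite module over (+)_n I^n t^n *)
Definition finite_rees F : Prop :=
  exists (r : nat) (g : 'I_r -> laurent),
    (forall j, laurent_in F (g j)) /\
    forall f, laurent_in F f ->
      exists c : 'I_r -> laurent, (forall j, laurent_in multipow (c j)) /\
        forall n, f n = \sum_(j < r) laurent_mul_coef (c j) (g j) n.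

Record admissible F : Prop := Admissible {
  admissible_filtration :> filtration F;
  admissible_pos : forall n, F n = F (dpos n);
  admissible_finite : finite_rees F
}.

(* graded pieces of the Rees rings, indexed by Z^s, zero outside N^s *)
Definition rees F n : set R := if dle 0 n then F n else [set 0].

Definition rees_pp n : set R := if dle de n then multipow n else [set 0].

End Filtrations.

(** * The graded R(I)-module R(F) *)

Lemma idmul_in (R : comNzRingType) (I J : set R) (x y : R) :
  I x -> J y -> idmul I J (x * y).
Proof. by move=> Ix Jy K [_]; apply; exists x => //; exists y. Qed.

Section IdealElements.
Variable R : comNzRingType.

Record ideal := Ideal { ideal_set :> set R; idealP : is_ideal ideal_set }.

Definition ideal_pred (I : ideal) : {pred R} := fun x => `[< ideal_set I x >].

Fact ideal_pred_closed (I : ideal) : zmod_closed (ideal_pred I).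
Proof.
have [I0 ID IM] := idealP I; split=> [|x y /asboolP Ix /asboolP Iy].
  exact/asboolP.
by apply/asboolP; apply: ID => //; rewrite -mulN1r; apply: IM.
Qed.
HB.instance Definition _ (I : ideal) :=
  GRing.isZmodClosed.Build R (ideal_pred I) (ideal_pred_closed I).

Record ideal_elt (I : ideal) :=
  IdealElt { ideal_val : R; _ : ideal_val \in ideal_pred I }.
HB.instance Definition _ (I : ideal) := [isSub for @ideal_val I].
HB.instance Definition _ (I : ideal) := [Choice of ideal_elt I by <:].
HB.instance Definition _ (I : ideal) :=
  [SubChoice_isSubZmodule of ideal_elt I by <:].

End IdealElements.

Section ReesModule.
Variables (R : comNzRingType) (s : nat).
Variables (I : 'I_s -> set R) (F : 'rV[int]_s -> set R).
Hypothesis filtF : filtration I F.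

Fact rees_ideal_subproof n : is_ideal (rees F n).
Proof.
rewrite /rees; case: ifP => _; first exact: filtration_ideal filtF n.
by split=> [//|x y -> ->|a x ->] /=; rewrite ?addr0 ?mulr0.
Qed.

Definition rees_comp n : zmodType := ideal_elt (Ideal (rees_ideal_subproof n)).

(* multiplication by a, when it maps into degree p (0 otherwise) *)
Definition rees_act n p (a : R) (x : rees_comp n) : rees_comp p :=
  insubd (0 : rees_comp p) (a * val x).

Fact rees_act_in n p a (x : rees_comp n) :
  rees (multipow I) (p - n) a -> rees F p (a * val x).
Proof.
move=> Aa; have /asboolP /= := valP x.
have [I0 _ _] := rees_ideal_subproof p.
move: Aa; rewrite {1}/rees; case: ifP => [pn Ia|_ ->]; last by rewrite mul0r.
rewrite {1}/rees; case: ifP => [n0 Fx|_ ->]; last by rewrite mulr0.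
have -> : rees F p = F p.
  rewrite /rees ifT //; apply/forallP => i.
  have /forallP/(_ i) := pn; have /forallP/(_ i) := n0.
  by rewrite !mxE subr_ge0; exact: le_trans.
rewrite -[p](subrK n); apply: (filtration_mul filtF).
by apply: idmul_in => //; exact: (filtration_multipow filtF).
Qed.

Fact val_rees_act n p a (x : rees_comp n) :
  rees F p (a * val x) -> val (rees_act p a x) = a * val x.
Proof. by move=> /asboolT Fax; rewrite val_insubd ifT. Qed.

Fact rees_actDr n p a (x y : rees_comp n) : rees (multipow I) (p - n) a ->
  rees_act p a (x + y) = rees_act p a x + rees_act p a y.
Proof.
move=> Aa; apply: val_inj; rewrite raddfD /= !val_rees_act; try exact: rees_act_in.
by rewrite raddfD mulrDr.
Qed.

Fact rees_actDl n p a b (x : rees_comp n) :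
  rees (multipow I) (p - n) a -> rees (multipow I) (p - n) b ->
  rees_act p (a + b) x = rees_act p a x + rees_act p b x.
Proof.
move=> Aa Ab; apply: val_inj.
have Fa := rees_act_in x Aa; have Fb := rees_act_in x Ab.
rewrite raddfD /= !val_rees_act ?mulrDl //.
by have [_ ID _] := rees_ideal_subproof p; exact: ID.
Qed.

Fact rees_act1 n (x : rees_comp n) : rees_act n 1 x = x.
Proof.
apply: val_inj; rewrite val_rees_act mul1r //.
by have /asboolP := valP x.
Qed.

Fact rees_actA n p q a b (x : rees_comp n) :
  rees (multipow I) (p - n) a -> rees (multipow I) (q - p) b ->
  rees_act q b (rees_act p a x) = rees_act q (b * a) x.
Proof.
move=> Aa Ab; apply: val_inj; have Fa := rees_act_in x Aa.
have Fba := rees_act_in (rees_act p a x) Ab; rewrite val_rees_act //.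
by rewrite (val_rees_act Fa) mulrA in Fba *; rewrite val_rees_act.
Qed.

(* R(F) as a graded R(I)-module *)
Definition rees_gmod : gmod (rees (multipow I)) :=
  GMod rees_actDr rees_actDl rees_act1 rees_actA.

End ReesModule.

(** * Hilbert polynomials and complete reductions *)

Section Hilbert.
Variables (R : comNzRingType) (s : nat) (F : 'rV[int]_s -> set R).
Implicit Types (n p : 'rV[int]_s).

Definition hilbert_fun n : nat := length_quot (F n).

Definition mpeval (P : {mpoly rat[s]}) n : rat :=
  P.@[fun i => (n 0 i)%:~R].

(* the unique polynomial agreeing with the Hilbert function for large n *)
Definition hilbert_poly : {mpoly rat[s]} :=
  xget 0 [set P | for_large (fun n => (hilbert_fun n)%:R = mpeval P n)].

Definition postulation_vectors : set 'rV[int]_s :=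
  [set n | forall p, dle n p -> (hilbert_fun p)%:R = mpeval hilbert_poly p].

End Hilbert.

Section Reductions.
Variables (R : comNzRingType) (s : nat) (I : 'I_s -> set R).
Variables (F : 'rV[int]_s -> set R).
Variable x : 'I_s -> 'I_2 -> R. (* the set A = {x_ij} *)

Definition red_elt (j : 'I_2) : R := \prod_(i < s) x i j.

Definition red_ideal : set R := ideal_span (range red_elt).

Definition complete_reduction : Prop :=
  (forall i j, I i (x i j)) /\
  for_large (fun n => idmul red_ideal (F n) = F (n + de)).

Definition good_complete_reduction : Prop :=
  complete_reduction /\
  for_large (fun n => F n `&` ideal_span [set red_elt 0]
                      = [set red_elt 0 * z | z in F (n - de)]).

(* meaningful when x is a complete reduction, so that the minimum exists *)
Definition reduction_number : nat :=
  xget 0%N (is_minimum [set k | forall n, dle (const_mx k%:Z) n ->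
    idmul red_ideal (F n) = F (n + de)]).

End Reductions.

(* Main.v *)
Require Import Defs.
From mathcomp Require Import all_boot all_order all_algebra finmap.
From mathcomp.multinomials Require Import mpoly.
From mathcomp Require Import boolp classical_sets functions cardinality.
From mathcomp Require Import ring lra zify.
Import Order.TTheory GRing.Theory Num.Theory.
Local Open Scope classical_set_scope.
Local Open Scope ring_scope.
Set Implicit Arguments.
Unset Strict Implicit.
Unset Printing Implicit Defensive.

(** Let x be a complete reduction with products y_1 and y_2, let J = (y_1, y_2),
    and let H be the Hilbert function of F. Since R/J has finite length and R has
    depth two, y_1 and y_2 form a regular sequence, and the Koszul complex on
    them gives, for every ideal A of finite colength,
      length (R/JA) + length (R/(A : J)) = length (R/J) + 2 length (R/A)
    ([colen_koszul]). For A = F(n+e) with n >= 0, the vanishing of the first local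
    cohomology in degree n says that (F(n+e) : J) = F(n)
    ([reduction_colon_closed]). As F(n+2e) contains J F(n+e), the equality
    J F(n+e) = F(n+2e) for all n >= 0, that is, reduction number at most one,
    means that
      H(n+2e) - 2 H(n+e) + H(n) = length (R/J)   for all n >= 0
    ([reduction_number_le1_hilbert]). This holds for large n whatever the
    reduction number is, so the Hilbert polynomial P satisfies the same relation
    everywhere. If H = P for n >= 0 the relation holds for H; conversely, if it
    holds for H, then H - P has vanishing second differences along the diagonals,
    and since it vanishes far out it vanishes for all n >= 0.

    It remains to show that a good complete reduction exists, that H is
    eventually a polynomial, and that no other vector is a postulation vector.
    All three follow from elements x_i, y_i of I_i ([joint_reduction_system]) such
    that in large degrees n, for all i and j,
      (F(n+e_i) : x_i) = F(n)  and  F(n+e_i+e_j) = x_i F(n+e_j) + y_j F(n+e_i).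
    The products of the x_i and of the y_j then give a good complete reduction.
    By [colen_koszul] again, the mixed difference of H in the directions i and j
    is eventually the positive constant length (R/(x_i, y_j)). So H is eventually a
    polynomial of degree two; and if n_i < 0, then H is independent of its i-th
    argument near -1 while a mixed difference of P in the directions i and j <> i
    is positive, so n is not a postulation vector.

    The x_i and y_j are superficial elements. The Rees algebra is Noetherian by
    Hilbert's basis theorem, and a general linear combination of generators of
    I_i, with coefficients from distinct residue classes, is a nonzerodivisor in
    large degrees on a finite module over it ([superficial_element]). The y_j are
    chosen modulo the x_i. In the one-dimensional rings R/(x_i) the lengths of
    F(n)/F(n+e) are bounded and do not decrease, so multiplication by y_j is
    eventually surjective on these quotients ([generated_mod]). *)

(** * Operations on ideals *)

Section IdealTheory.
Variable R : comNzRingType.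
Implicit Types (A B C J : set R) (x y z a : R).

Definition idsum A B : set R := [set z | exists a b, [/\ A a, B b & z = a + b]].
Definition scale x A : set R := [set x * z | z in A].
Definition colon A x : set R := [set z | A (x * z)].
Definition principal x : set R := scale x setT.

Lemma is_ideal0 A : is_ideal A -> A 0. Proof. by case. Qed.
Lemma is_idealD A x y : is_ideal A -> A x -> A y -> A (x + y).
Proof. by case=> _ + _; apply. Qed.
Lemma is_ideal_mull A x y : is_ideal A -> A y -> A (x * y).
Proof. by case=> _ _; apply. Qed.
Lemma is_ideal_mulr A x y : is_ideal A -> A x -> A (x * y).
Proof. by rewrite mulrC; apply: is_ideal_mull. Qed.
Lemma is_idealN A x : is_ideal A -> A x -> A (- x).
Proof. by move=> idA Ax; rewrite -mulN1r; apply: is_ideal_mull. Qed.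
Lemma is_idealB A x y : is_ideal A -> A x -> A y -> A (x - y).
Proof. by move=> idA Ax Ay; apply: is_idealD => //; apply: is_idealN. Qed.
Lemma ideal_sum A (T : Type) (r : seq T) (f : T -> R) :
  is_ideal A -> (forall t, A (f t)) -> A (\sum_(t <- r) f t).
Proof.
move=> idA Af; elim/big_ind: _ => //; first exact: is_ideal0.
by move=> x y; apply: is_idealD.
Qed.
Lemma is_ideal_1 A : is_ideal A -> A 1 -> A = setT.
Proof.
by move=> idA A1; apply/seteqP; split=> // x _; rewrite -[x]mulr1; apply: is_ideal_mull.
Qed.

Lemma ideal_setT : is_ideal [set: R]. Proof. by []. Qed.
Lemma ideal_set0 : is_ideal [set (0 : R)].
Proof. by split=> [//|x y -> ->|a x ->] /=; rewrite ?addr0 ?mulr0. Qed.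
Lemma ideal_setI A B : is_ideal A -> is_ideal B -> is_ideal (A `&` B).
Proof.
move=> [A0 AD AM] [B0 BD BM]; split=> // [x y [? ?] [? ?]|a x [? ?]].
  by split; [apply: AD | apply: BD].
by split; [apply: AM | apply: BM].
Qed.
Lemma ideal_idsum A B : is_ideal A -> is_ideal B -> is_ideal (idsum A B).
Proof.
move=> idA idB; split.
- by exists 0, 0; split; rewrite ?addr0 //; apply: is_ideal0.
- move=> _ _ [a [b [Aa Bb ->]]] [a' [b' [Aa' Bb' ->]]].
  by exists (a + a'), (b + b'); split; rewrite 1?addrACA //; apply: is_idealD.
- move=> c _ [a [b [Aa Bb ->]]].
  by exists (c * a), (c * b); split; rewrite ?mulrDr //; apply: is_ideal_mull.
Qed.
Lemma ideal_scale x A : is_ideal A -> is_ideal (scale x A).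
Proof.
move=> idA; split.
- by exists 0; rewrite ?mulr0 //; apply: is_ideal0.
- by move=> _ _ [a Aa <-] [b Ab <-]; exists (a + b); rewrite ?mulrDr //; apply: is_idealD.
- by move=> c _ [a Aa <-]; exists (c * a); rewrite 1?mulrCA //; apply: is_ideal_mull.
Qed.
Lemma ideal_colon x A : is_ideal A -> is_ideal (colon A x).
Proof.
move=> idA; split; rewrite /colon /=.
- by rewrite mulr0; apply: is_ideal0.
- by move=> a b Aa Ab; rewrite mulrDr; apply: is_idealD.
- by move=> c a Aa; rewrite mulrCA; apply: is_ideal_mull.
Qed.
Lemma ideal_principal x : is_ideal (principal x).
Proof. exact: ideal_scale. Qed.
Lemma ideal_span_ideal (S : set R) : is_ideal (ideal_span S).
Proof.
split=> [J [[]//]|x y Sx Sy J JS|a x Sx J JS].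
  by apply: (is_idealD JS.1); [apply: Sx | apply: Sy].
by apply: (is_ideal_mull _ JS.1); apply: Sx.
Qed.
Lemma sub_ideal_span (S : set R) : S `<=` ideal_span S.
Proof. by move=> x Sx J [_]; apply. Qed.
Lemma ideal_span_min (S J : set R) : is_ideal J -> S `<=` J -> ideal_span S `<=` J.
Proof. by move=> idJ SJ x; apply. Qed.
Lemma ideal_idmul A B : is_ideal (idmul A B).
Proof. exact: ideal_span_ideal. Qed.
Lemma idmul_min A B J : is_ideal J -> (forall a b, A a -> B b -> J (a * b)) ->
  idmul A B `<=` J.
Proof. by move=> idJ ABJ; apply: ideal_span_min => // _ [a Aa [b Bb <-]]; apply: ABJ. Qed.

Lemma principal_id x : principal x x. Proof. by exists 1; rewrite ?mulr1. Qed.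
Lemma principalM x z : principal x (x * z). Proof. by exists z. Qed.
Lemma principal_min x A : is_ideal A -> A x -> principal x `<=` A.
Proof. by move=> idA Ax _ [z _ <-]; apply: is_ideal_mulr. Qed.
Lemma span1 x : ideal_span [set x] = principal x.
Proof.
apply/seteqP; split.
  by apply: ideal_span_min => [|_ ->]; [apply: ideal_principal | apply: principal_id].
by apply: principal_min; [apply: ideal_span_ideal | apply: sub_ideal_span].
Qed.
Lemma idsum_min A B J : is_ideal J -> A `<=` J -> B `<=` J -> idsum A B `<=` J.
Proof. by move=> idJ AJ BJ _ [a [b [/AJ ? /BJ ? ->]]]; apply: is_idealD. Qed.
Lemma sub_idsuml A B : is_ideal B -> A `<=` idsum A B.
Proof. by move=> /is_ideal0 B0 a Aa; exists a, 0; rewrite addr0. Qed.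
Lemma sub_idsumr A B : is_ideal A -> B `<=` idsum A B.
Proof. by move=> /is_ideal0 A0 b Bb; exists 0, b; rewrite add0r. Qed.

End IdealTheory.

#[global] Hint Resolve ideal_setT ideal_set0 ideal_setI ideal_idsum ideal_scale
  ideal_colon ideal_principal ideal_idmul ideal_span_ideal principal_id : core.

(** * Noetherian rings and Hilbert's basis theorem *)

Section Noetherian.
Variable R : comNzRingType.
Hypothesis noethR : noetherian R.

Lemma noetherian_acc (L : nat -> set R) : (forall k, is_ideal (L k)) ->
  (forall k, L k `<=` L k.+1) -> exists K, forall k, L k `<=` L K.
Proof.
move=> idL incL.
have monoL i j : (i <= j)%N -> L i `<=` L j.
  elim: j => [|j IH]; first by rewrite leqn0 => /eqP->.
  by rewrite leq_eqVlt ltnS => /orP[/eqP->//|/IH LiLj]; apply: subset_trans LiLj _.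
pose U := [set x | exists k, L k x].
have idU : is_ideal U.
  split; first by exists 0%N; apply: is_ideal0.
    move=> x y [i Lx] [j Ly]; exists (maxn i j).
    by apply: is_idealD => //; [apply: monoL Lx | apply: monoL Ly]; lia.
  by move=> a x [i Lx]; exists i; apply: is_ideal_mull.
have [s Us] := noethR idU.
have /(_ s) : forall r : seq R, [set` r] `<=` U -> exists K, [set` r] `<=` L K.
  elim=> [|x r IH] rU; first by exists 0%N.
  have [|i Li] := IH; first by move=> y /= yr; apply: rU; rewrite /= inE yr orbT.
  have [|j Lj] := rU x; first by rewrite /= mem_head.
  exists (maxn i j) => y /=; rewrite inE => /predU1P[->|/Li]; last by apply: monoL; lia.
  by apply: monoL Lj; lia.
case=> [|K sK]; first by rewrite Us; apply: sub_ideal_span.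
exists K => k x Lx; have : U x by exists k.
by rewrite Us; apply: ideal_span_min.
Qed.

(** Existence of maximal elements is the form in which the Noetherian hypothesis
   is used for local algebra: otherwise dependent choice builds a strictly
   increasing sequence. *)
Lemma noetherian_max (S : set (set R)) (A0 : set R) :
  (forall A, S A -> is_ideal A) -> S A0 ->
  exists A, [/\ S A, A0 `<=` A & forall B, S B -> A `<=` B -> B `<=` A].
Proof.
move=> Sid SA0; apply: contrapT => noMax.
have /choice[h hP] : forall A, exists B, S A -> A0 `<=` A ->
    [/\ S B, A `<=` B & ~ (B `<=` A)].
  move=> A; apply: contrapT => noB; apply: noMax; exists A.
  have [SA sA] : S A /\ A0 `<=` A.
    by apply: contrapT => nSA; apply: noB; exists A => SA sA; case: nSA.
  split=> // B SB AB; apply: contrapT => nBA.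
  by apply: noB; exists B.
have itP k : S (iter k h A0) /\ A0 `<=` iter k h A0.
  elim: k => [|k [SA sA]]; first by split.
  have [? ? _] := hP _ SA sA.
  by split=> //; apply: subset_trans sA _.
have [||K KP] := @noetherian_acc (fun k => iter k h A0).
- by move=> k; apply: Sid; have [] := itP k.
- by move=> k; have [SA sA] := itP k; have [] := hP _ SA sA.
have [SA sA] := itP K; have [_ _] := hP _ SA sA; apply; exact: (KP K.+1).
Qed.

End Noetherian.

Section HilbertBasis.
Variable T : comNzRingType.

Definition lead_ideal (J : set {poly T}) (d : nat) : set T :=
  [set c | exists p, [/\ J p, (size p <= d.+1)%N & p`_d = c]].

Lemma lead_ideal_ideal J d : is_ideal J -> is_ideal (lead_ideal J d).
Proof.
move=> idJ; split.
- by exists 0; rewrite size_poly0 coef0; split=> //; apply: is_ideal0.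
- move=> _ _ [p [Jp sp <-]] [q [Jq sq <-]]; exists (p + q); rewrite coefD.
  by split=> //; [apply: is_idealD | rewrite (leq_trans (size_polyD _ _))// geq_max sp].
- move=> a _ [p [Jp sp <-]]; exists (a%:P * p); rewrite coefCM.
  split=> //; first exact: is_ideal_mull.
  by rewrite mul_polyC (leq_trans (size_scale_leq _ _)).
Qed.

Lemma lead_idealS J d : is_ideal J -> lead_ideal J d `<=` lead_ideal J d.+1.
Proof.
move=> idJ _ [p [Jp sp <-]]; exists (p * 'X); rewrite coefMX /=; split=> //.
  exact: is_ideal_mulr.
by rewrite (leq_trans (size_polyMleq _ _))// size_polyX addn2.
Qed.

Lemma sub_lead_ideal J J' d : J `<=` J' -> lead_ideal J d `<=` lead_ideal J' d.
Proof. by move=> JJ' c [p [Jp sp pc]]; exists p; split=> //; apply: JJ'. Qed.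

(** Hilbert's basis theorem. Generators of J come from lifting generators of the
   finitely many ideals [lead_ideal J d] up to the degree K where they stabilise;
   subtracting a combination that matches the leading term lowers the degree. *)
Lemma noetherian_poly : noetherian T -> noetherian {poly T}.
Proof.
move=> noethT J idJ.
have lift d : exists2 t : seq {poly T}, [set` t] `<=` J &
    lead_ideal J d `<=` lead_ideal (ideal_span [set` t]) d.
  have [s sE] := noethT _ (lead_ideal_ideal d idJ).
  have : [set` s] `<=` lead_ideal J d by rewrite sE; apply: sub_ideal_span.
  move=> sJ.
  suff [t tJ st] : exists2 t : seq {poly T}, [set` t] `<=` J &
      [set` s] `<=` lead_ideal (ideal_span [set` t]) d.
    by exists t => //; rewrite sE; apply: ideal_span_min => //; apply: lead_ideal_ideal.
  elim: s sJ {sE} => [|c s IH] sJ; first by exists [::].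
  have [|t tJ st] := IH; first by move=> y /= ys; apply: sJ; rewrite /= inE ys orbT.
  have [|p [Jp sp pc]] := sJ c; first by rewrite /= mem_head.
  exists (p :: t) => [q|c'] /=; rewrite inE => /predU1P[-> //|]; first exact: tJ.
    by exists p; split=> //; apply: sub_ideal_span; rewrite /= mem_head.
  move=> /st; apply: sub_lead_ideal; apply: ideal_span_min => // q qt.
  by apply: sub_ideal_span; rewrite /= inE; apply/orP; right.
have liftK K : exists2 t : seq {poly T}, [set` t] `<=` J & forall d, (d <= K)%N ->
    lead_ideal J d `<=` lead_ideal (ideal_span [set` t]) d.
  elim: K => [|K [t tJ tP]].
    by have [t tJ tP] := lift 0%N; exists t => // d; rewrite leqn0 => /eqP->.
  have [u uJ uP] := lift K.+1; exists (t ++ u) => [p|d] /=.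
    by rewrite mem_cat => /orP[/tJ|/uJ].
  rewrite leq_eqVlt ltnS => /predU1P[->|/tP tPd].
    apply: subset_trans uP _; apply: sub_lead_ideal; apply: ideal_span_min => // q qu.
    by apply: sub_ideal_span; rewrite /= mem_cat; apply/orP; right.
  apply: subset_trans tPd _; apply: sub_lead_ideal; apply: ideal_span_min => // q qu.
  by apply: sub_ideal_span; rewrite /= mem_cat; apply/orP; left.
have [||K KP] := noetherian_acc noethT (L := lead_ideal J).
- by move=> d; apply: lead_ideal_ideal.
- by move=> d; apply: lead_idealS.
have [t tJ tP] := liftK K; exists t; apply/seteqP; split; last exact: ideal_span_min.
suff main k : forall p, J p -> (size p <= k)%N -> ideal_span [set` t] p.
  by move=> p Jp; exact: main Jp (leqnn _).
elim: k => [|d IH] p Jp sp.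
  by move: sp; rewrite leqn0 size_poly_eq0 => /eqP->; apply: is_ideal0.
pose d' := minn d K.
have [q [Sq sq qd]] : lead_ideal (ideal_span [set` t]) d' p`_d.
  apply: tP; first by rewrite geq_minr.
  have : lead_ideal J d p`_d by exists p.
  rewrite /d'; by case: (leqP d K) => // dK /KP.
have qJ : J q by move: Sq; apply: ideal_span_min.
have d'd : (d' <= d)%N by rewrite geq_minl.
have -> : p = (p - q * 'X^(d - d')) + q * 'X^(d - d') by rewrite subrK.
apply: (is_idealD (ideal_span_ideal _)); last exact: (is_ideal_mulr _ (ideal_span_ideal _)).
apply: IH; first by apply: is_idealB => //; apply: is_ideal_mulr.
apply/leq_sizeP => j; rewrite leq_eqVlt coefB coefMXn => /predU1P[<-|dj].
  by rewrite ltnNge leq_subr /= subKn // qd subrr.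
rewrite nth_default ?(leq_trans sp)// ifF; last by apply/negbTE; lia.
rewrite nth_default ?subrr // (leq_trans sq) //; lia.
Qed.

End HilbertBasis.

(** A finitely generated R-algebra inside B is a quotient of an iterated polynomial
   ring T over R. The last clause says that the image of T is no larger than the
   subalgebra generated by xs, so it can be used to show that a set of elements of
   B is stable under the action of T. *)
Lemma noetherian_subalgebra (R B : comNzRingType) (iota : {rmorphism R -> B})
    (xs : seq B) : noetherian R ->
  exists (T : comNzRingType) (phi : {rmorphism T -> B}),
  [/\ noetherian T, forall r, exists t, phi t = iota r,
      forall x, x \in xs -> exists t, phi t = x
    & forall A : set B, (forall r, A (iota r)) -> (forall x, x \in xs -> A x) ->
        (forall x y, A x -> A y -> A (x + y)) -> (forall x y, A x -> A y -> A (x * y)) ->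
        forall t, A (phi t)].
Proof.
move=> noethR; elim: xs => [|x xs [T [phi [noethT phiR phix phiA]]]].
  by exists R, iota; split=> // r; exists r.
have cphix : commr_rmorph phi x by move=> t; exact: mulrC.
exists {poly T}, (horner_morph cphix); split.
- exact: noetherian_poly.
- by move=> r; have [t tr] := phiR r; exists t%:P; rewrite /= horner_morphC.
- move=> y; rewrite inE => /predU1P[->|/phix[t ty]].
    by exists 'X; rewrite /= horner_morphX.
  by exists t%:P; rewrite /= horner_morphC.
- move=> A Ar Axs AD AM p.
  have At t : A (phi t).
    by apply: phiA => // y yxs; apply: Axs; rewrite inE yxs orbT.
  elim/poly_ind: p => [|p c IH]; first by rewrite rmorph0 -(rmorph0 phi).
  rewrite rmorphD rmorphM /= horner_morphX horner_morphC.
  by apply: AD => //; apply: AM => //; apply: Axs; rewrite mem_head.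
Qed.

(** * Graded families of ideals over a multigraded Rees algebra *)

Section GradedFamilies.
Variables (R : comNzRingType) (s : nat) (I : 'I_s -> set R).
Hypothesis noethR : noetherian R.
Hypothesis idI : forall i, is_ideal (I i).
Implicit Types (L G Z : 'X_{1..s} -> set R) (n p : 'X_{1..s}).

(** A graded submodule of R[t_1, ..., t_s] over the Rees algebra of the ideals
   [I i]: the component of degree n is L n t^n, and stability under the
   homogeneous elements of degree [U_(i)] is stability under the whole algebra. *)
Record graded L : Prop := Graded {
  graded_ideal : forall n, is_ideal (L n);
  gradedM : forall n i a z, I i a -> L n z -> L (n + U_(i))%MM (a * z)
}.

(** With [graded G], the reverse inclusion holds too, so that G n is the product of
   G 0 with the powers of the ideals. *)
Definition generated_at0 G := forall n i, G (n + U_(i))%MM `<=` idmul (I i) (G n).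

Lemma multinom_ind (P : 'X_{1..s} -> Prop) (N : 'X_{1..s}) : P N ->
  (forall n i, (N <= n)%MM -> P n -> P (n + U_(i))%MM) ->
  forall n, (N <= n)%MM -> P n.
Proof.
move=> PN PS n; move: {2}(mdeg n) (leqnn (mdeg n)) => k.
elim: k n => [|k IH] n nk Nn.
  suff -> : n = N by [].
  have /eqP n0 : mdeg n == 0%N by rewrite -leqn0.
  move/eqP: n0; rewrite mdeg_eq0 => /eqP n0; apply/mnmP => i.
  by move/mnm_lepP/(_ i): Nn; rewrite n0 mnm0E leqn0 => /eqP->.
have [[i Ni]|Nn'] := pselect (exists i, (N i < n i)%N).
  have nE : n = (n - U_(i) + U_(i))%MM.
    by apply/mnmP => j; rewrite mnmDE mnmBE mnm1E; case: eqP => [<-|]; lia.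
  rewrite nE; have Nn1 : (N <= n - U_(i))%MM.
    apply/mnm_lepP => j; rewrite mnmBE mnm1E; move/mnm_lepP/(_ j): Nn.
    by case: eqP => [<-|]; lia.
  apply: PS => //; apply: IH => //.
  by move: nk; rewrite {1}nE mdegD mdeg1 addn1 ltnS.
suff -> : n = N by [].
apply/mnmP => i; apply/eqP; rewrite eqn_leq (mnm_lepP Nn) andbT leqNgt.
by apply/negP => Ni; apply: Nn'; exists i.
Qed.

(** The Rees algebra is generated over R by finitely many elements a t_i with a in
   [I i]. It contains every G n t^n, so a graded family L below G can be recovered
   from an ideal of the Noetherian ring T that maps onto the Rees algebra: the
   elements whose images have all their coefficients in L. *)
Lemma graded_acc G (L : nat -> 'X_{1..s} -> set R) :
  graded G -> generated_at0 G ->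
  (forall k, graded (L k)) -> (forall k n, L k n `<=` G n) ->
  (forall k n, L k n `<=` L k.+1 n) -> exists K, forall k n, L k n `<=` L K n.
Proof.
move=> grG genG grL LG incL.
have /choice[gen genE] : forall i, exists r : seq R, I i = ideal_span [set` r].
  by move=> i; apply: noethR.
pose xs : seq {mpoly R[s]} := flatten [seq [seq x *: 'X_i | x <- gen i] | i <- enum 'I_s].
have xsP i x : x \in gen i -> x *: 'X_i \in xs.
  by move=> xi; apply/flatten_mapP; exists i; rewrite ?mem_enum //; apply/mapP; exists x.
have xsE q : q \in xs -> exists i x, x \in gen i /\ q = x *: 'X_i.
  by move=> /flatten_mapP[i _ /mapP[x xi ->]]; exists i, x.
have [T [phi [noethT phiR phix phiA]]] :=
  noetherian_subalgebra (@mpolyC s R : {rmorphism R -> {mpoly R[s]}}) xs noethR.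
have act Z (grZ : graded Z) t (f : {mpoly R[s]}) :
    (forall n, Z n f@_n) -> forall n, Z n (phi t * f)@_n.
  move: f; pose A : set {mpoly R[s]} := [set b | forall f : {mpoly R[s]},
    (forall n, Z n f@_n) -> forall n, Z n (b * f)@_n].
  apply: (phiA A) => [r|q /xsE[i [x [xi ->]]]|a b Aa Ab|a b Aa Ab] f Zf n /=.
  - by rewrite mcoeffCM; apply: is_ideal_mull => //; apply: graded_ideal.
  - rewrite (mpolyE f) mulr_sumr raddf_sum /=; apply: ideal_sum => [|k].
      exact: graded_ideal.
    rewrite -scalerAr -scalerAl -mpolyXD scalerA mcoeffZ mcoeffX.
    case: eqP => [<-|_]; last by rewrite mulr0; apply: is_ideal0; apply: graded_ideal.
    rewrite mulr1 mulrC addmC; apply: gradedM => //.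
    by rewrite genE; apply: sub_ideal_span.
  - by rewrite mulrDl mcoeffD; apply: is_idealD; [apply: graded_ideal | apply: Aa | apply: Ab].
  - by rewrite -mulrA; apply: Aa; apply: Ab.
have imid n : is_ideal [set z | exists t, phi t = z *: 'X_[n]].
  split; first by exists 0; rewrite rmorph0 scale0r.
    by move=> x y [t tE] [u uE]; exists (t + u); rewrite rmorphD tE uE scalerDl.
  move=> a x [t tE]; have [u uE] := phiR a.
  by exists (u * t); rewrite rmorphM uE tE mul_mpolyC scalerA.
have phiG n z : G n z -> exists t, phi t = z *: 'X_[n].
  move: z; apply: (@multinom_ind (fun n => forall z, G n z -> exists t, phi t = z *: 'X_[n]) 0%MM).
  - by move=> z _; have [t tz] := phiR z; exists t; rewrite tz mpolyX0 alg_mpolyC.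
  - move=> k i _ IH; apply: subset_trans (genG k i) _.
    apply: (idmul_min (imid _)).
    move=> a g Ia /IH[u uE]; rewrite /=.
    suff [t tE] : exists t, phi t = a *: 'X_i.
      by exists (t * u); rewrite rmorphM tE uE -scalerAl -scalerAr -mpolyXD scalerA addmC.
    move: Ia; rewrite genE; apply: (ideal_span_min (imid _)).
    by move=> x /xsP /phix.
  - by apply/mnm_lepP => i; rewrite mnm0E.
pose J k : set T := [set t | forall n, L k n (phi t)@_n].
have [||K KP] := noetherian_acc noethT (L := J).
- move=> k; split.
  + by move=> n; rewrite rmorph0 mcoeff0; apply: is_ideal0; apply: graded_ideal.
  + move=> t u Jt Ju n; rewrite rmorphD mcoeffD.
    by apply: is_idealD; [apply: graded_ideal | apply: Jt | apply: Ju].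
  + by move=> t u Ju n; rewrite rmorphM; apply: act.
- by move=> k t Jt n; apply: incL; apply: Jt.
exists K => k n z Lz; have [t tz] := phiG _ _ (LG _ _ _ Lz).
have : J k t.
  move=> p; rewrite tz mcoeffZ mcoeffX; case: eqP => [<-|_]; first by rewrite mulr1.
  by rewrite mulr0; apply: is_ideal0; apply: graded_ideal.
by move=> /KP /(_ n); rewrite tz mcoeffZ mcoeffX eqxx mulr1.
Qed.

Definition eventually (Q : 'X_{1..s} -> Prop) :=
  exists M : nat, forall n, (forall i, (M <= n i)%N) -> Q n.

Lemma eventually_and (Q Q' : 'X_{1..s} -> Prop) :
  eventually Q -> eventually Q' -> eventually (fun n => Q n /\ Q' n).
Proof.
by move=> [M QM] [M' QM']; exists (maxn M M') => n nM; split;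
  [apply: QM => i | apply: QM' => i]; have := nM i; lia.
Qed.

Lemma eventually_all (J : finType) (Q : J -> 'X_{1..s} -> Prop) :
  (forall j, eventually (Q j)) -> eventually (fun n => forall j, Q j n).
Proof.
move=> /choice[M MP]; exists (\max_j M j)%N => n nM j; apply: MP => i.
exact: leq_trans (leq_bigmax j) (nM i).
Qed.

Lemma eventuallyW (Q Q' : 'X_{1..s} -> Prop) :
  (forall n, Q n -> Q' n) -> eventually Q -> eventually Q'.
Proof. by move=> QQ' [M QM]; exists M => n /QM /QQ'. Qed.

Lemma eventually_shift (Q : 'X_{1..s} -> Prop) p :
  eventually Q -> eventually (fun n => Q (n + p)%MM).
Proof. by move=> [M QM]; exists M => n nM; apply: QM => i; rewrite mnmDE; have := nM i; lia. Qed.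

(** The graded submodules generated by the components of degrees at most k form an
   increasing sequence, so one of them is L. Beyond the degrees of generators in
   direction i, a component is [I i] times the preceding one: the family defined
   by that formula is graded and contains the generators. *)
Lemma graded_fg G L : graded G -> generated_at0 G -> graded L ->
  (forall n, L n `<=` G n) ->
  eventually (fun n => forall i, L (n + U_(i))%MM `<=` idmul (I i) (L n)).
Proof.
move=> grG genG grL LG.
pose above k L' := graded L' /\ forall q : 'X_{1..s}, (forall i, (q i <= k)%N) -> L q `<=` L' q.
pose Lk k n : set R := [set z | forall L', above k L' -> L' n z].
have grLk k : graded (Lk k).
  split=> [n|n i a z Ia Lz L' aL']; last first.
    by apply: (gradedM aL'.1) => //; apply: Lz.
  split=> [L' aL'|x y Lx Ly L' aL'|a x Lx L' aL']; have idL := graded_ideal aL'.1 n.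
  - exact: is_ideal0.
  - by apply: is_idealD => //; [apply: Lx | apply: Ly].
  - by apply: is_ideal_mull => //; apply: Lx.
have LkL k n : Lk k n `<=` L n by move=> z Lz; apply: (Lz L); split=> // q _; exact: subset_refl.
have aboveLk k : above k (Lk k).
  by split=> // q qk z Lz L1 [_ aL1]; apply: aL1 Lz.
have incLk k n : Lk k n `<=` Lk k.+1 n.
  move=> z Lz L' [grL' aL']; apply: Lz; split=> // q qk.
  by apply: aL' => i; apply: leqW.
have LkG k n : Lk k n `<=` G n by apply: subset_trans (LG n).
have [K KP] := graded_acc grG genG grLk LkG incLk.
have LK n : L n `<=` Lk K n.
  move=> z Lz; apply: (KP (\max_i n i)%N).
  by apply: (aboveLk _).2 Lz => i; apply: leq_bigmax.
exists K => n nK i.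
pose L' p : set R := if (p i <= K)%N then L p else idmul (I i) (L (p - U_(i))%MM).
have idL' p : is_ideal (L' p).
  by rewrite /L'; case: ifP => _ //; apply: graded_ideal.
suff aL' : above K L'.
  move=> z /LK /(_ _ aL'); rewrite /L' mnmDE mnm1E eqxx ifF; last first.
    by apply/negbTE; have := nK i; lia.
  by rewrite addmK.
split; last by move=> q qK; rewrite /L' qK.
split=> // p j a z Ia.
have pj : (p + U_(j))%MM i = (p i + (j == i))%N by rewrite mnmDE mnm1E.
rewrite /L' pj; case: leqP => pK Lz.
  case: leqP => [_|pjK]; first exact: gradedM.
  have ji : j = i by apply/eqP; move: pjK; case: eqP => //; lia.
  by rewrite ji addmK; apply: idmul_in; rewrite -?ji.
rewrite ifF; last by apply/negbTE; lia.
have -> : (p + U_(j) - U_(i) = p - U_(i) + U_(j))%MM.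
  apply/mnmP => l; rewrite !mnmBE !mnmDE !mnmBE !mnm1E.
  by case: (i =P l) => [<-|]; lia.
suff sub : idmul (I i) (L (p - U_(i))%MM) `<=`
    colon (idmul (I i) (L (p - U_(i) + U_(j))%MM)) a by exact: sub.
apply: idmul_min => [|b c Ib Lc]; first exact: ideal_colon.
by rewrite /colon /= mulrCA; apply: idmul_in => //; apply: gradedM.
Qed.

End GradedFamilies.

(** * Superficial elements *)

Ltac mnm := by apply/mnmP=> ?;
  rewrite ?(mnmDE, mnmBE, mulmnE, mnm1E, mnm0E, mulnS, mulnDr, muln0, muln1); lia.

(** If powers of all the elements of gens carry z into T, some multiple w of z
   outside T is carried into T by each element of gens: for one element multiply
   by the largest power that stays outside T, then treat the next one. The index k
   records the number of factors, so that T may be a graded family or constant. *)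
Lemma killed_multiple (R : comNzRingType) (P : set R) (gens : seq R) :
  (forall a, a \in gens -> P a) ->
  forall T G : nat -> set R,
  (forall k a z, P a -> T k z -> T k.+1 (a * z)) ->
  (forall k a z, P a -> G k z -> G k.+1 (a * z)) ->
  forall z, G 0%N z -> ~ T 0%N z ->
  (forall a, a \in gens -> exists k, T k (a ^+ k * z)) ->
  exists k w, [/\ G k w, ~ T k w & forall a, a \in gens -> T k.+1 (a * w)].
Proof.
elim: gens => [|a r IH] Pgens T G TM GM z Gz nTz gensz; first by exists 0%N, z.
have Pa : P a by apply: Pgens; rewrite mem_head.
have TXM k l w : T k w -> T (k + l)%N (a ^+ l * w).
  elim: l => [|l IHl] Tw; first by rewrite addn0 mul1r.
  by rewrite addnS exprS -mulrA; apply: TM => //; apply: IHl.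
pose G' k w := G k w /\ exists l, T (k + l)%N (a ^+ l * w).
have [||||k [w [[Gw [l0 Tw]] nTw rw]]] := IH _ T G' TM _ z _ nTz.
- by move=> b br; apply: Pgens; rewrite inE br orbT.
- move=> k b w Pb [Gw [l Tw]]; split; first exact: GM.
  by exists l; rewrite mulrCA addSn; apply: TM.
- by split=> //; apply: gensz; rewrite mem_head.
- by move=> b br; apply: gensz; rewrite inE br orbT.
have exl : exists l, `[< T (k + l)%N (a ^+ l * w) >] by exists l0; apply/asboolP.
case: (ex_minnP exl) => -[|l] /asboolP Tl minl; first by case: nTw; rewrite addn0 mul1r in Tl.
exists (k + l)%N, (a ^+ l * w); split.
- elim: l {Tl minl} => [|l IHl]; first by rewrite addn0 mul1r.
  by rewrite addnS exprS -mulrA; apply: GM.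
- by move=> Tl'; have /minl := asboolT Tl'; rewrite ltnn.
- move=> b; rewrite inE => /predU1P[->|br]; first by rewrite mulrA -exprS -addnS.
  by rewrite mulrCA -addSn; apply: TXM; apply: rw.
Qed.

Section Superficial.
Variables (R : comNzRingType) (s : nat) (I : 'I_s -> set R).
Hypothesis noethR : noetherian R.
Hypothesis idI : forall i, is_ideal (I i).
Variable c : nat -> R.
Hypothesis c_unit : forall k l, k != l -> exists u, u * (c k - c l) = 1.
Variable G : 'X_{1..s} -> set R.
Hypothesis grG : graded I G.
Hypothesis genG : generated_at0 I G.
Variable i : 'I_s.
Implicit Types (Z : 'X_{1..s} -> set R) (n p : 'X_{1..s}) (a b x z : R).

Lemma gradedX Z n a z k : graded I Z -> I i a -> Z n z ->
  Z (n + U_(i) *+ k)%MM (a ^+ k * z).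
Proof.
move=> grZ Ia Zz; elim: k => [|k IH]; first by rewrite mulm0n addm0 mul1r.
have -> : (n + U_(i) *+ k.+1 = n + U_(i) *+ k + U_(i))%MM by mnm.
by rewrite exprS -mulrA; apply: (gradedM grZ).
Qed.

(** The elements of G whose class modulo Z is killed by a power of b, where b is
   placed in degree [U_(i)]. *)
Definition power_torsion Z b n : set R :=
  [set z | G n z /\ exists l, Z (n + U_(i) *+ l)%MM (b ^+ l * z)].

Lemma graded_power_torsion Z b : graded I Z -> I i b -> graded I (power_torsion Z b).
Proof.
move=> grZ Ib; have idZ := graded_ideal grZ; have idG := graded_ideal grG.
split=> [n|n j a z Ia [Gz [l Zl]]]; last first.
  split; first exact: (gradedM grG).
  exists l; rewrite mulrCA.
  have -> : (n + U_(j) + U_(i) *+ l = n + U_(i) *+ l + U_(j))%MM by mnm.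
  exact: (gradedM grZ).
split.
- by split; [apply: is_ideal0 | exists 0%N; rewrite mulr0; apply: is_ideal0].
- move=> x y [Gx [l Zl]] [Gy [k Zk]]; split; first exact: is_idealD.
  exists (l + k)%N; rewrite mulrDr; apply: is_idealD => //.
    have -> : (n + U_(i) *+ (l + k) = n + U_(i) *+ l + U_(i) *+ k)%MM by mnm.
    by rewrite addnC exprD -mulrA; apply: gradedX.
  have -> : (n + U_(i) *+ (l + k) = n + U_(i) *+ k + U_(i) *+ l)%MM by mnm.
  by rewrite exprD -mulrA; apply: gradedX.
- move=> a x [Gx [l Zl]]; split; first exact: is_ideal_mull.
  by exists l; rewrite mulrCA; apply: is_ideal_mull.
Qed.

(** The argument is the independence of eigenvectors. If z is annihilated by
   a + c_k b modulo the b-torsion, it is an eigenvector of a relative to b with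
   eigenvalue - c_k. The submodules annihilated by the products of the first k
   factors a + c_j b increase with k, so they are constant from some K on, and an
   eigenvector for a later eigenvalue, on which these products act as a unit times
   a power of b, must be b-torsion. *)
Lemma finitely_many_bad Z a b : graded I Z -> I i a -> I i b ->
  exists K, forall k, (K <= k)%N -> forall n z, G n z ->
  power_torsion Z b (n + U_(i))%MM ((a + c k * b) * z) -> power_torsion Z b n z.
Proof.
move=> grZ Ia Ib; set T := power_torsion Z b.
have grT : graded I T := graded_power_torsion grZ Ib.
have idT := graded_ideal grT; have idG := graded_ideal grG.
have Iab k : I i (a + c k * b) by apply: is_idealD => //; apply: is_ideal_mull.
have Tb n z : G n z -> T (n + U_(i))%MM (b * z) -> T n z.
  move=> Gz [_ [l Zl]]; split=> //; exists l.+1; rewrite exprSr -mulrA.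
  by have -> : (n + U_(i) *+ l.+1 = n + U_(i) + U_(i) *+ l)%MM by mnm.
pose P k := \prod_(j < k) (a + c j * b).
have PS k : P k.+1 = P k * (a + c k * b) by rewrite /P big_ord_recr.
have PT k n z : T n z -> T (n + U_(i) *+ k)%MM (P k * z).
  move=> Tz; elim: k => [|k IH]; first by rewrite mulm0n addm0 /P big_ord0 mul1r.
  have -> : (n + U_(i) *+ k.+1 = n + U_(i) *+ k + U_(i))%MM by mnm.
  by rewrite PS mulrAC mulrC; apply: (gradedM grT).
pose L k n : set R := [set z | G n z /\ T (n + U_(i) *+ k)%MM (P k * z)].
have grL k : graded I (L k).
  split=> [n|n j d z Id [Gz Tz]]; last first.
    split; first exact: (gradedM grG).
    have -> : (n + U_(j) + U_(i) *+ k = n + U_(i) *+ k + U_(j))%MM by mnm.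
    by rewrite mulrCA; apply: (gradedM grT).
  split; first by split; rewrite ?mulr0; apply: is_ideal0.
    by move=> x y [Gx Tx] [Gy Ty]; split; rewrite ?mulrDr; apply: is_idealD.
  by move=> d x [Gx Tx]; split; rewrite 1?mulrCA; apply: is_ideal_mull.
have LG k n : L k n `<=` G n by move=> z [].
have incL k n : L k n `<=` L k.+1 n.
  move=> z [Gz Tz]; split=> //.
  have -> : (n + U_(i) *+ k.+1 = n + U_(i) *+ k + U_(i))%MM by mnm.
  by rewrite PS mulrAC mulrC; apply: (gradedM grT).
have [K KP] := graded_acc noethR idI grG genG grL LG incL.
exists K => k Kk n z Gz Tz.
have Lz : L k.+1 n z.
  split=> //; have -> : (n + U_(i) *+ k.+1 = n + U_(i) + U_(i) *+ k)%MM by mnm.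
  by rewrite PS -mulrA; apply: PT.
have [_] := KP _ _ _ Lz; move=> {Lz}.
(* Modulo the torsion, a z = - c_k (b z): applying the factor a + c_j b to z
   gives (c_j - c_k) b z, a unit multiple of b z, so the product of the first K
   factors can be cancelled one at a time. *)
have : (K <= k)%N by [].
elim: {KP} K n z Gz Tz {Kk} => [|q IH] n z Gz Tz qk.
  by rewrite /P big_ord0 mul1r mulm0n addm0.
have -> : (n + U_(i) *+ q.+1 = n + U_(i) + U_(i) *+ q)%MM by mnm.
rewrite PS -mulrA => /IH Tqz.
have {Tqz} Tqz : T (n + U_(i))%MM ((a + c q * b) * z).
  apply: Tqz; last exact: ltnW.
    exact: (gradedM grG).
  by rewrite mulrCA; apply: (gradedM grT).
have [u uE] : exists u, u * (c k - c q) = 1 by apply: c_unit; rewrite gtn_eqF.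
apply: Tb => //.
have -> : b * z = u * ((a + c k * b) * z - (a + c q * b) * z).
  by rewrite -[LHS]mul1r -uE; ring.
by apply: is_ideal_mull => //; apply: is_idealB.
Qed.

Lemma power_torsionB Z x b d n z : graded I Z -> I i x -> I i b ->
  power_torsion Z x n z -> power_torsion Z b n z -> power_torsion Z (x - d * b) n z.
Proof.
move=> grZ Ix Ib [Gz [l Zl]] [_ [k Zk]]; split=> //; exists (l + k)%N.
rewrite exprDn mulr_suml; apply: ideal_sum => [|q]; first exact: (graded_ideal grZ).
rewrite mulrnAl -mulr_natl; apply: is_ideal_mull; first exact: (graded_ideal grZ).
rewrite -mulNr exprMn; rewrite [_ * (_ * b ^+ q)]mulrCA -mulrA.
apply: is_ideal_mull; first exact: (graded_ideal grZ).
have := ltn_ord q; move: (nat_of_ord q) => {}q; rewrite ltnS => ql.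
have [kq|qk] := leqP k q.
  have [e [f [-> ->]]] : exists e f, [/\ q = e + k & l = f + e]%N.
    by exists (q - k)%N, (l + k - q)%N; split; lia.
  have -> : (f + e + k - (e + k) = f)%N by lia.
  have -> : (n + U_(i) *+ (f + e + k) = n + U_(i) *+ k + U_(i) *+ e + U_(i) *+ f)%MM by mnm.
  by rewrite [b ^+ _]exprD -!mulrA; apply: gradedX => //; apply: gradedX.
have [e ->] : exists e, k = (q + e)%N by exists (k - q)%N; lia.
have -> : (l + (q + e) - q = e + l)%N by lia.
have -> : (n + U_(i) *+ (l + (q + e)) = n + U_(i) *+ l + U_(i) *+ e + U_(i) *+ q)%MM by mnm.
by rewrite mulrAC mulrC exprD -!mulrA; apply: gradedX => //; apply: gradedX.
Qed.

(** A general linear combination x of the elements of r acts as the whole ideal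
   that they generate: its torsion is their common torsion. One adds the elements
   of r one at a time, avoiding the finitely many bad coefficients for all the
   families Z j at once. *)
Lemma common_torsion (J : finType) (Z : J -> 'X_{1..s} -> set R) (r : seq R) :
  (forall j, graded I (Z j)) -> (forall a, a \in r -> I i a) ->
  exists2 x, I i x & forall j n z, power_torsion (Z j) x n z ->
    forall a, a \in r -> power_torsion (Z j) a n z.
Proof.
move=> grZ; elim: r => [|b r IH] Ir; first by exists 0 => //; apply: is_ideal0.
have [|x Ix xP] := IH; first by move=> a ar; apply: Ir; rewrite inE ar orbT.
have Ib : I i b by apply: Ir; rewrite mem_head.
have /choice[K KP] := fun j => finitely_many_bad (grZ j) Ix Ib.
pose k := (\max_j K j)%N.
have Iy : I i (x + c k * b) by apply: is_idealD => //; apply: is_ideal_mull.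
exists (x + c k * b) => // j n z yz.
have bz : power_torsion (Z j) b n z.
  have [Gz [l Zl]] := yz.
  have {Zl} : power_torsion (Z j) b (n + U_(i) *+ l)%MM ((x + c k * b) ^+ l * z).
    split; first exact: gradedX.
    by exists 0%N; rewrite mul1r mulm0n addm0.
  elim: l => [|l IHl]; first by rewrite mulm0n addm0 mul1r.
  have -> : (n + U_(i) *+ l.+1 = n + U_(i) *+ l + U_(i))%MM by mnm.
  rewrite exprS -mulrA => ybz; apply: IHl; apply: (KP j k) ybz.
    exact: leq_bigmax.
  exact: gradedX.
move=> a; rewrite inE => /predU1P[->//|]; apply: xP.
by rewrite -[x](addrK (c k * b)); apply: power_torsionB.
Qed.

(** Let T be the saturation of Z with respect to [I i]. It is reached after
   finitely many steps and coincides with Z in large degrees, because there each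
   component of T is a high power of [I i] times another one, and that power
   carries T into Z. An element x whose torsion modulo T is the [I i]-torsion is a
   nonzerodivisor modulo T. This replaces the avoidance of associated primes. *)
Lemma superficial_element (J : finType) (Z : J -> 'X_{1..s} -> set R) :
  (forall j, graded I (Z j)) -> (forall j n, Z j n `<=` G n) ->
  exists2 x, I i x & forall j, eventually (fun n =>
    forall z, G n z -> Z j (n + U_(i))%MM (x * z) -> Z j n z).
Proof.
move=> grZ ZG; have idG := graded_ideal grG.
have satZ j : exists T, [/\ graded I T, forall n, Z j n `<=` T n,
    forall n z, G n z -> (forall a, I i a -> T (n + U_(i))%MM (a * z)) -> T n z
  & eventually (fun n => T n `<=` Z j n)].
  pose T k := iter k (fun (T : 'X_{1..s} -> set R) n => [set z | G n z /\
    forall a, I i a -> T (n + U_(i))%MM (a * z)]) (Z j).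
  have grT k : graded I (T k).
    elim: k => [|k IH]; first exact: grZ.
    split=> [n|n l a z Ia [Gz Tz]]; last first.
      split=> [|b Ib]; first exact: (gradedM grG).
      have -> : (n + U_(l) + U_(i) = n + U_(i) + U_(l))%MM by mnm.
      by rewrite mulrCA; apply: (gradedM IH) => //; apply: Tz.
    have idT := graded_ideal IH.
    split; first by split=> [|a Ia]; rewrite ?mulr0; apply: is_ideal0.
      move=> x y [Gx Tx] [Gy Ty]; split=> [|a Ia]; first exact: is_idealD.
      by rewrite mulrDr; apply: is_idealD => //; [apply: Tx | apply: Ty].
    move=> a x [Gx Tx]; split=> [|b Ib]; first exact: is_ideal_mull.
    by rewrite mulrCA; apply: is_ideal_mull => //; apply: Tx.
  have TG k n : T k n `<=` G n by case: k => [|k] z; [apply: ZG | case].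
  have incT k n : T k n `<=` T k.+1 n.
    move=> z Tz; split=> [|a Ia]; first exact: TG Tz.
    exact: (gradedM (grT k)).
  have [K KP] := graded_acc noethR idI grG genG grT TG incT.
  exists (T K); split=> //.
  - by move=> n; apply: (KP 0%N).
  - by move=> n z Gz Tz; apply: (KP K.+1).
  have [M MP] := graded_fg noethR idI grG genG (grT K) (TG K).
  have TK q n : (q <= K)%N -> (forall l, (M <= n l)%N) ->
      T K (n + U_(i) *+ q)%MM `<=` T (K - q)%N (n + U_(i) *+ q)%MM.
    elim: q => [|q IH] qK nM; first by rewrite subn0.
    have -> : (n + U_(i) *+ q.+1 = n + U_(i) *+ q + U_(i))%MM by mnm.
    have Mq l : (M <= (n + U_(i) *+ q)%MM l)%N by rewrite mnmDE; have := nM l; lia.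
    apply: subset_trans (MP _ Mq i) _.
    apply: idmul_min; first exact: graded_ideal (grT _) _.
    move=> a z Ia Tz; have := IH (ltnW qK) nM _ Tz.
    have -> : (K - q = (K - q.+1).+1)%N by lia.
    by case=> _; apply.
  exists (M + K)%N => n nM.
  have nE : n = (n - U_(i) *+ K + U_(i) *+ K)%MM.
    apply/mnmP => l; rewrite !(mnmDE, mnmBE, mulmnE, mnm1E).
    by have := nM l; case: (i == l); lia.
  have := TK K (n - U_(i) *+ K)%MM (leqnn K); rewrite subnn -nE; apply=> l.
  by rewrite mnmBE mulmnE mnm1E; have := nM l; case: (i == l); lia.
have /choice[T TP] := satZ.
have [r rE] := noethR (idI i).
have rI a : a \in r -> I i a by rewrite rE => ar; apply: sub_ideal_span.
have grT j : graded I (T j) by have [] := TP j.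
have [x Ix xP] := common_torsion grT rI.
exists x => // j; have [_ ZT satT] := TP j.
apply: eventuallyW => n TZ z Gz Zxz; apply: (TZ z).
have tz : forall a, a \in r -> power_torsion (T j) a n z.
  apply: xP; split=> //; exists 1%N; rewrite expr1.
  by rewrite mulm1n; apply: ZT.
apply: contrapT => nTz.
have Sn k : (n + U_(i) *+ k.+1 = n + U_(i) *+ k + U_(i))%MM by mnm.
have [||||a ar|k [w [Gw nTw rw]]] := @killed_multiple _ (I i) r rI
    (fun k => T j (n + U_(i) *+ k)%MM) (fun k => G (n + U_(i) *+ k)%MM) _ _ z.
- by move=> k a w Ia Tw; rewrite Sn; apply: (gradedM (grT j)).
- by move=> k a w Ia Tw; rewrite Sn; apply: (gradedM grG).
- by rewrite mulm0n addm0.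
- by rewrite mulm0n addm0.
- by have [_] := tz a ar.
apply: nTw; apply: satT => // a; rewrite -Sn.
rewrite rE; move: a; apply: (ideal_span_min (J := [set a | T j _ (a * w)])) => //.
have idT := graded_ideal (grT j) (n + U_(i) *+ k.+1)%MM.
split=> [|a b Ta Tb|a b Tb] /=; first by rewrite mul0r; apply: is_ideal0.
  by rewrite mulrDl; apply: is_idealD.
by rewrite -mulrA; apply: is_ideal_mull.
Qed.

End Superficial.

(** * Noetherian local rings of depth and dimension two *)

Section LocalRing.
Variables (R : comNzRingType) (m : set R).
Hypothesis noethR : noetherian R.
Hypothesis locR : local_ring m.
Implicit Types (A B P Q V W : set R) (x y z a b u v : R).

Definition nonzerodivisor x := forall z, x * z = 0 -> z = 0.

(** For x and y in the maximal ideal of a Noetherian local ring this is a regular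
   sequence of length two in either order; the last clause is the vanishing of the
   first Koszul homology. *)
Definition regular_pair x y :=
  [/\ nonzerodivisor x, nonzerodivisor y
    & forall p q, x * p = y * q -> exists r, p = y * r].

(** For an ideal A of a Noetherian local ring this amounts to finiteness of the
   length of R/A. Speaking of the powers of elements, and not of those of m, avoids
   counting exponents. *)
Definition cofinite A := forall f, m f -> exists k, A (f ^+ k).

Lemma ideal_max : is_ideal m. Proof. by case: locR => -[]. Qed.
Hint Resolve ideal_max : core.

Lemma max_proper : ~ m 1.
Proof. by case: locR => -[im mT _] _ m1; move/eqP: mT; apply; apply: is_ideal_1. Qed.

Lemma proper_sub_max A : is_ideal A -> ~ A 1 -> A `<=` m.
Proof.
move=> idA A1.
have [||B [[idB B1] AB maxB]] := @noetherian_max _ noethR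
  [set B | is_ideal B /\ ~ B 1] A.
- by move=> B [].
- by [].
suff <- : B = m by [].
apply: locR.2; split=> //; first by apply/eqP => BT; apply: B1; rewrite BT.
move=> C idC CT BC; apply/seteqP; split=> //; apply: maxB => //; split=> // C1.
by move/eqP: CT; apply; apply: is_ideal_1.
Qed.

Lemma local_unit x : ~ m x -> exists u, u * x = 1.
Proof.
move=> mx; have [[u _ <-]|nu] := pselect (principal x 1).
  by exists u; rewrite mulrC.
by case: mx; apply: (proper_sub_max _ nu).
Qed.

Lemma prime_max : prime_ideal m.
Proof.
split=> //; first by apply/eqP => mT; apply: max_proper; rewrite mT.
move=> x y mxy; have [|/local_unit[u ux]] := pselect (m x); first by left.
by right; rewrite -[y]mul1r -ux -mulrA; apply: is_ideal_mull.
Qed.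

Lemma unit_1B a : m a -> exists u, u * (1 - a) = 1.
Proof.
move=> ma; apply: local_unit => m1a; apply: max_proper.
by rewrite -[1](subrK a); apply: is_idealD.
Qed.

(** If W' is maximal among the ideals between W and W + V that do not contain V,
   then (W + V)/W' is simple, so m kills it. Hence V lies in W + m V, which lies in
   W', a contradiction. *)
Lemma nakayama V W Q : is_ideal V -> is_ideal W -> Q `<=` m ->
  V `<=` idsum W (idmul Q V) -> V `<=` W.
Proof.
move=> idV idW Qm VWQV; apply: contrapT => nVW.
have [||W' [[idW' W'V nW'] WW' maxW']] := @noetherian_max _ noethR
  [set B | [/\ is_ideal B, B `<=` idsum W V & ~ V `<=` B]] W.
- by move=> B [].
- by split=> //; apply: sub_idsuml.
have mVW' a z : m a -> V z -> W' (a * z).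
  move=> ma Vz; apply: contrapT => naz.
  have idS := ideal_idsum idW' (ideal_principal (a * z)).
  have VS : V `<=` idsum W' (principal (a * z)).
    apply: contrapT => nVS; apply: naz.
    apply: (maxW' (idsum W' (principal (a * z)))).
    - split=> //; apply: idsum_min => //; first exact: ideal_idsum.
      apply: principal_min; first exact: ideal_idsum.
      by apply: sub_idsumr => //; apply: is_ideal_mull.
    - exact: sub_idsuml.
    - by apply: sub_idsumr.
  have [w [_ [Ww [r _ <-] zE]]] := VS _ Vz.
  have [|u uE] := @unit_1B (r * a); first exact: is_ideal_mull.
  apply: naz; apply: is_ideal_mull => //.
  have -> : z = u * w.
    have wE : w = (1 - r * a) * z by rewrite mulrBl mul1r {1}zE; ring.
    by rewrite wE mulrA uE mul1r.
  exact: is_ideal_mull.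
apply: nW' => z /VWQV [w [v [Ww Vv ->]]]; apply: is_idealD => //; first exact: WW'.
move: v Vv; apply: idmul_min => // a b Qa Vb.
by apply: mVW' => //; apply: Qm.
Qed.

Lemma nakayama0 x V : m x -> is_ideal V -> (forall z, V z -> exists2 w, V w & z = x * w) ->
  forall z, V z -> z = 0.
Proof.
move=> mx idV VxV; apply: (nakayama (W := [set 0]) (Q := m) idV) => // z Vz.
have [w Vw ->] := VxV z Vz.
by apply: sub_idsumr => //; apply: idmul_in.
Qed.

Lemma socle_element B z : is_ideal B -> ~ B z ->
  (forall f, m f -> exists k, B (f ^+ k * z)) ->
  exists w, ~ B w /\ forall a, m a -> B (a * w).
Proof.
move=> idB nBz nilz; have [r rE] := noethR ideal_max.
have rm a : a \in r -> m a by rewrite rE => ar; apply: sub_ideal_span.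
have [||||a ar|k [w [_ nBw rw]]] := @killed_multiple _ m r rm (fun=> B) (fun=> setT) _ _ z.
- by move=> k a w _; apply: is_ideal_mull.
- by [].
- by [].
- by [].
- by apply: nilz; apply: rm.
exists w; split=> // a; rewrite rE; move: a.
apply: (ideal_span_min (J := [set a | B (a * w)])) => //.
split=> [|a b Ba Bb|a b Bb] /=; first by rewrite mul0r; apply: is_ideal0.
  by rewrite mulrDl; apply: is_idealD.
by rewrite -mulrA; apply: is_ideal_mull.
Qed.

(** An ideal maximal among those that contain A and miss the multiplicative set S
   is prime. *)
Lemma prime_disjoint A S : is_ideal A -> S 1 ->
  (forall x y, S x -> S y -> S (x * y)) -> (forall x, A x -> ~ S x) ->
  exists P, [/\ prime_ideal P, A `<=` P & forall x, P x -> ~ S x].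
Proof.
move=> idA S1 SM AS.
have [||P [[idP PS] AP maxP]] := @noetherian_max _ noethR
  [set B | is_ideal B /\ forall x, B x -> ~ S x] A.
- by move=> B [].
- by [].
exists P; split=> //; split=> //.
  by apply/eqP => PT; apply: (PS 1) => //; rewrite PT.
move=> x y Pxy; apply: contrapT => /not_orP[nPx nPy].
have meet z : ~ P z -> exists p r, P p /\ S (p + z * r).
  move=> nPz; apply: contrapT => noS.
  apply: nPz; apply: (maxP (idsum P (principal z))).
  - split; first exact: ideal_idsum.
    move=> w [p [q [Pp [r _ <-] ->]]] Sw; apply: noS; by exists p, r.
  - exact: sub_idsuml.
  - by apply: sub_idsumr.
have [p [r [Pp Sp]]] := meet _ nPx; have [q [t [Pq Sq]]] := meet _ nPy.
apply: (PS _ _ (SM _ _ Sp Sq)).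
have -> : (p + x * r) * (q + y * t) =
    p * (q + y * t) + ((x * r) * q + (x * y) * (r * t)) by ring.
apply: (is_idealD idP); first exact: (is_ideal_mulr _ idP).
by apply: (is_idealD idP); [apply: (is_ideal_mull _ idP) | apply: (is_ideal_mulr _ idP)].
Qed.

Lemma regular_pairC x y : regular_pair x y -> regular_pair y x.
Proof.
move=> [nx ny xy]; split=> // p q pq; have [r qE] := xy _ _ (esym pq).
exists r; apply/eqP; rewrite -subr_eq0; apply/eqP; apply: ny.
by rewrite mulrBr pq qE; ring.
Qed.

Lemma nonzerodivisor_inj x y z : nonzerodivisor x -> x * y = x * z -> y = z.
Proof.
move=> nx xyz; apply/eqP; rewrite -subr_eq0; apply/eqP; apply: nx.
by rewrite mulrBr xyz subrr.
Qed.

Lemma regular_pairI x y : m x -> nonzerodivisor x ->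
  (forall z, principal x (y * z) -> principal x z) -> regular_pair x y.
Proof.
move=> mx nx xy; split=> //.
  move=> z yz; apply: (@nakayama0 x (colon [set 0] y)) => //; first exact: ideal_colon.
  move=> {yz}z /= yz; have [|w _ zE] := xy z; first by rewrite yz; apply: is_ideal0.
  exists w => //; apply: nx; rewrite /colon /= -yz -zE; ring.
move=> p q pq; have [|r _ qE] := xy q; first by exists p.
by exists r; apply: (nonzerodivisor_inj nx); rewrite pq -qE; ring.
Qed.

Lemma nonzerodivisorM x y : nonzerodivisor x -> nonzerodivisor y -> nonzerodivisor (x * y).
Proof. by move=> nx ny z; rewrite -mulrA => /nx /ny. Qed.

Lemma regular_pairM x y z : regular_pair x y -> regular_pair x z -> regular_pair x (y * z).
Proof.
move=> [nx ny xy] [_ nz xz]; split=> //; first exact: nonzerodivisorM.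
move=> p q pq; have [|r pE] := xy p (z * q); first by rewrite pq mulrA.
have [|t rE] := xz r q.
  by apply: (nonzerodivisor_inj ny); rewrite mulrCA -pE pq mulrA.
by exists t; rewrite pE rE mulrA.
Qed.

Lemma regular_pair1 x : nonzerodivisor x -> regular_pair x 1.
Proof.
move=> nx; split=> // [z|p q _]; first by rewrite mul1r.
by exists p; rewrite mul1r.
Qed.

Lemma regular_pairX x y k : regular_pair x y -> regular_pair x (y ^+ k).
Proof.
move=> xy; elim: k => [|k IH]; first by apply: regular_pair1; case: xy.
by rewrite exprS; apply: regular_pairM.
Qed.

(** Otherwise some f in m has no power in (x, y). Then one finds primes
   P0 < P1 < Q < m, contradicting dimension two: Q contains x and y and no power
   of f, P1 inside Q contains x and not y since y is regular modulo x, and P0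
   inside P1 does not contain x since x is a nonzerodivisor. *)
Lemma regular_pair_cofinite x y : krull_dim R 2 -> m x -> m y -> regular_pair x y ->
  cofinite (idsum (principal x) (principal y)).
Proof.
move=> [_ dim2] mx my [nx ny xy] f mf; apply: contrapT => nf.
set A := idsum _ _ in nf; have idA : is_ideal A by apply: ideal_idsum.
have Ax : A x by apply: sub_idsuml.
have Ay : A y by apply: sub_idsumr.
have [|||Q [[idQ QT Qpr] AQ Qf]] := @prime_disjoint A [set f ^+ k | k in setT] idA.
- by exists 0%N.
- by move=> _ _ [k _ <-] [l _ <-]; exists (k + l)%N; rewrite ?exprD.
- by move=> z Az [k _ zE]; apply: nf; exists k; rewrite zE.
have one P : prime_ideal P -> ~ P 1.
  by move=> [idP /eqP PT _] P1; apply: PT; apply: is_ideal_1.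
have localize Q' w B : prime_ideal Q' -> is_ideal B ->
    (forall z k, ~ Q' z -> ~ B (z * w ^+ k)) ->
    exists P, [/\ prime_ideal P, B `<=` P, P `<=` Q' & ~ P w].
  move=> Qp idB Bw; have Q1 := one _ Qp; case: (Qp) => idQ' _ Qpr'.
  have [|||P [Pp BP PS]] := @prime_disjoint B
    [set z | exists t k, ~ Q' t /\ z = t * w ^+ k] idB.
  - by exists 1, 0%N; rewrite mulr1.
  - move=> _ _ [t [k [Qt ->]]] [t' [k' [Qt' ->]]]; exists (t * t'), (k + k')%N.
    by split; [move=> /Qpr'[] | rewrite exprD mulrACA].
  - by move=> z Bz [t [k [Qt zE]]]; move: Bz; rewrite zE; apply: Bw.
  exists P; split=> // [z Pz|Pw].
    apply: contrapT => Qz; apply: (PS z Pz); exists z, 0%N; by rewrite mulr1.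
  by apply: (PS w Pw); exists 1, 1%N; rewrite mul1r.
have [|||P1 [P1p xP1 P1Q P1y]] := localize Q y (principal x).
- by split.
- by [].
- move=> z k Qz Pz; apply: Qz; suff : principal x z by apply: principal_min => //; apply: AQ.
  have [t _ tE] := Pz.
  have [_ _ /(_ t z)[|r tr]] := regular_pairX k (And3 nx ny xy); first by rewrite tE mulrC.
  exists r => //; have [_ nyk _] := regular_pairX k (And3 nx ny xy).
  by apply: (nonzerodivisor_inj nyk); rewrite mulrCA -tr tE mulrC.
have [|||P0 [P0p _ P0P1 P0x]] := localize P1 x [set 0].
- by [].
- by [].
- move=> z k P1z zx; apply: P1z.
  suff -> : z = 0 by apply: is_ideal0; case: P1p.
  elim: k zx => [|k IH]; first by rewrite mulr1.
  by rewrite exprS mulrCA => /nx.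
have := dim2 3; suff H : [set l | exists P : nat -> set R,
      (forall i, (i <= l)%N -> prime_ideal (P i)) /\
      (forall i, (i < l)%N -> P i `<` P i.+1)] 3 by move=> /(_ H).
exists (fun k => nth m [:: P0; P1; Q] k); split.
  by case=> [|[|[|[|]]]] //= _; exact: prime_max.
have ps B C w : B `<=` C -> C w -> ~ B w -> B `<` C.
  by move=> BC Cw nBw; split=> // CB; apply: nBw; apply: CB.
case=> [|[|[|]]] //= _.
- by apply: (ps _ _ x) => //; apply: xP1.
- by apply: (ps _ _ y) => //; apply: AQ.
- apply: (ps _ _ f) => //; first by apply: proper_sub_max => //; apply: one; split.
  by move=> Qf1; apply: (Qf f) => //; exists 1%N.
Qed.

Section Depth2.
Variables (u v : R).
Hypotheses (mu : m u) (mv : m v) (uv : regular_pair u v).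

(** R/(x) has depth one, since R has depth two. If u z = x al and v z = x be then
   v al = u be, so al is divisible by u, and then z by x. *)
Lemma socle_free x z : nonzerodivisor x ->
  (forall a, m a -> principal x (a * z)) -> principal x z.
Proof.
move=> nx mz; have [al _ alE] := mz u mu; have [be _ beE] := mz v mv.
have [nu nv uvP] := uv.
have [|r beE'] := uvP be al.
  apply: (nonzerodivisor_inj nx).
  by rewrite mulrCA beE mulrCA [in RHS]mulrCA alE mulrCA.
exists r => //; apply: (nonzerodivisor_inj nv).
by rewrite -beE beE'; ring.
Qed.

Lemma cofinite_regular_mod Q x z : cofinite Q -> nonzerodivisor x ->
  (forall a, Q a -> principal x (a * z)) -> principal x z.
Proof.
move=> cQ nx Qz; apply: contrapT => nz.
have [f mf|w [nw mw]] := socle_element (ideal_principal x) nz.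
  by have [k Qf] := cQ f mf; exists k; apply: Qz.
by apply: nw; apply: socle_free.
Qed.

Lemma cofinite_regular Q z : cofinite Q -> (forall a, Q a -> a * z = 0) -> z = 0.
Proof.
move=> cQ Qz; have [k Qu] := cQ u mu.
have : nonzerodivisor (u ^+ k).
  have [nu _ _] := uv.
  by elim: k {Qu} => [|k IH]; [move=> w; rewrite mul1r | rewrite exprS; apply: nonzerodivisorM].
by move=> nuk; apply: nuk; apply: Qz.
Qed.

(** The ideal (a, b) contains a regular pair U, V, made of powers of the given one.
   This forces the first Koszul homology on (a, b) to vanish, and regularity
   follows by Nakayama's lemma. *)
Lemma cofinite_regular_pair a b : m a -> m b ->
  cofinite (idsum (principal a) (principal b)) -> regular_pair a b.
Proof.
move=> ma mb cab.
have [k [_ [_ [[al _ <-] [be _ <-] UE]]]] := cab u mu.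
have [l [_ [_ [[ga _ <-] [de _ <-] VE]]]] := cab v mv.
have UV : regular_pair (u ^+ k) (v ^+ l).
  by apply: regular_pairX; apply: regular_pairC; apply: regular_pairX; apply: regular_pairC.
move: (u ^+ k) (v ^+ l) UE VE UV => {k l} U V UE VE [nU nV UVP].
(* H_1 of the Koszul complex on (a, b) vanishes: the ideal (a, b) kills it, so
   U (p, q) is the boundary of some w. Then U divides a w and b w, hence V w,
   hence w, and U can be cancelled. *)
have H1 p q : a * p + b * q = 0 -> exists r, p = b * r /\ q = - (a * r).
  move=> pq; pose w := be * p - al * q.
  have Up : U * p = b * w.
    have -> : U * p = be * (b * p) + al * (a * p) by rewrite UE; ring.
    have -> : a * p = - (b * q) by apply/eqP; rewrite -addr_eq0 pq.
    rewrite /w; ring.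
  have Uq : U * q = - (a * w).
    have -> : U * q = al * (a * q) + be * (b * q) by rewrite UE; ring.
    have -> : b * q = - (a * p) by apply/eqP; rewrite -addr_eq0 addrC pq.
    rewrite /w; ring.
  have [_ _ VUP] := regular_pairC (And3 nU nV UVP).
  have [|r wr] := VUP w (de * p - ga * q).
    have -> : V * w = ga * (a * w) + de * (b * w) by rewrite VE; ring.
    have -> : a * w = - (U * q) by rewrite Uq opprK.
    rewrite -Up; ring.
  exists r; split; apply: (nonzerodivisor_inj nU).
    by rewrite Up wr; ring.
  by rewrite Uq wr; ring.
split.
- move=> z az; apply: (@nakayama0 b (colon [set 0] a)) => //; first exact: ideal_colon.
  move=> {az}z /= az; have [|r [zr ar]] := H1 z 0; first by rewrite az mulr0 addr0.
  by exists r => //; rewrite /colon /= -[LHS]opprK -ar oppr0.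
- move=> z bz; apply: (@nakayama0 a (colon [set 0] b)) => //; first exact: ideal_colon.
  move=> {bz}z /= bz; have [|r [br zr]] := H1 0 z; first by rewrite bz mulr0 addr0.
  by exists (- r); rewrite /colon /= ?mulrN -?br ?oppr0.
- move=> p q pq; have [|r [pr _]] := H1 p (- q); first by rewrite pq mulrN subrr.
  by exists r.
Qed.

End Depth2.

Lemma depth2_regular_pair : depth m 2 -> exists u v, [/\ m u, m v & regular_pair u v].
Proof.
move=> [[xs [xs2 xsm [_ reg]]] _].
case: xs xs2 xsm reg => [|u [|v []]] //= _ xsm reg.
have mu : m u by apply: xsm; rewrite /= !inE eqxx.
exists u, v; split=> //; first by apply: xsm; rewrite /= !inE eqxx orbT.
apply: regular_pairI => //.
  move=> z uz; have := reg 0%N isT z; rewrite /= uz.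
  have -> : [set` [::]] = set0 :> set R by apply/seteqP; split.
  move=> /(_ (is_ideal0 (ideal_span_ideal _))).
  by apply: (ideal_span_min (J := [set 0])).
move=> z; have := reg 1%N isT z => /=.
have -> : [set` [:: u]] = [set u].
  by apply/seteqP; split=> w /=; [rewrite inE => /eqP | move=> ->; rewrite mem_head].
by rewrite span1.
Qed.

End LocalRing.

(** * Lengths of intervals of ideals *)

Section Length.
Variable R : comNzRingType.
Implicit Types (A B C D J K : set R) (x y z : R) (l : nat).

(** The last ideal B is an index, so that chains can be extended at the top and
   compared by induction; the first one may be larger than A. *)
Inductive chain A : set R -> nat -> Prop :=
| chain0 B : is_ideal B -> A `<=` B -> chain A B 0
| chainS B C l : chain A B l -> is_ideal C -> B `<` C -> chain A C l.+1.

Definition finite_length A B := exists b, forall l, chain A B l -> (l <= b)%N.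
Definition len A B : nat := xget 0%N (is_maximum (chain A B)).

Lemma chain_ideal A B l : chain A B l -> is_ideal B.
Proof. by case. Qed.
Lemma chain_sub A B l : chain A B l -> A `<=` B.
Proof. by elim=> // {}B C {}l _ AB _ [BC _]; apply: subset_trans BC. Qed.
Lemma chain_top A B C l : chain A B l -> is_ideal C -> B `<=` C -> chain A C l.
Proof.
move=> [D idD AD|D E k Dk idE [DE nED]] idC BC; first by apply: chain0 => //; apply: subset_trans BC.
apply: chainS Dk idC _; split; first exact: subset_trans BC.
by move=> CD; apply: nED; apply: subset_trans CD.
Qed.
Lemma chain_bottom A B C l : chain B C l -> A `<=` B -> chain A C l.
Proof.
move=> ch AB; elim: ch => [D idD BD|D E k _ IH idE DE]; last exact: chainS IH idE DE.
by apply: chain0 => //; apply: subset_trans BD.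
Qed.
Lemma chain_cat A B C k l : chain A B k -> chain B C l -> chain A C (k + l).
Proof.
move=> AB; elim=> [D idD BD|D E j _ IH idE DE]; first by rewrite addn0; apply: chain_top BD.
by rewrite addnS; apply: chainS IH idE DE.
Qed.

Lemma chainSE A B l : chain A B l.+1 -> exists2 D, chain A D l & D `<` B.
Proof. by move E : l.+1 => k ch; case: ch E => // C D j chC _ CD [->]; exists C. Qed.

Lemma chain_proper A B l : chain A B l.+1 -> ~ (B `<=` A).
Proof.
move=> /chainSE[D chD [DB nBD]] BA.
by apply: nBD; apply: subset_trans BA (chain_sub chD).
Qed.

(** Jordan-Hoelder by the modular law: intersecting a chain with B and adding B to
   it give two chains with repetitions, and at each step at least one of them is
   strict. *)
Lemma chain_split A B C l : is_ideal B -> A `<=` B -> chain A C l ->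
  exists k1 k2, [/\ (l <= k1 + k2)%N, chain A (C `&` B) k1 & chain B (idsum C B) k2].
Proof.
move=> idB AB; elim=> [D idD AD|D E j chD [k1 [k2 [jk ch1 ch2]]] idE [DE nED]].
  exists 0%N, 0%N; split=> //; apply: chain0; first exact: ideal_setI.
  - by move=> a Aa; split; [apply: AD | apply: AB].
  - exact: ideal_idsum.
  - exact: sub_idsumr.
have idD := chain_ideal chD.
have idEB := ideal_setI idE idB; have idEsB := ideal_idsum idE idB.
have sI : D `&` B `<=` E `&` B by move=> d [Dd Bd]; split=> //; apply: DE.
have sS : idsum D B `<=` idsum E B.
  by move=> _ [d [b [Dd Bb ->]]]; exists d, b; split=> //; apply: DE.
have [EB|nEB] := pselect (E `&` B `<=` D `&` B).
  exists k1, k2.+1; rewrite addnS ltnS; split=> //; first exact: chain_top sI.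
  apply: chainS ch2 idEsB _; split=> // sES; apply: nED => e Ee.
  have [|d [b [Dd Bb eE]]] := sES e; first exact: sub_idsuml.
  have bE : b = e - d by rewrite eE addrAC subrr add0r.
  have [|Db _] := EB b; last by rewrite eE; apply: is_idealD.
  by split=> //; rewrite bE; apply: is_idealB => //; apply: DE.
exists k1.+1, k2; rewrite addSn ltnS; split=> //; first exact: chainS ch1 idEB _.
exact: chain_top sS.
Qed.

Lemma lenP A B : is_ideal B -> A `<=` B -> finite_length A B ->
  is_maximum (chain A B) (len A B).
Proof.
move=> idB AB [b bP].
have exc : exists l, `[< chain A B l >] by exists 0%N; apply/asboolP; apply: chain0.
have bc l : `[< chain A B l >] -> (l <= b)%N by move=> /asboolP /bP.
have [l /asboolP chl lmax] := ex_maxnP exc bc.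
have ml : is_maximum (chain A B) l by split=> // k chk; apply: lmax; apply/asboolP.
exact: (xgetI 0%N ml).
Qed.

Lemma finite_length_sub A B C D : A `<=` B -> is_ideal D -> C `<=` D ->
  finite_length A D -> finite_length B C.
Proof.
move=> AB idD CD [b bP]; exists b => l ch; apply: bP.
by apply: chain_bottom AB; apply: chain_top CD.
Qed.

Lemma finite_length_cat A B C : is_ideal B -> is_ideal C -> A `<=` B -> B `<=` C ->
  finite_length A B -> finite_length B C -> finite_length A C.
Proof.
move=> idB idC AB BC [b1 P1] [b2 P2]; exists (b1 + b2)%N => l.
move=> /(chain_split idB AB)[k1 [k2 [lk ch1 ch2]]].
apply: leq_trans lk (leq_add (P1 _ _) (P2 _ _)); first by apply: chain_top ch1 _ _ => // z [].
by apply: chain_top ch2 _ _ => //; apply: idsum_min.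
Qed.

Lemma len_add A B C : is_ideal B -> is_ideal C -> A `<=` B -> B `<=` C ->
  finite_length A C -> len A C = (len A B + len B C)%N.
Proof.
move=> idB idC AB BC fAC.
have [chAC maxAC] := lenP idC (subset_trans AB BC) fAC.
have [chAB maxAB] := lenP idB AB (finite_length_sub (@subset_refl _ A) idC BC fAC).
have [chBC maxBC] := lenP idC BC (finite_length_sub AB idC (@subset_refl _ C) fAC).
apply/eqP; rewrite eqn_leq maxAC ?andbT; last exact: chain_cat chAB chBC.
have [k1 [k2 [lk ch1 ch2]]] := chain_split idB AB chAC.
apply: leq_trans lk (leq_add (maxAB _ _) (maxBC _ _)); first by apply: chain_top ch1 _ _ => // z [].
by apply: chain_top ch2 _ _ => //; apply: idsum_min.
Qed.

(** Lengths of intervals are compared through strictly increasing maps, since the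
   lengths are maxima over chains. *)
Lemma chain_map (f : set R -> set R) A B A' B' l :
  is_ideal B -> is_ideal B' ->
  (forall J, is_ideal J -> A `<=` J -> J `<=` B ->
    [/\ is_ideal (f J), A' `<=` f J & f J `<=` B']) ->
  (forall J K, is_ideal J -> is_ideal K -> A `<=` J -> K `<=` B -> J `<` K ->
    f J `<` f K) ->
  chain A B l -> chain A' B' l.
Proof.
move=> idB idB' fid fstrict ch.
suff H C k : chain A C k -> C `<=` B -> chain A' (f C) k.
  have [_ _ fB] := fid B idB (chain_sub ch) (@subset_refl _ B).
  by apply: chain_top (H _ _ ch (@subset_refl _ B)) _ fB.
elim=> [D idD AD DB|D E j chD IH idE DE EB].
  by have [? ? _] := fid D idD AD DB; apply: chain0.
have idD := chain_ideal chD; have AD := chain_sub chD.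
have [DE' _] := DE.
have [idfE _ _] := fid E idE (subset_trans AD DE') EB.
by apply: chainS (IH (subset_trans DE' EB)) idfE _; apply: fstrict.
Qed.

Lemma len_eq A B A' B' : (forall l, chain A B l <-> chain A' B' l) ->
  len A B = len A' B'.
Proof.
move=> ch; congr xget; apply/predeqP => l; rewrite /is_maximum.
by split=> -[chl maxl]; split; try (by apply/ch); move=> k /ch; apply: maxl.
Qed.

Lemma len_scale x A B : nonzerodivisor x -> is_ideal A -> is_ideal B ->
  len (scale x A) (scale x B) = len A B.
Proof.
move=> nx idA idB; apply: len_eq => l; split.
  apply: (chain_map (f := fun J => colon J x)) => //; first exact: ideal_scale.
    move=> J idJ AJ JB; split; first exact: ideal_colon.
      by move=> a Aa; apply: AJ; exists a.
    by move=> z /JB[b Bb /(nonzerodivisor_inj nx) <-].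
  move=> J K idJ idK AJ KB [JK nKJ]; split; first by move=> z; apply: JK.
  move=> cKJ; apply: nKJ => k Kk; have [b Bb bE] := KB _ Kk.
  by rewrite -bE; apply: cKJ; rewrite /colon /= bE.
apply: (chain_map (f := scale x)) => //; first exact: ideal_scale.
  move=> J idJ AJ JB; split; first exact: ideal_scale.
    by move=> _ [a Aa <-]; exists a => //; apply: AJ.
  by move=> _ [a Aa <-]; exists a => //; apply: JB.
move=> J K idJ idK AJ KB [JK nKJ]; split; first by move=> _ [a Aa <-]; exists a => //; apply: JK.
move=> sKJ; apply: nKJ => k Kk; have [|j Jj] := sKJ (x * k); first by exists k.
by move=> /(nonzerodivisor_inj nx) <-.
Qed.

Lemma len_second_iso A B : is_ideal A -> is_ideal B ->
  len B (idsum A B) = len (A `&` B) A.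
Proof.
move=> idA idB; apply: len_eq => l; split.
  apply: (chain_map (f := fun J => J `&` A)) => //; first exact: ideal_idsum.
    move=> J idJ AJ JB; split; first exact: ideal_setI.
      by move=> a [Aa Ba]; split=> //; apply: AJ.
    by move=> z [].
  move=> J K idJ idK BJ KAB [JK nKJ]; split; first by move=> z [? ?]; split=> //; apply: JK.
  move=> KAJ; apply: nKJ => k Kk; have [a [b [Aa Bb kE]]] := KAB k Kk.
  have Jb := BJ _ Bb.
  have [|Ja _] := KAJ a; last by rewrite kE; apply: is_idealD.
  split=> //; have -> : a = k - b by rewrite kE addrK.
  by apply: is_idealB => //; apply: JK.
apply: (chain_map (f := fun J => idsum J B)) => //; first exact: ideal_idsum.
  move=> J idJ AJ JB; split; first exact: ideal_idsum.
    exact: sub_idsumr.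
  by move=> _ [a [b [Ja Bb ->]]]; exists a, b; split=> //; apply: JB.
move=> J K idJ idK AJ KB [JK nKJ]; split.
  by move=> _ [a [b [Ja Bb ->]]]; exists a, b; split=> //; apply: JK.
move=> KJ; apply: nKJ => k Kk; have [|j [b [Jj Bb kE]]] := KJ k; first exact: sub_idsuml.
rewrite kE; apply: is_idealD => //; apply: AJ; split=> //.
have -> : b = k - j by rewrite kE addrAC subrr add0r.
by apply: KB; apply: is_idealB => //; apply: JK.
Qed.

Lemma length_quotE A : length_quot A = len A setT.
Proof.
suff chE : [set l | exists J : nat -> set R,
    [/\ forall i, (i <= l)%N -> is_ideal (J i), A `<=` J 0%N
      & forall i, (i < l)%N -> J i `<` J i.+1]] = chain A setT.
  by rewrite /length_quot chE.
apply/predeqP => l; split.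
  move=> [J [idJ AJ JS]].
  suff /(_ l (leqnn l)) ch k : (k <= l)%N -> chain A (J k) k by apply: chain_top ch _ _.
  elim: k => [|k IH] kl; first by apply: chain0 => //; apply: idJ.
  apply: chainS (IH (ltnW kl)) _ _; [exact: idJ | exact: JS].
move: setT => B; suff H : chain A B l -> exists J : nat -> set R,
    [/\ forall i, (i <= l)%N -> is_ideal (J i), A `<=` J 0%N,
        forall i, (i < l)%N -> J i `<` J i.+1 & J l = B].
  by move=> /H[J [? ? ? _]]; exists J.
elim=> [{}B idB AB|{}B C {}l chB [J [idJ AJ JS JB]] idC BC]; first by exists (fun=> B).
exists (fun i => if (i <= l)%N then J i else C); split=> //.
- by move=> i _; case: ifP => // /idJ.
- move=> i il /=; have [il'|li] := ltnP i l.
    by rewrite (ltnW il'); apply: JS.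
  have -> : i = l by apply/eqP; rewrite eqn_leq li andbT -ltnS.
  by rewrite leqnn JB.
- by rewrite ltnn.
Qed.

Variable m : set R.
Hypothesis noethR : noetherian R.
Hypothesis locR : local_ring m.

Definition colen A := len A setT.

Lemma cofiniteS A B : cofinite m A -> A `<=` B -> cofinite m B.
Proof. by move=> cA AB f /cA[k Af]; exists k; apply: AB. Qed.

(** Noetherian induction: a maximal counterexample B has a socle element w modulo
   B, and the interval from B to B + (w) is simple. *)
Lemma cofinite_finite_length A : is_ideal A -> cofinite m A -> finite_length A setT.
Proof.
move=> idA cA; apply: contrapT => nfin.
have [||B [[idB nB] AB maxB]] := @noetherian_max _ noethR
  [set B | is_ideal B /\ ~ finite_length B setT] A.
- by move=> B [].
- by [].
have nB1 : ~ B 1.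
  move=> /(is_ideal_1 idB) BT; apply: nB; exists 0%N => l.
  by rewrite BT; case: l => // l /chain_proper[].
have [|w [nw mw]] := @socle_element _ _ noethR locR B 1 idB nB1.
  by move=> f mf; have [k Af] := cA f mf; exists k; rewrite mulr1; apply: AB.
have idC := ideal_idsum idB (ideal_principal w).
set C := idsum _ _ in idC.
have BC : B `<=` C by apply: sub_idsuml.
have Cw : C w by apply: sub_idsumr.
have fC : finite_length C setT.
  by apply: contrapT => nC; apply: nw; apply: (maxB C).
apply: nB; apply: (finite_length_cat (B := C)) => //.
have simple D : is_ideal D -> B `<=` D -> D `<=` C -> ~ (D `<=` B) -> C `<=` D.
  move=> idD BD DC nDB.
  have [d [Dd nBd]] : exists d, D d /\ ~ B d.
    apply: contrapT => nd; apply: nDB => d Dd; apply: contrapT => nBd.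
    by apply: nd; exists d.
  have [b [_ [Bb [r _ <-] dE]]] := DC _ Dd.
  have [mr|/(local_unit noethR locR)[u ur]] := pselect (m r).
    by case: nBd; rewrite dE; apply: is_idealD => //; rewrite mulrC; apply: mw.
  apply: idsum_min => //; apply: principal_min => //.
  have -> : w = u * (d - b) by rewrite dE addrAC subrr add0r mulrCA ur mulr1.
  by apply: is_ideal_mull => //; apply: is_idealB => //; apply: BD.
exists 1%N => l; case: l => [//|[//|l]] ch.
have [D chD [DC nCD]] := chainSE ch.
by case: nCD; apply: simple => //;
  [apply: chain_ideal chD | apply: chain_sub chD | apply: chain_proper chD].
Qed.

Lemma colen_add A B : is_ideal A -> is_ideal B -> cofinite m A -> A `<=` B ->
  colen A = (len A B + colen B)%N.
Proof. by move=> idA idB cA AB; apply: len_add => //; apply: cofinite_finite_length. Qed.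

Lemma colen_eq A B : is_ideal A -> is_ideal B -> cofinite m A -> A `<=` B ->
  colen A = colen B -> A = B.
Proof.
move=> idA idB cA AB lAB; apply/seteqP; split=> //; apply: contrapT => nBA.
have fAB : finite_length A B.
  apply: (finite_length_sub (@subset_refl _ A) (ideal_setT R)) => //.
  exact: cofinite_finite_length.
have [_ maxAB] := lenP idB AB fAB.
have : (1 <= len A B)%N by apply: maxAB; apply: chainS (chain0 idA (@subset_refl _ A)) idB _.
by have := colen_add idA idB cA AB; rewrite lAB; lia.
Qed.

Lemma colen_setT : colen setT = 0%N.
Proof.
have fT : finite_length [set: R] setT.
  by apply: cofinite_finite_length => // f _; exists 0%N.
have [ch _] := lenP (ideal_setT R) (@subset_refl R setT) fT.
by rewrite /colen; case: (len _ _) ch => // k /chain_proper[].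
Qed.

Lemma colen_gt0 A : is_ideal A -> cofinite m A -> ~ A 1 -> (0 < colen A)%N.
Proof.
move=> idA cA nA1; rewrite lt0n; apply/eqP => l0; apply: nA1.
have -> // : A = setT; apply: colen_eq => //; by rewrite colen_setT.
Qed.

Lemma cofiniteI A B : is_ideal A -> is_ideal B -> cofinite m A -> cofinite m B ->
  cofinite m (A `&` B).
Proof.
move=> idA idB cA cB f mf; have [k Ak] := cA f mf; have [l Bl] := cB f mf.
by exists (k + l)%N; rewrite exprD; split; [apply: is_ideal_mulr | apply: is_ideal_mull].
Qed.

Lemma cofinite_scale_sum x y A B : is_ideal A -> is_ideal B -> cofinite m A -> cofinite m B ->
  cofinite m (idsum (principal x) (principal y)) ->
  cofinite m (idsum (scale x A) (scale y B)).
Proof.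
move=> idA idB cA cB cxy f mf; have [k [_ [_ [[a _ <-] [b _ <-] fk]]]] := cxy f mf.
have [l [Al Bl]] := cofiniteI idA idB cA cB mf.
exists (k + l)%N; exists (x * (a * f ^+ l)), (y * (b * f ^+ l)); split.
- by exists (a * f ^+ l) => //; apply: is_ideal_mull.
- by exists (b * f ^+ l) => //; apply: is_ideal_mull.
- by rewrite exprD fk; ring.
Qed.

(** The lengths in the exact sequence
   0 -> R/((A : y) cap (B : x)) -> R/A + R/B -> R/(x A + y B) -> R/(x, y) -> 0
   given by the Koszul complex on x and y. They are compared by moving between
   intervals of ideals with the second isomorphism theorem and with multiplication
   by x and by y. *)
Lemma colen_koszul x y A B : regular_pair x y ->
  cofinite m (idsum (principal x) (principal y)) ->
  is_ideal A -> is_ideal B -> cofinite m A -> cofinite m B ->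
  (colen (idsum (scale x A) (scale y B)) + colen (colon A y `&` colon B x) =
   colen (idsum (principal x) (principal y)) + colen A + colen B)%N.
Proof.
move=> [nx ny xy] cxy idA idB cA cB.
set E := idsum (scale x A) (scale y B); set E2 := idsum (principal x) (principal y).
pose X := scale x A; have idX : is_ideal X by apply: ideal_scale.
pose E1 := idsum (principal y) E.
have idE : is_ideal E by apply: ideal_idsum; apply: ideal_scale.
have idE1 : is_ideal E1 by apply: ideal_idsum.
have idE2 : is_ideal E2 by apply: ideal_idsum.
have cE : cofinite m E by apply: cofinite_scale_sum.
have XE : X `<=` E by apply: sub_idsuml; apply: ideal_scale.
have EE1 : E `<=` E1 by apply: sub_idsumr.
have idAy : is_ideal (colon A y) by apply: ideal_colon.
have idBx : is_ideal (colon B x) by apply: ideal_colon.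
have scT z C : scale z C `<=` principal z by move=> _ [c _ <-]; exists c.
have E12 : E1 `<=` E2.
  apply: idsum_min => //; first exact: sub_idsumr.
  apply: idsum_min => //; first by apply: subset_trans (scT _ _) _; apply: sub_idsuml.
  by apply: subset_trans (scT _ _) _; apply: sub_idsumr.
have cE1 : cofinite m E1 by apply: cofiniteS EE1.
have idAsy := ideal_idsum (ideal_principal y) idA.
have idAs : is_ideal (scale x (colon A y)) by apply: ideal_scale.
have idBs := ideal_idsum idAs idB.
have cAsy : cofinite m (idsum (principal y) A) by apply: cofiniteS cA _; apply: sub_idsumr.
have cBs : cofinite m (idsum (scale x (colon A y)) B).
  by apply: cofiniteS cB _; apply: sub_idsumr.
have A_Ay : A `<=` colon A y by move=> a Aa; apply: is_ideal_mull.
have B_Bx : B `<=` colon B x by move=> b Bb; apply: is_ideal_mull.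
(* By the second isomorphism theorem the interval from E to E1 is y times an
   interval ending at R, and below the one from E1 to E2 is x times such one. *)
have -> : colen E = (colen (idsum (scale x (colon A y)) B) + colen E1)%N.
  rewrite (colen_add idE idE1 cE EE1) len_second_iso //.
  congr (_ + _)%N; rewrite /colen -(len_scale ny idBs (ideal_setT R)).
  congr len; apply/seteqP; split.
    move=> _ [[t _ <-] [_ [_ [[a Aa <-] [b Bb <-] tE]]]].
    have [|r aE] := xy a (t - b); first by rewrite mulrBr tE addrK.
    exists t => //; exists (x * r), b; split=> //.
      by exists r => //; rewrite /colon /= -aE.
    by apply: (nonzerodivisor_inj ny); rewrite tE aE; ring.
  move=> _ [_ [_ [b [[r Ar <-] Bb ->]]] <-]; split; first exact: principalM.
  exists (x * (y * r)), (y * b); split; first by exists (y * r).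
    by exists b.
  ring.
have E2E : E2 = idsum (principal x) E1.
  apply/seteqP; split; apply: idsum_min; try exact: ideal_idsum.
  - exact: sub_idsuml.
  - by move=> z yz; apply: sub_idsumr => //; apply: sub_idsuml.
  - exact: sub_idsuml.
  - by [].
have -> : colen E1 = (colen (idsum (principal y) A) + colen E2)%N.
  rewrite (colen_add idE1 idE2 cE1 E12) {1}E2E len_second_iso //.
  congr (_ + _)%N; rewrite /colen -(len_scale nx idAsy (ideal_setT R)).
  congr len; apply/seteqP; split.
    move=> _ [[t _ <-] [_ [_ [[r _ <-] [_ [_ [[a Aa <-] [b Bb <-] ->]] tE]]]]].
    have [|q tq] := xy (t - a) (r + b); first by rewrite mulrBr tE; ring.
    exists t => //; exists (y * q), a; split=> //; first by exists q.
    by rewrite -tq subrK.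
  move=> _ [_ [_ [a [[r _ <-] Aa ->]]] <-]; split; first exact: principalM.
  exists (y * (x * r)), (x * a); split; first by exists (x * r).
    by apply: XE; exists a.
  ring.
have lA : colen A = (colen (colon A y) + colen (idsum (principal y) A))%N.
  rewrite (colen_add idA idAsy cA) ?len_second_iso //; last exact: sub_idsumr.
  congr (_ + _)%N; rewrite /colen -(len_scale ny idAy (ideal_setT R)).
  congr len; apply/seteqP; split; first by move=> _ [[t _ <-] At]; exists t.
  by move=> _ [t At <-]; split=> //; exists t.
have lB : (colen B + colen (colon A y) = colen (colon A y `&` colon B x) +
    colen (idsum (scale x (colon A y)) B))%N.
  have cI : cofinite m (colon A y `&` colon B x).
    by apply: cofiniteI => //; [apply: cofiniteS cA _ | apply: cofiniteS cB _].
  rewrite (colen_add idB idBs cB) ?len_second_iso //; last exact: sub_idsumr.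
  rewrite (colen_add (ideal_setI idAy idBx) idAy cI); last by move=> z [].
  rewrite -(len_scale nx (ideal_setI idAy idBx) idAy).
  have -> : scale x (colon A y) `&` B = scale x (colon A y `&` colon B x).
    apply/seteqP; split; first by move=> _ [[t At <-] Bt]; exists t.
    by move=> _ [t [At Bt] <-]; split=> //; exists t.
  lia.
lia.
Qed.

End Length.

(** * Joint reductions *)

(** The largest value attained in large degrees is attained in all larger degrees. *)
Lemma bounded_nondecreasing_eventually_const s (d : 'X_{1..s} -> nat) b :
  (forall n, d n <= b)%N -> eventually (fun n => forall j, (d n <= d (n + U_(j))%MM)%N) ->
  eventually (fun n => forall j, d (n + U_(j))%MM = d n).
Proof.
move=> db [M dM]; pose N := [multinom M | i < s].
have large n : (N <= n)%MM -> forall i, (M <= n i)%N by move=> /mnm_lepP Nn i; move: (Nn i); rewrite mnmE.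
have [|k kb|v /asboolP[n0 [Nn0 <-]] vmax] :=
    @ex_maxnP (fun v => `[< exists n, (N <= n)%MM /\ d n = v >]) b.
- by exists (d N); apply/asboolP; exists N; split=> //; apply: lepm_refl.
- by move: kb => /asboolP[n [_ <-]].
have dn0 n : (n0 <= n)%MM -> d n = d n0 /\ (N <= n)%MM.
  move: n; apply: multinom_ind => // n i n0n [dn Nn].
  have Nn1 : (N <= n + U_(i))%MM by apply: lepm_trans Nn (lem_addr _ _).
  split=> //; apply/eqP; rewrite eqn_leq -{2}dn dM ?andbT; last exact: large.
  by apply: vmax; apply/asboolP; exists (n + U_(i))%MM.
exists (\max_i n0 i)%N => n nM j.
have n0n : (n0 <= n)%MM by apply/mnm_lepP => i; apply: leq_trans (leq_bigmax i) (nM i).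
by rewrite (dn0 n n0n).1; apply: (dn0 _ _).1; apply: lepm_trans n0n (lem_addr _ _).
Qed.

Section JointSystem.
Variables (R : comNzRingType) (m : set R).
Hypothesis noethR : noetherian R.
Hypothesis locR : local_ring m.
Hypothesis dim2 : krull_dim R 2.
Hypothesis depth2 : depth m 2.
Variables (s : nat) (I : 'I_s -> set R).
Hypothesis idI : forall i, is_ideal (I i).
Hypothesis Im : forall i, I i `<=` m.
Variable c : nat -> R.
Hypothesis c_unit : forall k l, k != l -> exists u, u * (c k - c l) = 1.
Variable F : 'X_{1..s} -> set R.
Hypothesis grF : graded I F.
Hypothesis F0 : F 0%MM = setT.
Hypothesis antiF : forall n p, (n <= p)%MM -> F p `<=` F n.
Hypothesis cofF : forall n, cofinite m (F n).
Hypothesis stepF : eventually (fun n => forall i, F (n + U_(i))%MM `<=` idmul (I i) (F n)).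
Implicit Types (n p q : 'X_{1..s}) (i j : 'I_s) (x y z : R).

Let idF n : is_ideal (F n) := graded_ideal grF n.
Let E : 'X_{1..s} := [multinom 1%N | i < s].

Let addE n i : (n + E + U_(i) = n + U_(i) + E)%MM.
Proof. mnm. Qed.

(** The filtration becomes the Rees module of an ideal after a shift by a constant
   degree. *)
Lemma shifted_generated : exists N : nat,
  graded I (fun n => F (n + [multinom N | i < s])%MM) /\
  generated_at0 I (fun n => F (n + [multinom N | i < s])%MM).
Proof.
have [N NP] := stepF; exists N; set D := [multinom N | i < s].
have shift n i : (n + U_(i) + D = n + D + U_(i))%MM by mnm.
split; first split=> [n|n i a z Ia Fz]; first exact: idF.
  by rewrite shift; apply: (gradedM grF).
by move=> n i; rewrite shift; apply: NP => l; rewrite mnmDE mnmE leq_addl.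
Qed.

(** Take x superficial for the associated graded module with components
   F n / F (n + E), and regular on R. If x z lies in F (n + [U_(i)]), the
   Artin-Rees argument puts z in F (n - E *+ k) for a constant k, and then z climbs
   back to F n along the diagonal, one step at a time. *)
Lemma superficial_regular_element i : exists x, [/\ I i x, nonzerodivisor x
  & eventually (fun n => forall z, F (n + U_(i))%MM (x * z) -> F n z)].
Proof.
have [u [v [mu mv uv]]] := depth2_regular_pair noethR locR depth2.
have [N] := shifted_generated; set D := [multinom N | i < s].
pose G n := F (n + D)%MM; rewrite -/G => -[grG genG]; have idG := graded_ideal grG.
pose Z (b : bool) n : set R := if b then G (n + E)%MM else [set 0].
have [[]||x Ix xP] := superficial_element noethR idI c_unit grG genG i (Z := Z).
- split=> [n|n j a z Ia Gz]; first exact: idG.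
  rewrite /Z; have -> : (n + U_(j) + E = n + E + U_(j))%MM by mnm.
  exact: (gradedM grG).
- by split=> [n|n j a z Ia ->] //; rewrite /Z /= mulr0.
- case=> n z; last by move=> ->; apply: is_ideal0.
  by apply: antiF; apply/mnm_lepP => l; rewrite !mnmDE; lia.
have [M0 xreg] := xP false; have [M2 xgr] := xP true.
have nx : nonzerodivisor x.
  move=> z xz; apply: (cofinite_regular mu uv (cofF ([multinom M0 | i < s] + D)%MM)) => a Ga.
  apply: (xreg [multinom M0 | i < s]) => [l||]; first by rewrite mnmE.
    exact: is_ideal_mulr.
  by rewrite /Z /= mulrCA xz mulr0.
exists x; split=> //.
pose L n : set R := G n `&` principal x.
have grL : graded I L.
  split=> [n|n j a z Ia [Gz [t _ zE]]]; first by apply: ideal_setI; first exact: idG.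
  split; first exact: (gradedM grG).
  by exists (a * t) => //; rewrite -zE mulrCA.
have [M1 LM] := graded_fg noethR idI grG genG grL (fun n z => @proj1 _ _).
pose B := [multinom M1 | i < s].
(* Artin-Rees: G n meets (x) in x Z n with Z n = (G n : x), and finite
   generation makes Z grow no faster than the filtration, up to the shift B. *)
have AR p : forall z, G (B + p)%MM (x * z) -> F p z.
  have : (0 <= p)%MM by apply/mnm_lepP => l; rewrite mnm0E.
  move: p; apply: multinom_ind => [z _|p j _ IH z Gxz]; first by rewrite F0.
  have : idmul (I j) (L (B + p)%MM) `<=` scale x (F (p + U_(j))%MM).
    apply: idmul_min => [|a w Ia [Gw [t _ wE]]]; first exact: ideal_scale.
    exists (a * t); first by apply: (gradedM grF) => //; apply: IH; rewrite wE.
    by rewrite -wE; ring.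
  move=> /(_ (x * z))[|t Ft /(nonzerodivisor_inj nx) <- //].
  apply: LM; first by move=> l; rewrite mnmDE mnmE leq_addr.
  split; last exact: principalM.
  by have <- : (B + (p + U_(j)) = B + p + U_(j))%MM by mnm.
have climb k q z : (forall l, (M2 <= q l)%N) -> G q z ->
    G (q + E *+ k + U_(i))%MM (x * z) -> G (q + E *+ k)%MM z.
  move=> qM Gz; elim: k => [|k IH]; first by rewrite mulm0n addm0.
  have qS : (q + E *+ k.+1 = q + E *+ k + E)%MM by mnm.
  rewrite qS addE => Gxz; apply: (xgr (q + E *+ k)%MM) => //.
    by move=> l; rewrite mnmDE; have := qM l; lia.
  by apply: IH; move: Gxz; apply: antiF; apply/mnm_lepP => l; rewrite !mnmDE; lia.
(* N is the shift from F to G, the Artin-Rees argument loses k = N + M1 diagonal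
   steps, and the climb needs degrees above M2. *)
exists (N + (N + M1) + M2)%N => n nM z Fxz.
pose k := (N + M1)%N; pose q := (n - D - E *+ k)%MM.
have nE : n = (q + E *+ k + D)%MM.
  by apply/mnmP => l; rewrite !(mnmDE, mnmBE, mulmnE, mnmE); have := nM l; lia.
rewrite nE; apply: climb.
- by move=> l; rewrite !(mnmDE, mnmBE, mulmnE, mnmE); have := nM l; lia.
- have Fz : F (n + U_(i) - D - B)%MM z.
    apply: AR; rewrite /G.
    suff -> : (B + (n + U_(i) - D - B) + D = n + U_(i))%MM by [].
    by apply/mnmP => l; rewrite !(mnmDE, mnmBE, mnmE); have := nM l; lia.
  move: Fz; apply: antiF; apply/mnm_lepP => l.
  by rewrite !(mnmDE, mnmBE, mulmnE, mnmE); have := nM l; lia.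
- rewrite /G; suff -> : (q + E *+ k + U_(i) + D = n + U_(i))%MM by [].
  rewrite {1}nE; mnm.
Qed.

(** The same construction modulo each of the x i, in the one-dimensional rings
   R/(x i). Depth two makes y regular modulo x i. *)
Lemma superficial_mod i0 (x : 'I_s -> R) : (forall i, I i (x i)) ->
  (forall i, nonzerodivisor (x i)) ->
  exists y, [/\ I i0 y, forall i, regular_pair (x i) y
  & eventually (fun n => forall i z, F n z ->
      idsum (F (n + U_(i0) + E)%MM) (principal (x i)) (y * z) ->
      idsum (F (n + E)%MM) (principal (x i)) z)].
Proof.
move=> Ix nx; have [u [v [mu mv uv]]] := depth2_regular_pair noethR locR depth2.
have [N] := shifted_generated; set D := [multinom N | i < s].
pose G n := F (n + D)%MM; rewrite -/G => -[grG genG]; have idG := graded_ideal grG.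
pose Z (t : 'I_s * bool) n : set R := G n `&`
  (if t.2 then idsum (G (n + E)%MM) (principal (x t.1)) else principal (x t.1)).
have [[i b]||y Iy yP] := superficial_element noethR idI c_unit grG genG i0 (Z := Z).
- split=> [n|n j a z Ia [Gz Zz]].
    by rewrite /Z; case: (_.2); apply: ideal_setI => //; apply: ideal_idsum.
  split; first exact: (gradedM grG).
  move: Zz; case: b => /=; last exact: is_ideal_mull.
  move=> [g [r [Gg xr ->]]]; exists (a * g), (a * r); split; last by rewrite mulrDr.
    have -> : (n + U_(j) + E = n + E + U_(j))%MM by mnm.
    exact: (gradedM grG).
  exact: is_ideal_mull.
- by move=> t n z [].
exists y; split=> //.
  move=> i; apply: (regular_pairI noethR locR) => //; first exact: Im.
  move=> z yz; have [M yreg] := yP (i, false).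
  apply: (cofinite_regular_mod noethR locR mu mv uv (cofF ([multinom M | i < s] + D)%MM) (nx i)) => a Ga.
  suff : Z (i, false) [multinom M | i < s] (a * z) by case.
  apply: yreg => [l||]; first by rewrite mnmE.
    exact: is_ideal_mulr.
  rewrite mulrCA; split; last exact: is_ideal_mull.
  by rewrite mulrCA; apply: (gradedM grG) => //; apply: is_ideal_mulr.
have [M yM] := eventually_all yP.
exists (N + M)%N => n nM i z Fz.
have nE : n = (n - D + D)%MM.
  by apply/mnmP => l; rewrite !(mnmDE, mnmBE, mnmE); have := nM l; lia.
have GE p : (n - D + p + D = n + p)%MM.
  by apply/mnmP => l; rewrite !(mnmDE, mnmBE, mnmE); have := nM l; lia.
move=> Fyz; suff [_] : Z (i, true) (n - D)%MM z by rewrite /= /G GE.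
apply: (yM (n - D)%MM).
- by move=> l; rewrite mnmBE mnmE; have := nM l; lia.
- by rewrite /G -nE.
- split; first by apply: (gradedM grG) => //; rewrite /G -nE.
  rewrite /= /G; suff -> : (n - D + U_(i0) + E + D = n + U_(i0) + E)%MM by [].
  by rewrite -[(_ + U_(i0) + E)%MM]addmA GE addmA.
Qed.

Lemma prodF (y : 'I_s -> R) n z : (forall i, I i (y i)) -> F n z ->
  F (n + E)%MM (\prod_i y i * z).
Proof.
move=> Iy Fz.
have -> : (n + E = n + \sum_(i <- index_enum 'I_s) U_(i))%MM.
  apply/mnmP => l; rewrite !mnmDE mnm_sumE mnmE (bigD1 l) //= mnm1E eqxx big1 ?addn0 //.
  by move=> j /negbTE jl; rewrite mnm1E jl.
elim: (index_enum 'I_s) => [|i r IH]; first by rewrite !big_nil addm0 mul1r.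
rewrite !big_cons -mulrA; have -> : forall p, (n + (U_(i) + p) = n + p + U_(i))%MM by move=> p; mnm.
exact: (gradedM grF).
Qed.

(** In the one-dimensional ring R/(x) the lengths d n of V n / V (n + E), where V n
   is F n + (x), are bounded by the length of R/(x, w) with w the product of the
   y j. Multiplication by y j embeds V n / V (n + E) in the corresponding quotient
   for n + [U_(j)], so the d n do not decrease, hence are eventually constant and
   these embeddings are isomorphisms. Nakayama's lemma gives the inclusion. *)
Lemma generated_mod i (x : R) (y : 'I_s -> R) : I i x ->
  (forall j, I j (y j)) -> (forall j, regular_pair x (y j)) ->
  (forall j, eventually (fun n => forall z, F n z ->
      idsum (F (n + U_(j) + E)%MM) (principal x) (y j * z) ->
      idsum (F (n + E)%MM) (principal x) z)) ->
  eventually (fun n => forall j,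
    F (n + U_(j))%MM `<=` idsum (scale (y j) (F n)) (principal x)).
Proof.
move=> Ix Iy xy /eventually_all ysup.
pose V n := idsum (F n) (principal x).
have idV n : is_ideal (V n) by apply: ideal_idsum.
have FV n : F n `<=` V n by apply: sub_idsuml.
have xV n : principal x `<=` V n by apply: sub_idsumr.
have antiV n p : (n <= p)%MM -> V p `<=` V n.
  by move=> np; apply: idsum_min => //; apply: subset_trans (FV n); apply: antiF.
have cV n : cofinite m (V n) by apply: cofiniteS (FV n).
have VE n : V (n + E)%MM `<=` V n by apply: antiV; exact: lem_addr.
pose d n := len (V (n + E)%MM) (V n).
have colenV n : colen (V (n + E)%MM) = (d n + colen (V n))%N.
  exact: (colen_add noethR locR).
pose w := \prod_j y j.
have mw : m w by rewrite /w (bigD1 i) //=; apply: is_ideal_mulr; [exact: ideal_max | exact: Im].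
have mx : m x by apply: Im Ix.
have xw : regular_pair x w.
  rewrite /w; elim/big_ind: _ => //; last exact: regular_pairM.
  by apply: regular_pair1; case: (xy i).
have cxw := regular_pair_cofinite noethR locR dim2 mx mw xw.
have dbound n : (d n <= colen (idsum (principal x) (principal w)))%N.
  have := colen_koszul noethR locR xw cxw (ideal_setT R) (idV n)
    (fun f _ => ex_intro (fun k => setT (f ^+ k)) 0%N Logic.I) (cV n).
  have -> : colon setT w `&` colon (V n) x = setT.
    apply/seteqP; split=> // z _; split=> //.
    by apply: xV; apply: principalM.
  rewrite (colen_setT noethR locR) addn0 addn0; set W := idsum _ _ => WE.
  have idW : is_ideal W by apply: ideal_idsum; apply: ideal_scale.
  have WV : W `<=` V (n + E)%MM.
    apply: idsum_min => // _ [_ [f [_ [Ff [r _ <-] ->]]] <-].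
    rewrite mulrDr; apply: is_idealD => //; first by apply: FV; apply: prodF.
    by apply: is_ideal_mull => //; apply: xV; apply: principalM.
  have cW : cofinite m W.
    apply: cofinite_scale_sum => //; by move=> f _; exists 0%N.
  have := colen_add noethR locR idW (idV _) cW WV; rewrite colenV; lia.
have step n j : (forall z, F n z -> idsum (F (n + U_(j) + E)%MM) (principal x) (y j * z) ->
      idsum (F (n + E)%MM) (principal x) z) ->
    (d n <= d (n + U_(j))%MM)%N /\ (d (n + U_(j))%MM = d n ->
    V (n + U_(j))%MM = idsum (scale (y j) (V n)) (V (n + U_(j) + E)%MM)).
  move=> supj; set S := idsum _ _; have idyV : is_ideal (scale (y j) (V n)) by apply: ideal_scale.
  have idS : is_ideal S by apply: ideal_idsum.
  have yV p : scale (y j) (V p) `<=` V (p + U_(j))%MM.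
    move=> _ [_ [f [_ [Ff [r _ <-] ->]]] <-].
    rewrite mulrDr; apply: is_idealD => //; first by apply: FV; apply: (gradedM grF).
    by apply: is_ideal_mull => //; apply: xV; apply: principalM.
  have SV : S `<=` V (n + U_(j))%MM by apply: idsum_min.
  have VS : V (n + U_(j) + E)%MM `<=` S by apply: sub_idsumr.
  have [nx ny _] := xy j.
  have lenS : len (V (n + U_(j) + E)%MM) S = d n.
    rewrite /S len_second_iso // /d -(len_scale ny (idV _) (idV n)); congr len.
    apply/seteqP; split; last first.
      move=> z yz; split; last by have := yV _ _ yz; rewrite addE.
      by case: yz => t /VE Vt <-; exists t.
    move=> _ [[_ [f [_ [Ff [r _ <-] ->]]] <-] Vyz]; exists (f + x * r) => //.
    apply: is_idealD => //; last by apply: xV; apply: principalM.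
    apply: supj => //; rewrite -[y j * f](addrK (y j * (x * r))) -mulrDr.
    apply: (is_idealB (idV _)) => //.
    by apply: is_ideal_mull => //; apply: xV; apply: principalM.
  have cS : cofinite m S by apply: cofiniteS VS.
  have := colen_add noethR locR (idV _) idS (cV _) VS.
  have lSV := colen_add noethR locR idS (idV _) cS SV; rewrite colenV lenS lSV => dE.
  split; first lia.
  move=> dd; apply/esym/(colen_eq noethR locR) => //; lia.
have dconst := bounded_nondecreasing_eventually_const dbound.
have {dconst}/dconst dconst : eventually (fun n => forall j, (d n <= d (n + U_(j))%MM)%N).
  by apply: eventuallyW ysup => n supn j; apply: (step n j (supn j)).1.
have stepU := eventually_all (fun j => eventually_shift U_(j)%MM stepF).
apply: eventuallyW (eventually_and (eventually_and ysup dconst) stepU).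
move=> n [[supn dn] stepn] j; have [_ /(_ (dn j)) VSE] := step n j (supn j).
suff sub : V (n + U_(j))%MM `<=` idsum (scale (y j) (F n)) (principal x).
  exact: subset_trans (FV _) sub.
have idW : is_ideal (idsum (scale (y j) (F n)) (principal x)).
  by apply: ideal_idsum => //; apply: ideal_scale.
apply: (nakayama noethR locR (Q := m)) => //.
rewrite {1}VSE; apply: idsum_min; first exact: ideal_idsum.
  move=> _ [_ [f [_ [Ff [r _ <-] ->]]] <-]; apply: sub_idsuml => //.
  rewrite mulrDr; apply: is_idealD => //; first by apply: sub_idsuml => //; exists f.
  by apply: sub_idsumr; [apply: ideal_scale | rewrite mulrCA; apply: principalM].
apply: idsum_min; first exact: ideal_idsum.
  move=> z Fz; apply: sub_idsumr => //.
  have : F (n + U_(j) + U_(j))%MM z.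
    by move: Fz; apply: antiF; apply/mnm_lepP => l; rewrite !mnmDE mnm1E mnmE; case: eqP; lia.
  move=> /stepn; apply: idmul_min => // a b Ia Fb.
  by apply: idmul_in; [apply: Im Ia | apply: FV].
by move=> z xz; apply: sub_idsuml => //; apply: sub_idsumr => //; apply: ideal_scale.
Qed.

(** Existence of joint reductions for all pairs of directions with the x i
   superficial: generation modulo x i by y j is lifted to R by dividing the
   remainder by x i, which superficiality allows. *)
Theorem joint_reduction_system : exists x y : 'I_s -> R,
  [/\ forall i, I i (x i), forall i, I i (y i), forall i j, regular_pair (x i) (y j)
  & eventually (fun n =>
      (forall i z, F (n + U_(i))%MM (x i * z) -> F n z) /\
      (forall i j, F (n + U_(i) + U_(j))%MM `<=`
        idsum (scale (x i) (F (n + U_(j))%MM)) (scale (y j) (F (n + U_(i))%MM))))].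
Proof.
have /choice[x xP] := superficial_regular_element.
have Ix i : I i (x i) by case: (xP i).
have nx i : nonzerodivisor (x i) by case: (xP i).
have xsup : forall i, eventually (fun n => forall z, F (n + U_(i))%MM (x i * z) -> F n z).
  by move=> i; case: (xP i).
have /choice[y yP] := fun i => superficial_mod i Ix nx.
have Iy i : I i (y i) by case: (yP i).
have xy i j : regular_pair (x i) (y j) by case: (yP j).
exists x, y; split=> //.
have gen : forall i, eventually (fun n => forall j,
    F (n + U_(j))%MM `<=` idsum (scale (y j) (F n)) (principal (x i))).
  move=> i; apply: generated_mod => // j; have [_ _] := yP j.
  by apply: eventuallyW => n yn; apply: yn.
have genU := eventually_all (fun i => eventually_shift U_(i)%MM (gen i)).
have xsupU := eventually_all (fun j => eventually_all (fun i => eventually_shift U_(j)%MM (xsup i))).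
apply: eventuallyW (eventually_and (eventually_all xsup) (eventually_and genU xsupU)).
move=> n [xn [gn xUn]]; split=> [//|i j z Fz].
have [_ [_ [[f Ff <-] [r _ <-] zE]]] := gn i j z Fz.
exists (x i * r), (y j * f); split; [exists r => // | by exists f | by rewrite zE addrC].
apply: (xUn j i); have -> : x i * r = z - y j * f by rewrite zE addrAC subrr add0r.
have -> : (n + U_(j) + U_(i) = n + U_(i) + U_(j))%MM by mnm.
by apply: is_idealB => //; apply: (gradedM grF).
Qed.

End JointSystem.

(** * Admissible filtrations *)

(** Representatives of distinct residue classes. *)
Lemma infinite_residue_units (R : comNzRingType) (m : set R) :
  noetherian R -> local_ring m -> infinite_residue_field m ->
  exists c : nat -> R, forall k l, k != l -> exists u, u * (c k - c l) = 1.
Proof.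
move=> noethR locR /infiniteP/pcard_leP[f].
have fE k : exists c, f k = [set y | m (y - c)].
  by have [c _ <-] := 'funS_f (I : setT k); exists c.
have /choice[c cE] := fE.
exists c => k l /eqP kl; apply: (local_unit noethR locR) => mkl; apply: kl.
have idm := ideal_max locR.
have fkl : f k = f l; last by exact: ('inj_f (in_setT k) (in_setT l) fkl).
rewrite !cE; apply/predeqP => y /=; split=> my.
  by rewrite -[y - c l](subrKA (c k)); apply: is_idealD.
rewrite -[y - c k](subrKA (c l)); apply: is_idealD => //.
by rewrite -opprB; apply: is_idealN.
Qed.

Definition unitdeg {s} (i : 'I_s) : 'rV[int]_s := delta_mx 0 i.

Lemma unitdegE s (i j : 'I_s) : unitdeg i 0 j = (j == i)%:Z.
Proof. by rewrite mxE eqxx /=; case: (j == i). Qed.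

Section MultiPowers.
Variables (R : comNzRingType) (s : nat) (I : 'I_s -> set R).
Implicit Types (n p : 'rV[int]_s) (a : 'I_s -> R).

Lemma multipow_prod n a : (forall i, idexp (I i) (n 0 i) (a i)) ->
  multipow I n (\prod_i a i).
Proof.
move=> na; rewrite /multipow; apply: (big_ind2 (fun (A : set R) b => A b)) => //.
by move=> A b B d; apply: idmul_in.
Qed.

Lemma multipow_ideal n : is_ideal (multipow I n).
Proof.
by rewrite /multipow; case: (index_enum _) => [|i r]; rewrite ?big_nil ?big_cons.
Qed.

Lemma multipow_min n J : is_ideal J ->
  (forall a, (forall i, idexp (I i) (n 0 i) (a i)) -> J (\prod_i a i)) ->
  multipow I n `<=` J.
Proof.
rewrite /multipow; elim: (index_enum _) (index_enum_uniq 'I_s) J => [_|i r IH /= /andP[ir ur]] J idJ nJ.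
  have J1 : J 1.
    have := nJ (fun i => 0) ; rewrite big_nil; apply=> i.
    by case: (n 0 i) => // -[|k] //=; apply: is_ideal0.
  by rewrite big_nil (is_ideal_1 idJ J1).
rewrite big_cons; apply: idmul_min => // x y Ix ny.
suff : colon J x y by [].
move: y ny; apply: IH => //; first exact: ideal_colon.
move=> a na; pose b j := if j == i then x else a j.
have -> : \prod_(j <- r) a j = \prod_(j <- r) b j.
  apply: eq_big_seq => j jr; rewrite /b ifF //; apply/negbTE/eqP => ji.
  by move: ir; rewrite -ji jr.
have bi : b i = x by rewrite /b eqxx.
have := nJ b; rewrite big_cons bi; apply=> j.
by rewrite /b; case: eqP => [->|].
Qed.

Lemma multipow_pred n i : 1 <= n 0 i ->
  multipow I n `<=` idmul (I i) (multipow I (n - unitdeg i)).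
Proof.
move=> ni; apply: multipow_min => // a na.
rewrite (bigD1 i) //=; set P := \prod_(j | _) _.
suff : idexp (I i) (n 0 i) `<=` colon (idmul (I i) (multipow I (n - unitdeg i))) P.
  by move=> /(_ _ (na i)); rewrite /colon /= mulrC.
case E : (n 0 i) ni => [[|k]|//] // _.
apply: idmul_min => [|b d Ib Id]; first exact: ideal_colon.
rewrite /colon /= mulrCA; apply: idmul_in => //.
pose a' j := if j == i then d else a j.
have -> : P * d = \prod_j a' j.
  rewrite (bigD1 i) //= {1}/a' eqxx mulrC; congr (_ * _).
  by apply: eq_bigr => j /negbTE ji; rewrite /a' ji.
apply: multipow_prod => j; rewrite /a' mxE mxE unitdegE.
case: eqP => [->|_]; last by rewrite oppr0 addr0.
have -> : n 0 i + - (true : nat)%:Z = k%:Z by rewrite E; lia.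
by [].
Qed.

Lemma multipow_unitdeg i x : is_ideal (I i) -> I i x -> multipow I (unitdeg i) x.
Proof.
move=> idI Ix; have -> : x = \prod_j (if j == i then x else 1).
  by rewrite (bigD1 i) //= eqxx big1 ?mulr1 // => j /negbTE ->.
apply: multipow_prod => j; rewrite unitdegE; case: eqP => [->|_] //=.
by rewrite -[x]mulr1; apply: idmul_in.
Qed.

Lemma multipow_de a : (forall i, is_ideal (I i)) -> (forall i, I i (a i)) ->
  multipow I de (\prod_i a i).
Proof.
move=> idI Ia; apply: multipow_prod => i; rewrite mxE /=.
by rewrite -[a i]mulr1; apply: idmul_in.
Qed.

Lemma laurent_bounded (f : laurent R s) : exists N : nat, forall n i,
  f n != 0 -> n 0 i <= N%:Z.
Proof.
exists (\max_(p <- finsupp f) \max_i `|p 0%R i|)%N => n i fn.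
have nf : n \in finsupp f by rewrite mem_finsupp.
apply: le_trans (lez_abs _) _; rewrite lez_nat.
apply: leq_trans (leq_bigmax_seq (F := fun p => \max_i `|p 0%R i|)%N n nf isT).
exact: (leq_bigmax (F := fun i => `|n 0%R i|)%N).
Qed.

(** Finitely many homogeneous generators have degrees at most N in direction i, so
   every coefficient that contributes to degree n + [unitdeg i] has positive
   degree in this direction and lies in a multiple of [I i]. *)
Lemma filtration_eventually_generated (F : 'rV[int]_s -> set R) : admissible I F ->
  exists N : nat, forall n i, N%:Z <= n 0 i -> F (n + unitdeg i) `<=` idmul (I i) (F n).
Proof.
move=> [filtF _ [r [g [gF gen]]]].
have /choice[N NP] := fun j => laurent_bounded (g j).
exists (\max_j N j)%N => n i nN z Fz.
pose f : laurent R s := [fsfun x in [fset (n + unitdeg i)%R]%fset => z].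
have fE p : f p = if p == n + unitdeg i then z else 0 by rewrite fsfunE inE.
have [p|c [cI cE]] := gen f.
  by rewrite fE; case: eqP => [->//|_]; apply: is_ideal0; apply: (filtration_ideal filtF).
have := cE (n + unitdeg i); rewrite fE eqxx => ->.
apply: (ideal_sum (A := idmul (I i) (F n))) => // j.
apply: (ideal_sum (A := idmul (I i) (F n))) => // p.
have [->|gn0] := eqVneq (g j (n + unitdeg i - p)) 0; first by rewrite mulr0; apply: is_ideal0.
have pi : 1 <= p 0 i.
  have := NP j _ i gn0; rewrite !mxE !eqxx /= => h.
  have : (N j)%:Z <= n 0 i by apply: le_trans nN; rewrite lez_nat leq_bigmax.
  by move: h; lia.
suff : multipow I p `<=` colon (idmul (I i) (F n)) (g j (n + unitdeg i - p)).
  by move=> /(_ _ (cI j p)); rewrite /colon /= mulrC.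
apply: subset_trans (multipow_pred pi) _.
apply: idmul_min => [|b d Ib Id]; first exact: ideal_colon.
rewrite /colon /= mulrCA; apply: idmul_in => //.
have Fgd : F ((n + unitdeg i - p) + (p - unitdeg i)) (g j (n + unitdeg i - p) * d).
  apply: (filtration_mul filtF); apply: idmul_in; first exact: gF.
  exact: (filtration_multipow filtF).
by move: Fgd; rewrite addrA subrK addrK.
Qed.

End MultiPowers.

Section FiltrationProducts.
Variables (R : comNzRingType) (s : nat) (I : 'I_s -> set R).
Variable F : 'rV[int]_s -> set R.
Hypothesis filtF : filtration I F.

Lemma filtrationM n p a b : F n a -> F p b -> F (n + p) (a * b).
Proof. by move=> Fa Fb; apply: (filtration_mul filtF); apply: idmul_in. Qed.

Lemma filtration_act n i a z : is_ideal (I i) -> I i a -> F n z ->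
  F (n + unitdeg i) (a * z).
Proof.
move=> idI Ia Fz; rewrite mulrC; apply: filtrationM => //.
by apply: (filtration_multipow filtF); apply: multipow_unitdeg.
Qed.

Lemma filtration0 : F 0 = setT.
Proof.
apply: is_ideal_1; first exact: (filtration_ideal filtF).
apply: (filtration_multipow filtF); have := @multipow_prod R s I 0 (fun=> 1).
by rewrite big1 //; apply=> i; rewrite mxE.
Qed.

End FiltrationProducts.

Section AdmissibleFiltration.
Variables (R : comNzRingType) (m : set R) (s : nat) (I : 'I_s -> set R).
Variable F : 'rV[int]_s -> set R.
Hypothesis hI : forall i, m_primary m (I i).
Hypothesis filtF : filtration I F.
Hypothesis posF : forall n, F n = F (dpos n).

Lemma m_primary_ideal i : is_ideal (I i). Proof. by have [[]] := hI i. Qed.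
Lemma m_primary_sub i : I i `<=` m.
Proof. by have [_ <-] := hI i; move=> x Ix; exists 1%N; rewrite expr1. Qed.
Lemma m_primary_cofinite i : cofinite m (I i).
Proof. by have [_ mE] := hI i; move=> f; rewrite -{1}mE. Qed.

Definition zdeg (n : 'X_{1..s}) : 'rV[int]_s := \row_i (n i)%:Z.

Lemma zdegD n p : zdeg (n + p)%MM = zdeg n + zdeg p.
Proof. by apply/rowP => i; rewrite !mxE mnmDE PoszD. Qed.

Lemma zdegU i : zdeg U_(i)%MM = unitdeg i.
Proof. by apply/rowP => j; rewrite mxE unitdegE mnm1E eq_sym; case: (j == i). Qed.

Lemma zdegP n : dle 0 n -> exists p, n = zdeg p.
Proof.
move=> /forallP n0; exists [multinom `|n 0%R i|%N | i < s].
by apply/rowP => i; rewrite !mxE mnmE gez0_abs //; have := n0 i; rewrite mxE.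
Qed.

Lemma graded_filtration : graded I (F \o zdeg).
Proof.
split=> [n|n i a z Ia Fz] /=; first exact: (filtration_ideal filtF).
by rewrite zdegD zdegU; apply: (filtration_act filtF) => //; apply: m_primary_ideal.
Qed.

Lemma filtration_cofinite n : cofinite m (F n).
Proof.
rewrite posF; have [|p ->] := @zdegP (dpos n).
  by apply/forallP => i; rewrite !mxE le_max lexx.
have : (0 <= p)%MM by apply/mnm_lepP => i; rewrite mnm0E.
move: p; apply: multinom_ind => [|p i _ IH] f mf.
  exists 0%N; have -> : zdeg 0%MM = 0 by apply/rowP => i; rewrite !mxE mnm0E.
  by rewrite (filtration0 filtF).
have [k Fk] := IH f mf; have [l Il] := m_primary_cofinite i mf.
exists (l + k)%N; rewrite exprD zdegD zdegU.
by apply: (filtration_act filtF) => //; apply: m_primary_ideal.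
Qed.

Lemma for_large_eventually (Q : 'rV[int]_s -> Prop) :
  eventually (Q \o zdeg) -> for_large Q.
Proof.
move=> [M QM]; exists M => n nM; have [|p nE] := @zdegP n.
  by apply/forallP => i; rewrite mxE; apply: le_trans (nM i).
by rewrite nE; apply: (QM p) => i; have := nM i; rewrite nE mxE lez_nat.
Qed.

Hypothesis noethR : noetherian R.
Hypothesis locR : local_ring m.
Hypothesis dim2 : krull_dim R 2.
Hypothesis depth2 : depth m 2.
Hypothesis resR : infinite_residue_field m.
Hypothesis finF : finite_rees I F.

Lemma joint_reductions : exists x y : 'I_s -> R,
  [/\ forall i, I i (x i), forall i, I i (y i), forall i j, regular_pair (x i) (y j)
  & for_large (fun n =>
      (forall i z, F (n + unitdeg i) (x i * z) -> F n z) /\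
      (forall i j, F (n + unitdeg i + unitdeg j) `<=`
        idsum (scale (x i) (F (n + unitdeg j))) (scale (y j) (F (n + unitdeg i)))))].
Proof.
have [c c_unit] := infinite_residue_units noethR locR resR.
have [N NF] := filtration_eventually_generated (Admissible filtF posF finF).
have [||||x [y [Ix Iy xy ev]]] := joint_reduction_system noethR locR dim2 depth2
  m_primary_ideal m_primary_sub c_unit graded_filtration.
- by rewrite /= -(filtration0 filtF); congr F; apply/rowP => i; rewrite !mxE mnm0E.
- move=> n p np /=; apply: (filtration_le filtF); apply/forallP => i.
  by rewrite !mxE lez_nat; apply/mnm_lepP: i.
- by move=> n; apply: filtration_cofinite.
- exists N => n nN i /=; rewrite zdegD zdegU; apply: NF.
  by rewrite mxE lez_nat.
exists x, y; split=> //; apply: for_large_eventually.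
apply: eventuallyW ev => n /= [xn gn]; split=> [i z|i j].
  by rewrite -zdegU -zdegD; apply: xn.
by rewrite -!zdegU -!zdegD; apply: gn.
Qed.

End AdmissibleFiltration.

(** * Vanishing of the first local cohomology *)

Section GradedHom.
Variables (R : comNzRingType) (s : nat) (A : 'rV[int]_s -> set R).
Variables (M N : gmod A) (f : forall n, M n -> N n).
Hypothesis homf : is_ghom f.

Lemma ghomB n (x y : M n) : f (x - y) = f x - f y.
Proof. by apply: (addIr (f y)); rewrite -homf.1 !subrK. Qed.

Lemma ghom0 n : f (0 : M n) = 0.
Proof. by rewrite -{1}(subrr 0) ghomB subrr. Qed.

End GradedHom.

Section FirstLocalCohomology.
Variables (R : comNzRingType) (s : nat) (I : 'I_s -> set R).
Variables (F : 'rV[int]_s -> set R) (filtF : filtration I F).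
Implicit Types (n p : 'rV[int]_s) (k : nat) (z a : R).

Let A : 'rV[int]_s -> set R := rees (multipow I).

(** The module R[t_1^+-1, ..., t_s^+-1], which contains the Rees module of F. *)
Definition laurent_gmod : gmod A := @GMod R s A (fun=> R : zmodType)
  (fun n p a x => a * x)
  (fun n p a x y _ => mulrDr a x y) (fun n p a b x _ _ => mulrDl a b x)
  (fun n x => mul1r x) (fun n p q a b x _ _ => mulrA b a x).

Definition rees_incl n (x : rees_gmod filtF n) : laurent_gmod n := ideal_val x.

Lemma rees_incl_hom : is_ghom rees_incl.
Proof.
split=> [n x y|n p a x Aa].
  by change (val (x + y) = val x + val y); rewrite raddfD.
by apply: val_rees_act; apply: rees_act_in.
Qed.

Lemma rees_incl_inj n : injective (@rees_incl n).
Proof. exact: val_inj. Qed.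

Lemma rees_inclE n z : rees F n z <-> exists x, @rees_incl n x = z.
Proof.
split=> [Fz|[x <-]]; last by have /asboolP := valP x.
have Pz : z \in ideal_pred (Ideal (rees_ideal_subproof filtF n)) by apply/asboolP.
by exists (IdealElt Pz).
Qed.

(** z t^n in the Laurent module becomes an element of the Rees module after k
   multiplications by elements of the ideal. *)
Fixpoint absorbed k n z : Prop :=
  if k is k'.+1 then forall p a, rees_pp I (p - n) a -> absorbed k' p (a * z)
  else rees F n z.

Lemma rees_pp_sub n a : rees_pp I n a -> A n a.
Proof.
rewrite /rees_pp /A /rees; case: ifP => [/forallP en|_ ->].
  rewrite ifT //; apply/forallP => i; have := en i; rewrite !mxE.
  by apply: le_trans.
by case: ifP => // _; apply: is_ideal0; apply: multipow_ideal.
Qed.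

Lemma rees_ppM n p a z : rees_pp I (p - n) a -> rees F n z -> rees F p (a * z).
Proof.
move=> /rees_pp_sub Aa /rees_inclE[x <-].
by have := rees_act_in x Aa.
Qed.

Lemma gact0 (M : gmod A) n p a : A (p - n) a -> gact p a (0 : M n) = 0.
Proof. by move=> Aa; apply: (addIr (gact p a (0 : M n))); rewrite -gactDr // !addr0 add0r. Qed.

Let idF n : is_ideal (rees F n) := rees_ideal_subproof filtF n.

Lemma absorbedS k n z : absorbed k n z -> absorbed k.+1 n z.
Proof.
elim: k n z => [|k IH] n z; first by move=> Fz p a Ja; apply: rees_ppM Ja Fz.
by move=> abz p a Ja; apply: IH; apply: abz.
Qed.

Lemma absorbedB k n z w : absorbed k n z -> absorbed k n w -> absorbed k n (z - w).
Proof.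
elim: k n z w => [|k IH] n z w; first exact: (is_idealB (idF _)).
by move=> az aw p a Ja; rewrite mulrBr; apply: IH; [apply: az | apply: aw].
Qed.

Lemma absorbed0 k n : absorbed k n 0.
Proof.
elim: k n => [|k IH] n; first exact: (is_ideal0 (idF _)).
by move=> p a _; rewrite mulr0.
Qed.

Lemma absorbed_rees k n z : rees F n z -> absorbed k n z.
Proof. by move=> Fz; elim: k => // k; apply: absorbedS. Qed.

Lemma killed0 (M : gmod A) k n : @killed _ _ _ (rees_pp I) M k n 0.
Proof.
elim: k n => [//|k IH] n p a /rees_pp_sub Aa.
by rewrite gact0 //; apply: IH.
Qed.

Lemma killedS (M : gmod A) k n (x : M n) : killed (rees_pp I) k x -> killed (rees_pp I) k.+1 x.
Proof.
elim: k n x => [|k IH] n x; first by move=> -> ; apply: killed0.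
by move=> kx p a Ja; apply: IH; apply: kx.
Qed.

(** Extend the augmentation of the injective resolution E from the Rees module to
   a map g on the Laurent module. For z absorbed by a power of the ideal, d (g z)
   is a torsion cycle, hence the boundary of a torsion element x. Then g z - x
   comes from some w in the Rees module, so that g (z - w) = x is torsion; as y is
   regular and g is injective on the Rees module, z = w. *)
Lemma local_cohomology1_closed n z y k : rees_pp I de y -> nonzerodivisor y ->
  local_cohomology_zero (rees_pp I) 1 (rees_gmod filtF) n -> absorbed k n z -> rees F n z.
Proof.
move=> Jy ny [E HE] abz.
have [g homg gE] := @gres_inj _ _ _ _ E 0%N _ _ _ _ rees_incl_hom rees_incl_inj (gres_aug_hom E).
have homd := gres_d_hom E 0%N.
have dg0 p w : rees F p w -> gres_d (g p w) = 0.
  by move=> /rees_inclE[x <-]; rewrite gE; apply/gres_exact0; exists x.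
have tors : gtorsion (rees_pp I) (gres_d (g n z)).
  exists k; elim: k n z abz {HE} => [|k IH] n z abz; first exact: dg0.
  move=> p a Ja; have Aa := rees_pp_sub Ja.
  by rewrite -homd.2 // -homg.2 //; apply: IH; apply: abz.
have [x [l kx] dx] : exists2 x : gres_obj E 0 n, gtorsion (rees_pp I) x & gres_d x = gres_d (g n z).
  by apply: HE => //; apply/gres_exact; exists (g n z).
have [w wE] : exists w, @gres_aug _ _ _ _ E n w = g n z - x.
  by apply/gres_exact0; rewrite (ghomB homd) dx subrr.
have xE : x = g n (z - ideal_val w).
  by rewrite (ghomB homg) -/(rees_incl w) gE wE subKr.
suff z0 : z - ideal_val w = 0.
  by apply/rees_inclE; exists w; apply/eqP; rewrite eq_sym -subr_eq0; apply/eqP.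
have abw : absorbed (k + l) n (z - ideal_val w).
  apply: absorbedB; last by apply: absorbed_rees; apply/rees_inclE; exists w.
  by rewrite addnC; elim: l {kx} => // l; apply: absorbedS.
have {kx} kx : killed (rees_pp I) (k + l) x.
  by elim: k {abz abw tors} => // k; apply: killedS.
move: (k + l)%N abw kx; rewrite xE; move: (z - _) => u {z abz tors x dx w wE xE HE} q.
elim: q n u => [|q IH] n u.
  move=> /rees_inclE[w <-]; rewrite /= gE => aw.
  suff -> : w = 0 by [].
  by apply: (gres_aug_inj (g := E)); rewrite aw (ghom0 (gres_aug_hom E)).
have Jyn : rees_pp I (n + de - n) y by rewrite addrC addKr.
move=> abu ku; apply: ny; apply: (IH (n + de)); first exact: abu.
have := ku (n + de) y Jyn.
by rewrite -homg.2 //; apply: rees_pp_sub.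
Qed.

(** If y1 z and y2 z lie in F (n + e), high powers of the ideal, which lie in
   products (y1, y2) F p, carry z into the filtration; so z represents a class of
   the first local cohomology. *)
Lemma reduction_colon_closed n z y1 y2 N : dle 0 n ->
  rees_pp I de y1 -> rees_pp I de y2 -> nonzerodivisor y1 ->
  local_cohomology_zero (rees_pp I) 1 (rees_gmod filtF) n ->
  (forall p, (forall i, N%:Z <= p 0 i) ->
    F (p + de) `<=` idmul (idsum (principal y1) (principal y2)) (F p)) ->
  F (n + de) (y1 * z) -> F (n + de) (y2 * z) -> F n z.
Proof.
move=> n0 Jy1 Jy2 ny1 H1 red Fy1 Fy2.
have reesF p : dle 0 p -> rees F p = F p by rewrite /rees => ->.
have idFp p := filtration_ideal filtF p.
rewrite -reesF //; apply: (local_cohomology1_closed (k := N.+1) Jy1) => //.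
suff H k p b : F (p - n) b -> dle 0 (p - n) ->
    (forall i, N.+1%:Z <= (p - n) 0 i + k%:Z) -> absorbed k p (b * z).
  rewrite -[z]mul1r; apply: H; rewrite ?subrr.
  - by rewrite (filtration0 filtF).
  - by apply/forallP => i.
  - by move=> i; rewrite mxE add0r.
elim: k p b => [|k IH] p b Fb pn pk.
  have p0 : dle 0 p.
    apply/forallP => i; move/forallP/(_ i): pn; move/forallP/(_ i): n0; rewrite !mxE;
    move: (n 0 i) (p 0 i) => ? ?; lia.
  rewrite /= reesF //.
  have Nq i : N%:Z <= (p - n - de) 0 i by have := pk i; rewrite !mxE;
    move: (n 0 i) (p 0 i) => ? ?; lia.
  have := red _ Nq b; rewrite subrK => /(_ Fb).
  suff : idmul (idsum (principal y1) (principal y2)) (F (p - n - de)) `<=` colon (F p) z.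
    by move=> sub /sub; rewrite /colon /= mulrC.
  apply: idmul_min => [|_ f [_ [_ [[r _ <-] [t _ <-] ->]]] Ff]; first exact: ideal_colon.
  rewrite /colon /=.
  have -> : z * ((y1 * r + y2 * t) * f) = f * (r * (y1 * z) + t * (y2 * z)) by ring.
  have -> : p = (p - n - de) + (n + de) by rewrite [n + de]addrC addrA !subrK.
  apply: (filtrationM filtF) => //.
  by apply: is_idealD => //; apply: is_ideal_mull.
move=> q a; rewrite /rees_pp; case: ifP => [eq Ia|_ ->]; last by rewrite mul0r; apply: absorbed0.
have qn : q - n = (q - p) + (p - n) by rewrite addrA subrK.
rewrite mulrA; apply: IH.
- rewrite qn; apply: (filtrationM filtF) => //.
  exact: (filtration_multipow filtF).
- apply/forallP => i; move/forallP/(_ i): pn; move/forallP/(_ i): eq; rewrite !mxE;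
    move: (n 0 i) (p 0 i) => ? ?; lia.
- move=> i; move/forallP/(_ i): eq; have := pk i; rewrite !mxE;
    move: (n 0 i) (p 0 i) => ? ?; lia.
Qed.

End FirstLocalCohomology.

(** * Good complete reductions from joint reductions *)

Section Reductions.
Variables (R : comNzRingType) (s : nat) (I : 'I_s -> set R).
Variable F : 'rV[int]_s -> set R.
Hypothesis filtF : filtration I F.
Hypothesis idI : forall i, is_ideal (I i).
Implicit Types (n p : 'rV[int]_s) (r : seq 'I_s).

Lemma range_ord2 (T : Type) (f : 'I_2 -> T) : range f = [set f 0] `|` [set f 1].
Proof.
apply/seteqP; split=> [_ [i _ <-]|_ [->|->]]; last 2 first.
- by exists 0.
- by exists 1.
case: i => [[|[|//]] ilt]; [left | right]; by congr f; apply: val_inj.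
Qed.

Lemma red_idealE (x : 'I_s -> 'I_2 -> R) :
  red_ideal x = idsum (principal (red_elt x 0)) (principal (red_elt x 1)).
Proof.
rewrite /red_ideal range_ord2; apply/seteqP; split.
  apply: ideal_span_min => [|z [->|->]]; first exact: ideal_idsum.
    exact: sub_idsuml.
  exact: sub_idsumr.
apply: idsum_min => //; apply: principal_min => //; apply: sub_ideal_span.
  by left.
by right.
Qed.

Lemma idmul_idsum_principal (y1 y2 : R) B : is_ideal B ->
  idmul (idsum (principal y1) (principal y2)) B = idsum (scale y1 B) (scale y2 B).
Proof.
move=> idB; apply/seteqP; split.
  apply: idmul_min => [|_ b [_ [_ [[r _ <-] [t _ <-] ->]]] Bb].
    by apply: ideal_idsum; apply: ideal_scale.
  exists (y1 * (r * b)), (y2 * (t * b)); split; last by ring.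
    by exists (r * b) => //; apply: is_ideal_mull.
  by exists (t * b) => //; apply: is_ideal_mull.
apply: idsum_min => // _ [b Bb <-]; apply: idmul_in => //.
  exact: sub_idsuml.
exact: sub_idsumr.
Qed.

Definition sumdeg r : 'rV[int]_s := \sum_(i <- r) unitdeg i.

Lemma sumdeg_cons i r : sumdeg (i :: r) = unitdeg i + sumdeg r.
Proof. by rewrite /sumdeg big_cons. Qed.

Lemma sumdeg_all : sumdeg (index_enum 'I_s) = de.
Proof.
apply/rowP => j; rewrite summxE (bigD1 j) //= [RHS]mxE unitdegE eqxx big1 ?addr0 //.
by move=> i /negbTE ij; rewrite unitdegE eq_sym ij.
Qed.

Lemma large_sumdeg (N : nat) n r : (forall i, N%:Z <= n 0 i) ->
  forall i, N%:Z <= (n + sumdeg r) 0 i.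
Proof.
move=> nN i; rewrite mxE; apply: le_trans (nN i) _; rewrite lerDl summxE.
by apply: sumr_ge0 => j _; rewrite mxE; case: (_ && _).
Qed.

Lemma large_unitdeg (N : nat) n i : (forall i, N%:Z <= n 0 i) ->
  forall j, N%:Z <= (n + unitdeg i) 0 j.
Proof.
by move=> nN; have := large_sumdeg [:: i] nN; rewrite /sumdeg big_seq1.
Qed.

Let unitact n i a z : I i a -> F n z -> F (n + unitdeg i) (a * z).
Proof. exact: (filtration_act filtF). Qed.

Lemma prod_act r (x : 'I_s -> R) n z : (forall i, I i (x i)) -> F n z ->
  F (n + sumdeg r) (\prod_(i <- r) x i * z).
Proof.
move=> Ix Fz; elim: r => [|i r IH]; first by rewrite /sumdeg !big_nil addr0 mul1r.
by rewrite sumdeg_cons big_cons addrCA addrC -mulrA; apply: unitact.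
Qed.

Section FromJointReductions.
Variables (x y : 'I_s -> R) (M : nat).
Hypotheses (Ix : forall i, I i (x i)) (Iy : forall i, I i (y i)).
Hypothesis supx : forall n, (forall i, M%:Z <= n 0 i) ->
  forall i z, F (n + unitdeg i) (x i * z) -> F n z.
Hypothesis joint : forall n, (forall i, M%:Z <= n 0 i) -> forall i j,
  F (n + unitdeg i + unitdeg j) `<=`
  idsum (scale (x i) (F (n + unitdeg j))) (scale (y j) (F (n + unitdeg i))).

Let idF n : is_ideal (F n) := filtration_ideal filtF n.

(** Divide by the factors one at a time. *)
Lemma prod_superficial r n z : (forall i, M%:Z <= n 0 i) ->
  F (n + sumdeg r) (\prod_(i <- r) x i * z) -> F n z.
Proof.
move=> nM; elim: r => [|i r IH]; first by rewrite /sumdeg !big_nil addr0 mul1r.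
rewrite sumdeg_cons big_cons -mulrA addrCA addrC => Fz; apply: IH.
by apply: supx Fz; apply: large_sumdeg.
Qed.

(** Joint reductions multiply: if F is generated by x i and y j for each j, it is
   generated by x i and the product of the y j. *)
Lemma joint_prod_right i r n : (forall i, M%:Z <= n 0 i) ->
  F (n + unitdeg i + sumdeg r) `<=` idsum (scale (x i) (F (n + sumdeg r)))
    (scale (\prod_(j <- r) y j) (F (n + unitdeg i))).
Proof.
elim: r n => [|j r IH] n nM.
  rewrite /sumdeg !big_nil !addr0 => z Fz; apply: sub_idsumr; first exact: ideal_scale.
  by exists z; rewrite ?mul1r.
have -> : n + unitdeg i + sumdeg (j :: r) = (n + unitdeg j) + unitdeg i + sumdeg r.
  by rewrite sumdeg_cons addrA; congr (_ + _); exact: addrAC.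
apply: subset_trans (IH _ (large_unitdeg j nM)) _.
have -> : n + sumdeg (j :: r) = n + unitdeg j + sumdeg r by rewrite sumdeg_cons addrA.
have idT : is_ideal (idsum (scale (x i) (F (n + unitdeg j + sumdeg r)))
    (scale (\prod_(j <- (j :: r)) y j) (F (n + unitdeg i)))).
  by apply: ideal_idsum; apply: ideal_scale.
apply: idsum_min => //; first by apply: sub_idsuml; apply: ideal_scale.
rewrite addrAC => _ [z Fz <-].
have [_ [_ [[a Fa <-] [b Fb <-] ->]]] := joint nM Fz.
rewrite mulrDr; apply: is_idealD => //.
  apply: sub_idsuml; first exact: ideal_scale.
  by rewrite mulrCA; exists (\prod_(k <- r) y k * a) => //; apply: prod_act.
apply: sub_idsumr; first exact: ideal_scale.
by exists b => //; rewrite big_cons; ring.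
Qed.

Lemma joint_prod_left r n : (forall i, M%:Z <= n 0 i) ->
  F (n + sumdeg r + de) `<=` idsum (scale (\prod_(i <- r) x i) (F (n + de)))
    (scale (\prod_j y j) (F (n + sumdeg r))).
Proof.
move=> nM; elim: r => [|i r IH].
  rewrite /sumdeg !big_nil !addr0 => z Fz; apply: sub_idsuml; first exact: ideal_scale.
  by exists z; rewrite ?mul1r.
have -> : n + sumdeg (i :: r) = n + sumdeg r + unitdeg i by rewrite sumdeg_cons addrCA addrC.
have := joint_prod_right (i := i) (r := index_enum 'I_s) (large_sumdeg r nM).
rewrite sumdeg_all => /subset_trans; apply.
have idT : is_ideal (idsum (scale (\prod_(j <- (i :: r)) x j) (F (n + de)))
    (scale (\prod_j y j) (F (n + sumdeg r + unitdeg i)))).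
  by apply: ideal_idsum; apply: ideal_scale.
apply: idsum_min => //; last by apply: sub_idsumr; apply: ideal_scale.
move=> _ [z /IH [_ [_ [[a Fa <-] [b Fb <-] ->]]] <-].
rewrite mulrDr; apply: is_idealD => //.
  apply: sub_idsuml; first exact: ideal_scale.
  by exists a => //; rewrite big_cons; ring.
apply: sub_idsumr; first exact: ideal_scale.
by rewrite mulrCA; exists (x i * b) => //; apply: unitact.
Qed.

Lemma good_complete_reduction_of_joint : (forall i, nonzerodivisor (x i)) ->
  good_complete_reduction I F (fun i j => if j == 0 then x i else y i).
Proof.
move=> nx; set X := fun i j => _.
have X0 : red_elt X 0 = \prod_i x i by apply: eq_bigr.
have X1 : red_elt X 1 = \prod_i y i by apply: eq_bigr.
have Ft n z w : (forall i, I i (w i)) -> F n z -> F (n + de) (\prod_i w i * z).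
  by move=> Iw Fz; rewrite -sumdeg_all; apply: prod_act.
have nX : nonzerodivisor (\prod_i x i).
  by elim/big_ind: _ => // [z|]; [rewrite mul1r | apply: nonzerodivisorM].
split; first split.
- by move=> i j; rewrite /X; case: ifP.
- exists M.+1 => n nM; rewrite red_idealE X0 X1 idmul_idsum_principal //.
  apply/seteqP; split; first by apply: idsum_min => // _ [z Fz <-]; apply: Ft.
  have nE : n = n - de + sumdeg (index_enum 'I_s) by rewrite sumdeg_all subrK.
  have nM' i : M%:Z <= (n - de) 0 i by have := nM i; rewrite !mxE; move: (n 0 i) => ?; lia.
  by have := joint_prod_left (r := index_enum 'I_s) nM'; rewrite -nE subrK.
- exists M.+1 => n nM; rewrite X0 span1; apply/seteqP; split.
    move=> t [Fz [z _ zE]]; exists z => //.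
    apply: (prod_superficial (r := index_enum 'I_s)).
      by move=> i; have := nM i; rewrite !mxE; move: (n 0 i) => ?; lia.
    by rewrite sumdeg_all subrK zE.
  move=> _ [z Fz <-]; split; last exact: principalM.
  by rewrite -[n](subrK de); apply: Ft.
Qed.

End FromJointReductions.
End Reductions.

(** * Polynomial functions on the lattice *)

Section DiagonalPolynomials.
Variable s : nat.
Implicit Types (f g : 'rV[int]_s -> rat) (n v : 'rV[int]_s).

(** Identities between polynomial functions are only needed along the diagonal
   lines n + k e, where they are identities of polynomials in one variable; every
   such line meets the region of large degrees in infinitely many points. *)
Definition diagonal_poly f := forall n, exists p : {poly rat},
  forall k : nat, f (n + de *+ k) = p.[k%:R].

Lemma diagonal_polyD f g : diagonal_poly f -> diagonal_poly g ->
  diagonal_poly (fun n => f n + g n).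
Proof.
move=> df dg n; have [p pE] := df n; have [q qE] := dg n.
by exists (p + q) => k; rewrite hornerD pE qE.
Qed.

Lemma diagonal_polyZ a f : diagonal_poly f -> diagonal_poly (fun n => a * f n).
Proof. by move=> df n; have [p pE] := df n; exists (a *: p) => k; rewrite hornerZ pE. Qed.

Lemma diagonal_poly_shift v f : diagonal_poly f -> diagonal_poly (fun n => f (n + v)).
Proof. by move=> df n; have [p pE] := df (n + v); exists p => k; rewrite addrAC pE. Qed.

Lemma diagonal_poly_const a : diagonal_poly (fun=> a).
Proof. by move=> n; exists a%:P => k; rewrite hornerC. Qed.

Lemma diagonal_poly_mpeval P : diagonal_poly (mpeval P).
Proof.
move=> n; exists (\sum_(m <- msupp P) (P@_m)%:P * \prod_i ((n 0 i)%:~R%:P + 'X) ^+ m i) => k.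
rewrite /mpeval mevalE horner_sum; apply: eq_bigr => m _.
rewrite hornerM hornerC horner_prod; congr (_ * _); apply: eq_bigr => i _.
rewrite horner_exp hornerD hornerC hornerX; congr (_ ^+ _).
by rewrite mxE intrD; congr (_ + _); rewrite mulmxnE mxE rmorphMn.
Qed.

Lemma diagonal_poly_second_difference P a :
  diagonal_poly (fun n => mpeval P (n + (de + de)) +
    (mpeval P n + (-2 * mpeval P (n + de) + a))).
Proof.
have dP := diagonal_poly_mpeval P.
apply: diagonal_polyD; first exact: diagonal_poly_shift.
apply: diagonal_polyD => //; apply: diagonal_polyD; last exact: diagonal_poly_const.
by apply: diagonal_polyZ; apply: diagonal_poly_shift.
Qed.

Lemma poly_eventually0 (p : {poly rat}) K :
  (forall k : nat, (K <= k)%N -> p.[k%:R] = 0) -> p = 0.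
Proof.
move=> pK; pose rs : seq rat := [seq (K + i)%:R | i <- iota 0 (size p)].
apply: (@roots_geq_poly_eq0 _ p rs).
- by apply/allP => _ /mapP[i _ ->]; rewrite /root pK // leq_addr.
- rewrite map_inj_uniq ?iota_uniq // => i j /eqP.
  by rewrite eqr_nat eqn_add2l => /eqP.
- by rewrite size_map size_iota.
Qed.

Lemma diagonal_poly_eq0 f : diagonal_poly f -> for_large (fun n => f n = 0) ->
  forall n, f n = 0.
Proof.
move=> df [N NP] n; have [p pE] := df n.
have p0 : p = 0.
  apply: (@poly_eventually0 p (N + \max_i `|n 0%R i|)%N) => k Kk.
  rewrite -pE; apply: NP => i; rewrite mxE mulmxnE mxE.
  have : (`|n 0%R i| <= \max_i `|n 0%R i|)%N by apply: (leq_bigmax (F := fun i => `|n 0%R i|)%N).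
  by move: Kk; move: (n 0 i) (\max_i _)%N => ? ?; lia.
by have := pE 0%N; rewrite mulr0n addr0 p0 horner0.
Qed.

End DiagonalPolynomials.

Section QuadraticFunctions.
Variables (s : nat) (h : 'rV[int]_s -> rat) (c : 'I_s -> 'I_s -> rat) (M : nat).
Hypothesis h_diff2 : forall n : 'rV[int]_s, (forall i, M%:Z <= n 0 i) -> forall i j,
  h (n + unitdeg i + unitdeg j) + h n = c i j + h (n + unitdeg i) + h (n + unitdeg j).
Implicit Types (n u v w : 'rV[int]_s).

Let N : 'rV[int]_s := const_mx M%:Z.
Let NM i : M%:Z <= N 0 i. Proof. by rewrite mxE. Qed.

Lemma unit_steps_const (g : 'rV[int]_s -> rat) :
  (forall n, (forall i, M%:Z <= n 0 i) -> forall i, g (n + unitdeg i) = g n) ->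
  forall n, (forall i, M%:Z <= n 0 i) -> g n = g N.
Proof.
move=> gS n nM; have [|p nE] := @zdegP _ n.
  by apply/forallP => i; rewrite mxE; apply: le_trans (nM i).
have NE : N = zdeg [multinom M | i < s] by apply/rowP => i; rewrite !mxE mnmE.
have : ([multinom M | i < s] <= p)%MM.
  by apply/mnm_lepP => i; have := nM i; rewrite nE mxE mnmE lez_nat.
rewrite nE; move: p {nE nM n}; apply: multinom_ind => [|p i Np IH]; first by rewrite NE.
rewrite zdegD zdegU gS // => j; rewrite mxE lez_nat.
by move/mnm_lepP/(_ j): Np; rewrite mnmE.
Qed.

Let B u v : rat := \sum_i \sum_j c i j / 2 * (u 0 i)%:~R * (v 0 j)%:~R.

Let BDl u v w : B (u + v) w = B u w + B v w.
Proof.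
rewrite /B -big_split; apply: eq_bigr => i _ /=; rewrite -big_split.
by apply: eq_bigr => j _ /=; rewrite mxE intrD; ring.
Qed.

Let BDr u v w : B u (v + w) = B u v + B u w.
Proof.
rewrite /B -big_split; apply: eq_bigr => i _ /=; rewrite -big_split.
by apply: eq_bigr => j _ /=; rewrite mxE intrD; ring.
Qed.

Let Bunit i j : B (unitdeg i) (unitdeg j) = c i j / 2.
Proof.
rewrite /B (bigD1 i) //= [X in _ + X]big1 ?addr0 => [|k /negbTE ki]; last first.
  by apply: big1 => l _; rewrite unitdegE ki mulr0 mul0r.
rewrite (bigD1 j) //= [X in _ + X]big1 ?addr0 => [|k /negbTE kj]; last first.
  by rewrite [(unitdeg j) _ _]unitdegE kj mulr0.
by rewrite !unitdegE !eqxx !mulr1.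
Qed.

Let csym i j : c i j = c j i.
Proof.
have := h_diff2 NM i j; have := h_diff2 NM j i.
rewrite [_ + unitdeg j + unitdeg i]addrAC => -> E; apply: (addIr (h (N + unitdeg i) + h (N + unitdeg j))).
by rewrite [LHS]addrA -E [_ + h (N + unitdeg i)]addrC; ring.
Qed.

(** The quadratic part of P is the bilinear form B, whose second differences are
   the c i j; the linear and constant coefficients are fitted at the corner N, and
   the difference between h and P, having vanishing second differences, then
   vanishes. *)
Lemma quadratic_function : exists P : {mpoly rat[s]}, for_large (fun n => h n = mpeval P n).
Proof.
pose q n := B n n.
pose b i := h (N + unitdeg i) - h N - (q (N + unitdeg i) - q N).
pose a := h N - q N - \sum_i b i * (N 0 i)%:~R.
pose P : {mpoly rat[s]} := (\sum_i \sum_j (c i j / 2)%:MP * 'X_i * 'X_j) +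
  \sum_i (b i)%:MP * 'X_i + a%:MP.
have PE n : mpeval P n = q n + \sum_i b i * (n 0 i)%:~R + a.
  rewrite /mpeval /P !mevalD mevalC; congr (_ + _ + _).
    rewrite raddf_sum; apply: eq_bigr => i _; rewrite raddf_sum; apply: eq_bigr => j _.
    by rewrite /= !mevalM mevalC !mevalXU.
  by rewrite raddf_sum; apply: eq_bigr => i _; rewrite /= mevalM mevalC mevalXU.
pose l n := \sum_i b i * (n 0 i)%:~R.
have lD u v : l (u + v) = l u + l v.
  by rewrite /l -big_split; apply: eq_bigr => i _; rewrite mxE intrD mulrDr.
have lunit i : l (unitdeg i) = b i.
  rewrite /l (bigD1 i) //= unitdegE eqxx mulr1 big1 ?addr0 // => j /negbTE ji.
  by rewrite unitdegE ji mulr0.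
have Pdiff n i : mpeval P (n + unitdeg i) - mpeval P n = q (n + unitdeg i) - q n + b i.
  by rewrite !PE -!/(l _) lD lunit; ring.
have PN : mpeval P N = h N by rewrite PE /a; ring.
pose f n := h n - mpeval P n.
have fdiff i n : (forall i, M%:Z <= n 0 i) -> f (n + unitdeg i) = f n.
  move=> nM; apply/eqP; rewrite -subr_eq0; apply/eqP.
  pose g n := f (n + unitdeg i) - f n.
  have gE k : g k = h (k + unitdeg i) - h k - (q (k + unitdeg i) - q k) - b i.
    by rewrite /g /f -[RHS]addrA -opprD -Pdiff; ring.
  rewrite -/(g n) (unit_steps_const _ nM); first by rewrite gE /b; ring.
  move=> k kM j; rewrite !gE /q !BDl !BDr !Bunit.
  have := h_diff2 kM i j; rewrite [in h (k + unitdeg j + _)]addrAC (csym j i) => E.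
  have -> : h (k + unitdeg i + unitdeg j) = c i j + h (k + unitdeg i) + h (k + unitdeg j) - h k.
    by rewrite -E addrK.
  by field.
exists P; exists M => n nM; apply/eqP; rewrite -subr_eq0; apply/eqP.
by rewrite -/(f n) (unit_steps_const (fun n nM i => fdiff i n nM) nM) /f PN subrr.
Qed.

End QuadraticFunctions.

(** * Hilbert functions and reduction numbers *)

Lemma dleP s (n p : 'rV[int]_s) : dle n p <-> forall i, n 0 i <= p 0 i.
Proof. by split=> [/forallP|?]; last apply/forallP. Qed.

Lemma is_minimum_ex (S : set nat) k : S k -> exists d, is_minimum S d.
Proof.
move=> Sk; have exS : exists d, `[< S d >] by exists k; apply/asboolP.
have [d /asboolP Sd dmin] := ex_minnP exS.
by exists d; split=> // l Sl; apply: dmin; apply/asboolP.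
Qed.

Section HilbertDifferences.
Variables (R : comNzRingType) (m : set R).
Hypothesis noethR : noetherian R.
Hypothesis locR : local_ring m.
Hypothesis dim2 : krull_dim R 2.
Hypothesis depth2 : depth m 2.
Variables (s : nat) (I : 'I_s -> set R).
Hypothesis s_gt0 : (0 < s)%N.
Hypothesis hI : forall i, m_primary m (I i).
Variable F : 'rV[int]_s -> set R.
Hypothesis hF : admissible I F.
Implicit Types (n p : 'rV[int]_s) (x : 'I_s -> 'I_2 -> R).

Let filtF : filtration I F := hF.
Let idF n : is_ideal (F n) := filtration_ideal filtF n.
Let cofF n : cofinite m (F n) := filtration_cofinite hI filtF (admissible_pos hF) n.

Lemma hilbert_funE n : hilbert_fun F n = colen (F n).
Proof. exact: length_quotE. Qed.

Lemma red_elt_max x j : (forall i, I i (x i j)) -> m (red_elt x j).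
Proof.
move=> Ix; rewrite /red_elt (bigD1 (Ordinal s_gt0)) //=.
by apply: is_ideal_mulr; [exact: ideal_max | apply: (m_primary_sub hI)].
Qed.

Lemma red_elt_rees_pp x j : (forall i, I i (x i j)) -> rees_pp I de (red_elt x j).
Proof.
move=> Ix; rewrite /rees_pp ifT; last by apply/dleP.
by apply: multipow_de => // i; apply: m_primary_ideal hI i.
Qed.

Lemma red_elt_act x j n z : (forall i, I i (x i j)) -> F n z ->
  F (n + de) (red_elt x j * z).
Proof.
move=> Ix Fz; rewrite mulrC; apply: (filtrationM filtF) => //.
apply: (filtration_multipow filtF).
by apply: multipow_de => // i; apply: m_primary_ideal hI i.
Qed.

Lemma complete_reduction_regular x : complete_reduction I F x ->
  regular_pair (red_elt x 0) (red_elt x 1) /\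
  cofinite m (idsum (principal (red_elt x 0)) (principal (red_elt x 1))).
Proof.
move=> [Ix [N red]]; have idJ :=
  ideal_idsum (ideal_principal (red_elt x 0)) (ideal_principal (red_elt x 1)).
have cJ : cofinite m (idsum (principal (red_elt x 0)) (principal (red_elt x 1))).
  apply: (cofiniteS (cofF (const_mx N%:Z + de))); rewrite -red.
    by rewrite red_idealE; apply: idmul_min => // a b Ja _; apply: is_ideal_mulr.
  by move=> i; rewrite mxE.
have [u [v [mu mv uv]]] := depth2_regular_pair noethR locR depth2.
split=> //; apply: (cofinite_regular_pair noethR locR mu mv uv) => //; exact: red_elt_max.
Qed.

(** The length formula applied to the regular pair of the reduction and to
   A = B = F (n + e): the colon ideal (F (n + e) : J) equals F n, by the vanishing of
   the first local cohomology. *)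
Lemma second_difference x n : complete_reduction I F x -> dle 0 n ->
  local_cohomology_zero (rees_pp I) 1 (rees_gmod filtF) n ->
  (colen (idmul (red_ideal x) (F (n + de))) + colen (F n) =
   colen (red_ideal x) + (colen (F (n + de)) + colen (F (n + de))))%N.
Proof.
move=> cx n0 H1; have [reg cof] := complete_reduction_regular cx.
have [Ix [N red]] := cx.
have := colen_koszul noethR locR reg cof (idF (n + de)) (idF (n + de)) (cofF _) (cofF _).
rewrite -idmul_idsum_principal // -red_idealE -addnA => <-.
congr (_ + colen _)%N; apply/seteqP; split.
  by move=> z Fz; split; apply: red_elt_act.
move=> z [F1 F0]; have [ny _ _] := reg.
apply: (reduction_colon_closed (filtF := filtF) n0 (red_elt_rees_pp (Ix^~ 0))
  (red_elt_rees_pp (Ix^~ 1)) ny H1 _ F0 F1).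
by move=> p pN; rewrite -red_idealE red.
Qed.

Lemma reduction_number_le1 x : complete_reduction I F x ->
  (reduction_number F x <= 1)%N <->
  (forall n, dle 0 n -> idmul (red_ideal x) (F (n + de)) = F (n + de + de)).
Proof.
move=> [_ [N red]]; rewrite /reduction_number; set S := [set k | _].
have [d Sd] : exists d, is_minimum S d.
  by apply: (@is_minimum_ex _ N) => n /dleP nN; apply: red => i; have := nN i; rewrite mxE.
have [Sr minr] := xgetI 0%N Sd; set r := xget _ _ in Sr minr *.
split=> [r1 n /dleP n0|S1].
  by apply: Sr; apply/dleP => i; have := n0 i; rewrite !mxE; move: (n 0 i) => ?; lia.
apply: minr => n /dleP n1; have := S1 (n - de); rewrite subrK; apply.
by apply/dleP => i; have := n1 i; rewrite !mxE; move: (n 0 i) => ?; lia.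
Qed.

Hypothesis hH1 : forall n, dle 0 n ->
  local_cohomology_zero (rees_pp I) 1 (rees_gmod filtF) n.

(** F (n + 2e) contains J F (n + e), and [second_difference] gives the colength of
   the latter, so equality is a numerical condition on the Hilbert function. *)
Lemma reduction_number_le1_hilbert x : complete_reduction I F x ->
  (reduction_number F x <= 1)%N <->
  (forall n, dle 0 n -> (colen (F (n + de + de)) + colen (F n) =
     colen (red_ideal x) + (colen (F (n + de)) + colen (F (n + de))))%N).
Proof.
move=> cx; rewrite (reduction_number_le1 cx); have [Ix _] := cx.
split=> red n n0; first by rewrite -red // second_difference //; apply: hH1.
have [_ cof] := complete_reduction_regular cx.
apply: (colen_eq noethR locR) => //.
- rewrite red_idealE idmul_idsum_principal //; exact: cofinite_scale_sum.
- apply: idmul_min => // a b.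
  rewrite red_idealE => -[_ [_ [[r _ <-] [t _ <-] ->]]] Fb.
  rewrite mulrDl ![red_elt _ _ * _ * b]mulrAC.
  by apply: is_idealD => //; apply: is_ideal_mulr => //; apply: red_elt_act.
- by apply: (@addIn (colen (F n))); rewrite red // second_difference //; apply: hH1.
Qed.

(** The second difference of the Hilbert polynomial along e is the constant
   e0 = length of R/J, since this holds in large degrees. If the Hilbert function is
   given by the polynomial in all nonnegative degrees, its second difference is e0
   there too. *)
Lemma reduction_number_le1_of_hilbert x : complete_reduction I F x ->
  (forall n, dle 0 n -> mpeval (hilbert_poly F) n = (hilbert_fun F n)%:R) ->
  (reduction_number F x <= 1)%N.
Proof.
move=> cx PH; apply/reduction_number_le1_hilbert => // n n0.
have [Ix [N red]] := cx; set e0 := colen (red_ideal x).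
pose P := mpeval (hilbert_poly F).
pose f n := P (n + (de + de)) + (P n + (-2 * P (n + de) + - e0%:R)).
have df : diagonal_poly f := diagonal_poly_second_difference _ _.
have de0 p q : dle 0 p -> dle 0 q -> dle 0 (p + q).
  move=> /dleP p0 /dleP q0; apply/dleP => i; have := p0 i; have := q0 i.
  by rewrite !mxE => ? ?; apply: addr_ge0.
have e_ge0 : dle 0 (de : 'rV[int]_s) by apply/dleP => i; rewrite !mxE.
have PE p : dle 0 p -> P p = (colen (F p))%:R by move=> p0; rewrite -hilbert_funE -PH.
have fE p : dle 0 p -> f p = (colen (F (p + de + de)))%:R + (colen (F p))%:R
    - (e0%:R + 2 * (colen (F (p + de)))%:R).
  move=> p0; have p1 := de0 _ _ p0 e_ge0.
  have p2 : dle 0 (p + (de + de)) by rewrite addrA; apply: de0.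
  rewrite /f (PE _ p2) (PE _ p1) (PE _ p0).
  by rewrite [p + (de + de)]addrA; ring.
have f0 : f n = 0.
  have flarge : for_large (fun p => f p = 0); last exact: (diagonal_poly_eq0 df flarge n).
  exists N => q qN.
  have q0 : dle 0 q by apply/dleP => i; rewrite mxE; apply: le_trans (qN i).
  rewrite fE //; have := second_difference cx q0 (hH1 q0); rewrite -/e0.
  rewrite red; last by move=> i; have := qN i; rewrite !mxE; move: (q 0 i) => ?; lia.
  move=> /(congr1 (fun k => k%:R : rat)); rewrite !natrD => ->; ring.
move: f0; rewrite fE // => /eqP; rewrite subr_eq0 => /eqP E.
by apply/eqP; rewrite -(eqr_nat rat) !natrD E; apply/eqP; ring.
Qed.

(** Both the Hilbert function and the polynomial have second difference e0 along e,
   so their difference g along a diagonal satisfies g k = 2 g (k+1) - g (k+2); it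
   vanishes for large k, hence by descent for all k. *)
Lemma hilbert_of_reduction_number_le1 x (P : {mpoly rat[s]}) : complete_reduction I F x ->
  (reduction_number F x <= 1)%N ->
  for_large (fun n => (hilbert_fun F n)%:R = mpeval P n) ->
  forall n, dle 0 n -> (hilbert_fun F n)%:R = mpeval P n.
Proof.
move=> cx /(reduction_number_le1_hilbert cx) red [N PN] n n0; set e0 := colen (red_ideal x) in red.
pose f p := mpeval P (p + (de + de)) + (mpeval P p + (-2 * mpeval P (p + de) + - e0%:R)).
have df : diagonal_poly f := diagonal_poly_second_difference _ _.
have redQ p : dle 0 p -> (hilbert_fun F (p + (de + de)))%:R + ((hilbert_fun F p)%:R
    + (-2 * (hilbert_fun F (p + de))%:R + - e0%:R)) = 0 :> rat.
  move=> p0; rewrite !hilbert_funE [p + (de + de)]addrA.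
  have := red p p0 => /(congr1 (fun k => k%:R : rat)).
  by rewrite !natrD !addrA => E; rewrite E; ring.
have f0 p : f p = 0.
  have flarge : for_large (fun p => f p = 0); last exact: (diagonal_poly_eq0 df flarge p).
  exists N => q qN.
  have q0 : dle 0 q by apply/dleP => i; rewrite mxE; apply: le_trans (qN i).
  by rewrite /f -!PN ?redQ // => i; have := qN i; rewrite !mxE; move: (q 0 i) => ?; lia.
pose g k := (hilbert_fun F (n + de *+ k))%:R - mpeval P (n + de *+ k).
have gS k : g k = 2 * g k.+1 - g k.+2.
  have n0k : dle 0 (n + de *+ k).
    by apply/dleP => i; move/dleP/(_ i): n0; rewrite !mxE mulmxnE mxE; move: (n 0 i) => ?; lia.
  have := f0 (n + de *+ k); have := redQ _ n0k; rewrite /f /g !mulrSr !addrA => E1 E2.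
  by rewrite -[LHS]subr0 -{1}E1 -[LHS]addr0 -{1}E2; ring.
have g0 j : forall k, (N + \max_i `|n 0%R i| <= k + j)%N -> g k = 0.
  elim: j => [|j IH] k kj; last by rewrite gS !IH ?subr0 ?mulr0 //; lia.
  rewrite /g PN ?subrr // => i; rewrite mxE mulmxnE mxE.
  have : (`|n 0%R i| <= \max_i `|n 0%R i|)%N by apply: (leq_bigmax (F := fun i => `|n 0%R i|)%N).
  by move: kj; move: (n 0 i) (\max_i _)%N => ? ?; lia.
have := g0 _ 0%N (leqnn _); rewrite /g mulr0n addr0 => /eqP.
by rewrite subr_eq0 => /eqP.
Qed.

End HilbertDifferences.

(** * Existence of good complete reductions and of the Hilbert polynomial *)

Section HilbertPolynomial.
Variables (R : comNzRingType) (m : set R).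
Hypothesis noethR : noetherian R.
Hypothesis locR : local_ring m.
Hypothesis dim2 : krull_dim R 2.
Hypothesis depth2 : depth m 2.
Hypothesis resR : infinite_residue_field m.
Variables (s : nat) (I : 'I_s -> set R).
Hypothesis hI : forall i, m_primary m (I i).
Variable F : 'rV[int]_s -> set R.
Hypothesis hF : admissible I F.
Implicit Types (n p : 'rV[int]_s).

Let filtF : filtration I F := hF.
Let idF n : is_ideal (F n) := filtration_ideal filtF n.
Let cofF n : cofinite m (F n) := filtration_cofinite hI filtF (admissible_pos hF) n.

Lemma good_complete_reduction_exists : exists x, good_complete_reduction I F x.
Proof.
have [x [y [Ix Iy xy [M joint]]]] := joint_reductions hI filtF (admissible_pos hF)
  noethR locR dim2 depth2 resR (admissible_finite hF).
exists (fun i j => if j == 0 then x i else y i).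
apply: (good_complete_reduction_of_joint filtF (m_primary_ideal hI) Ix Iy (M := M)).
- by move=> n nM; have [] := joint n nM.
- by move=> n nM; have [] := joint n nM.
- by move=> i; have [] := xy i i.
Qed.

(** The length formula applied to the joint reductions: the mixed second
   differences of the Hilbert function are the lengths of R/(x i, y j). *)
Lemma hilbert_mixed_differences : exists c : 'I_s -> 'I_s -> nat,
  (forall i j, 0 < c i j)%N /\ for_large (fun n => forall i j,
    (hilbert_fun F (n + unitdeg i + unitdeg j) + hilbert_fun F n =
     c i j + hilbert_fun F (n + unitdeg i) + hilbert_fun F (n + unitdeg j))%N).
Proof.
have [x [y [Ix Iy xy [M joint]]]] := joint_reductions hI filtF (admissible_pos hF)
  noethR locR dim2 depth2 resR (admissible_finite hF).
have mI i z : I i z -> m z by apply: (m_primary_sub hI).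
have idm := ideal_max locR.
have cof i j : cofinite m (idsum (principal (x i)) (principal (y j))).
  by apply: (regular_pair_cofinite noethR locR dim2) => //; [apply: mI (Ix i) | apply: mI (Iy j)].
exists (fun i j => colen (idsum (principal (x i)) (principal (y j)))); split=> [i j|].
  apply: (colen_gt0 noethR locR) => //; first exact: ideal_idsum.
  move=> J1; apply: (max_proper locR); move: J1.
  by apply: idsum_min => //; apply: principal_min => //; [apply: mI (Ix i) | apply: mI (Iy j)].
exists M => n nM i j; have [sup gen] := joint n nM.
have actF k a z p : I k a -> F p z -> F (p + unitdeg k) (a * z).
  by move=> Ia Fz; apply: (filtration_act filtF) => //; apply: m_primary_ideal hI k.
rewrite !hilbert_funE.
have := colen_koszul noethR locR (xy i j) (cof i j) (idF (n + unitdeg j)) (idF (n + unitdeg i))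
  (cofF _) (cofF _).
have -> : colon (F (n + unitdeg j)) (y j) `&` colon (F (n + unitdeg i)) (x i) = F n.
  apply/seteqP; split; first by move=> z [_]; apply: sup.
  by move=> z Fz; split; apply: actF.
have -> : idsum (scale (x i) (F (n + unitdeg j))) (scale (y j) (F (n + unitdeg i))) =
    F (n + unitdeg i + unitdeg j).
  apply/seteqP; split; last exact: gen.
  apply: idsum_min => // _ [z Fz <-]; last exact: actF.
  by rewrite addrAC; apply: actF.
lia.
Qed.

Lemma hilbert_polyP : for_large (fun n => (hilbert_fun F n)%:R = mpeval (hilbert_poly F) n).
Proof.
have [c [_ [M cM]]] := hilbert_mixed_differences.
have [|P PE] := @quadratic_function s (fun n => (hilbert_fun F n)%:R)
    (fun i j => (c i j)%:R) M.
  by move=> n nM i j; rewrite -!natrD cM.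
rewrite /hilbert_poly; set S := [set P | _].
by have /(xgetI 0) : S P by exact: PE.
Qed.

(** If n i < 0, the Hilbert function does not depend on its argument in direction i
   near p i = -1, whereas for j <> i the mixed difference of the polynomial in the
   directions i and j is the positive constant c i j. This is where s > 1 is used. *)
Lemma postulation_vector_ge0 n : (1 < s)%N -> postulation_vectors F n -> dle 0 n.
Proof.
move=> s2 post; apply/dleP => i; rewrite mxE leNgt; apply/negP => ni.
have [c [c_gt0 [M cM]]] := hilbert_mixed_differences.
have [N PN] := hilbert_polyP.
have [j ji] : exists j : 'I_s, j != i.
  have [->|i0] := eqVneq i (Ordinal (ltnW s2)); first by exists (Ordinal s2).
  by exists (Ordinal (ltnW s2)); rewrite eq_sym.
pose P := mpeval (hilbert_poly F).
pose f p := P (p + (unitdeg i + unitdeg j)) + (P p + ((-1) * P (p + unitdeg i) +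
  ((-1) * P (p + unitdeg j) + - (c i j)%:R))).
have df : diagonal_poly f.
  have dP := diagonal_poly_mpeval (hilbert_poly F).
  do 2![apply: diagonal_polyD; first by [exact: diagonal_poly_shift | exact: dP]].
  do 2![apply: diagonal_polyD; first by apply: diagonal_polyZ; apply: diagonal_poly_shift].
  exact: diagonal_poly_const.
have f0 : for_large (fun p => f p = 0).
  exists (maxn M N) => p pMN.
  have pM k : M%:Z <= p 0 k by apply: le_trans (pMN k); rewrite lez_nat leq_maxl.
  have pN k : N%:Z <= p 0 k by apply: le_trans (pMN k); rewrite lez_nat leq_maxr.
  rewrite /f /P -!PN //; try (by do ?apply: large_unitdeg).
    have := cM p pM i j; rewrite -[p + unitdeg i + _]addrA => /(congr1 (fun k => k%:R : rat)).
    by rewrite !natrD !addrA => E; rewrite E; ring.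
  by rewrite addrA; do 2!apply: large_unitdeg.
pose p : 'rV[int]_s := \row_k (if k == i then -1 else Num.max 0 (n 0 k)).
have pE k : p 0 k = if k == i then -1 else Num.max 0 (n 0 k) by rewrite mxE.
have np : forall v : 'rV[int]_s, (forall k, 0 <= v 0 k) -> dle n (p + v).
  move=> v v0; apply/dleP => k; have := v0 k; rewrite mxE pE; case: eqP => [->|_].
    by move: ni; move: (n 0 i) (v 0 i) => ? ?; lia.
  by move: (n 0 k) (v 0 k) => ? ?; lia.
have H_eq (q : 'rV[int]_s) : q 0 i = -1 -> hilbert_fun F (q + unitdeg i) = hilbert_fun F q.
  move=> qi; rewrite /hilbert_fun (admissible_pos hF) [in RHS](admissible_pos hF).
  congr (length_quot (F _)); apply/rowP => k; rewrite [LHS]mxE [RHS]mxE [in LHS]mxE unitdegE.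
  case: eqP => [->|_]; last by rewrite addr0.
  by rewrite qi.
have u0 k l : 0 <= unitdeg k 0 l :> int by rewrite unitdegE.
have PH (v : 'rV[int]_s) : (forall k, 0 <= v 0 k) -> P (p + v) = (hilbert_fun F (p + v))%:R.
  by move=> v0; rewrite (post _ (np v v0)).
have := diagonal_poly_eq0 df f0 p; rewrite /f -{2}[p]addr0 !PH //; last 2 first.
- by move=> k; rewrite mxE.
- by move=> k; rewrite mxE addr_ge0.
rewrite addr0 H_eq; last by rewrite pE eqxx.
rewrite [unitdeg i + unitdeg j]addrC [p + (_ + _)]addrA H_eq; last first.
  by rewrite mxE pE eqxx unitdegE eq_sym (negbTE ji) addr0.
have : (0 : rat) < (c i j)%:R by rewrite ltr0n.
by move=> c0 E; move: c0; rewrite -(opprK (c i j)%:R) -[- (c i j)%:R]addr0 -{1}E; lra.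
Qed.

End HilbertPolynomial.

(** * The equivalence *)

Theorem theorem1p14 (R : comNzRingType) (m : set R)
  (hR : cohen_macaulay_local m) (hdim : krull_dim R 2)
  (hres : infinite_residue_field m)
  (s : nat) (hs : (2 <= s)%N)
  (I : 'I_s -> set R) (hI : forall i, m_primary m (I i))
  (F : 'rV[int]_s -> set R) (hF : admissible I F)
  (hH1 : forall n : 'rV[int]_s, dle 0 n ->
     local_cohomology_zero (rees_pp I) 1 (rees_gmod (admissible_filtration hF)) n) :
  [<-> postulation_vectors F = [set n | dle 0 n];
       forall n : 'rV[int]_s, dle 0 n ->
         mpeval (hilbert_poly F) n = (hilbert_fun F n)%:R;
       forall x : 'I_s -> 'I_2 -> R, good_complete_reduction I F x ->
         (reduction_number F x <= 1)%N;
       exists x : 'I_s -> 'I_2 -> R, good_complete_reduction I F x /\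
         (reduction_number F x <= 1)%N].
Proof.
have [noethR locR [d [[Sd maxd] depthd]]] := hR.
have d2 : d = 2%N.
  by apply/eqP; rewrite eqn_leq (hdim.2 d Sd) (maxd 2%N hdim.1).
rewrite {}d2 {Sd maxd} in depthd.
have s_gt0 : (0 < s)%N := ltnW hs.
tfae.
- move=> post n n0; have : postulation_vectors F n by rewrite post.
  by move=> /(_ n) <- //; apply/dleP.
- move=> PH x [cx _].
  exact: (reduction_number_le1_of_hilbert noethR locR depthd s_gt0 hI hH1 cx PH).
- move=> red; have [x gx] := good_complete_reduction_exists noethR locR hdim depthd hres hI hF.
  by exists x; split=> //; apply: red.
- move=> [x [[cx _] rx]]; apply/seteqP; split=> n.
    exact: (postulation_vector_ge0 noethR locR hdim depthd hres hI hF hs).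
  move=> /= /dleP n0 p /dleP np.
  apply: (hilbert_of_reduction_number_le1 noethR locR depthd s_gt0 hI hH1 cx rx).
    exact: (hilbert_polyP noethR locR hdim depthd hres hI hF).
  by apply/dleP => i; apply: le_trans (n0 i) (np i).
Qed.
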